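(* Let $\tau=\sqrt{\frac{1+\sqrt5}{2}}$ and $\sigma=\sqrt{\frac{-1+\sqrt5}{2}}$, and let $\lambda_0$ be the largest real positive root $\lambda$ of the equation $$\begin{aligned}-8=\;&\left(3-i+\sqrt5\,(-\tau+\sigma i)\right)e^{(\tau+\sigma i)/\lambda}+\left(3+i+\sqrt5\,(-\tau-\sigma i)\right)e^{(\tau-\sigma i)/\lambda}\\&+\left(3+i+\sqrt5\,(\tau+\sigma i)\right)e^{(-\tau+\sigma i)/\lambda}+\left(3-i+\sqrt5\,(\tau-\sigma i)\right)e^{(-\tau-\sigma i)/\lambda}.\end{aligned}$$ Then $\lambda_0$ is the largest eigenvalue (in modulus) of the operator $T$ on $L^2([0,1]^3)$ associated with avoiding isolated ascents and descents, and the number $\alpha_n$ of permutations in the symmetric group $\mathfrak{S}_n$ not having any isolated ascents or descents satisfies $$\alpha_n/n!=c\cdot\lambda_0^{\,n-3}+O(r^n),$$ where $c$ and $r$ are two positive constants such that $r<\lambda_0$.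
   Context: The descent word of a permutation $\pi=\pi_1\cdots\pi_n$ is $u(\pi)=u_1\cdots u_{n-1}$ with $u_i=\mathbf{a}$ if $\pi_i<\pi_{i+1}$ and $u_i=\mathbf{b}$ if $\pi_i>\pi_{i+1}$. A permutation has no isolated ascents or descents if its descent word contains neither $\mathbf{bab}$ nor $\mathbf{aba}$ as a factor (three consecutive letters); that is, there is no $i$ with $\pi_i<\pi_{i+1}>\pi_{i+2}<\pi_{i+3}$ or $\pi_i>\pi_{i+1}<\pi_{i+2}>\pi_{i+3}$. The associated operator $T$ on the complex Hilbert space $L^2([0,1]^3)$ is $$T(f)(x_1,x_2,x_3)=\int_0^1\chi(t,x_1,x_2,x_3)\,f(t,x_1,x_2)\,dt,$$ where, for points of $[0,1]^4$ with distinct coordinates, $\chi(y_1,y_2,y_3,y_4)=0$ if $y_1<y_2>y_3<y_4$ or $y_1>y_2<y_3>y_4$, and $\chi(y_1,y_2,y_3,y_4)=1$ otherwise (points with equal coordinates form a null set and are ignored). The asymptotic statement is as $n\to\infty$. *)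

(* Defs.v *)
From HB Require Import structures.
From mathcomp Require Import all_boot all_order all_algebra perm.
From mathcomp Require Import all_classical all_reals all_analysis.
From mathcomp Require Import complex.

Set Implicit Arguments.
Unset Strict Implicit.
Unset Printing Implicit Defensive.

Import Order.TTheory GRing.Theory Num.Theory.
Import numFieldNormedType.Exports.

Local Open Scope classical_set_scope.
Local Open Scope ring_scope.
Local Open Scope complex_scope.

(* Letters are booleans: false stands for a (ascent), true for b (descent). *)
Definition letter_a : bool := false.
Definition letter_b : bool := true.

Definition descent_word (n : nat) (s : 'S_n) : seq bool :=
  let w := [seq nat_of_ord (s i) | i <- enum 'I_n] in
  if w is x :: w' then pairmap (fun y z => (z < y)%N) x w' else [::].

Definition no_isolated (n : nat) (s : 'S_n) : bool :=
  ~~ infix [:: letter_b; letter_a; letter_b] (descent_word s) &&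
  ~~ infix [:: letter_a; letter_b; letter_a] (descent_word s).

Definition alpha (n : nat) : nat := #|[set s : 'S_n | no_isolated s]%SET|.

Definition cube_space (R : realType) :=
  (measurableTypeR R * measurableTypeR R * measurableTypeR R)%type.

Section Operator.
Variable R : realType.

(* On tuples with equal coordinates (a null set) the value is irrelevant. *)
Definition chi (y1 y2 y3 y4 : R) : R :=
  if [&& y1 < y2, y2 > y3 & y3 < y4] || [&& y1 > y2, y2 < y3 & y3 > y4]
  then 0 else 1.

Definition unit_cube : set (cube_space R) :=
  `[0, 1]%classic `*` `[0, 1]%classic `*` `[0, 1]%classic.

Definition lebesgue3 : {measure set (cube_space R) -> \bar R} :=
  (@lebesgue_measure R \x @lebesgue_measure R \x @lebesgue_measure R)%E.

(* An element of L^2([0,1]^3) is represented by a function on R^3 of which only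
   the restriction to the cube matters, up to [ae_eq_cube] below. *)
Definition L2_cube (f : cube_space R -> R[i]) : Prop :=
  [/\ measurable_fun unit_cube (fun x => complex.Re (f x)),
      measurable_fun unit_cube (fun x => complex.Im (f x)) &
      (\int[lebesgue3]_(x in unit_cube) (Normc.normc (f x) ^+ 2)%:E
         < +oo)%E].

Definition ae_eq_cube (f g : cube_space R -> R[i]) : Prop :=
  {ae lebesgue3, forall x, unit_cube x -> f x = g x}.

Definition integral01 (g : R -> R[i]) : R[i] :=
  (\int[lebesgue_measure]_(t in `[0, 1]) complex.Re (g t)) +i*
  (\int[lebesgue_measure]_(t in `[0, 1]) complex.Im (g t)).

Definition T_op (f : cube_space R -> R[i]) : cube_space R -> R[i] :=
  fun x => let: (x1, x2, x3) := x in
    integral01 (fun t => (chi t x1 x2 x3)%:C * f (t, x1, x2)).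

Definition T_eigenvalue (mu : R[i]) : Prop :=
  exists f : cube_space R -> R[i],
    [/\ L2_cube f, ~ ae_eq_cube f (cst 0) &
        ae_eq_cube (T_op f) (fun x => mu * f x)].

Definition cexp (z : R[i]) : R[i] :=
  (expR (complex.Re z) * cos (complex.Im z)) +i*
  (expR (complex.Re z) * sin (complex.Im z)).

Definition tau : R := Num.sqrt ((1 + Num.sqrt 5) / 2).
Definition sigma : R := Num.sqrt ((- 1 + Num.sqrt 5) / 2).

Definition lambda_equation (lambda : R) : Prop :=
  let t := tau%:C in let s := sigma%:C in
  let q := (Num.sqrt 5 : R)%:C in let l := lambda%:C in
  - 8 = (3 - 'i%C + q * (- t + s * 'i%C)) * cexp ((t + s * 'i%C) / l)
      + (3 + 'i%C + q * (- t - s * 'i%C)) * cexp ((t - s * 'i%C) / l)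
      + (3 + 'i%C + q * (t + s * 'i%C)) * cexp ((- t + s * 'i%C) / l)
      + (3 - 'i%C + q * (t - s * 'i%C)) * cexp ((- t - s * 'i%C) / l).

Definition largest_positive_root (lambda0 : R) : Prop :=
  [/\ 0 < lambda0, lambda_equation lambda0 &
      forall lambda : R, 0 < lambda -> lambda_equation lambda ->
        lambda <= lambda0].

(* "The" largest in modulus: every other eigenvalue is strictly smaller. *)
Definition largest_T_eigenvalue (mu0 : R[i]) : Prop :=
  T_eigenvalue mu0 /\
  forall mu : R[i], T_eigenvalue mu -> mu != mu0 ->
    Normc.normc mu < Normc.normc mu0.

End Operator.

(* Main.v *)
Require Import Defs.
From HB Require Import structures.
From mathcomp Require Import all_boot all_order all_algebra perm.
From mathcomp Require Import all_classical all_reals all_analysis.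
From mathcomp Require Import measurable_realfun complex ring lra zify.

Set Implicit Arguments.
Unset Strict Implicit.
Unset Printing Implicit Defensive.

Import Order.TTheory GRing.Theory Num.Theory.
Import numFieldNormedType.Exports.

Local Open Scope classical_set_scope.
Local Open Scope ring_scope.

(* After two applications of T a function depends only on its first coordinate
   and on the letters v, w of its descent word, so T reduces to the operator
     (K f)_vw (x) = [avw allowed] int_0^x f_av + [bvw allowed] int_x^1 f_bv
   on quadruples of continuous functions on [0,1].  Some power of K squeezes
   every nonnegative quadruple between two multiples of a fixed profile; the
   resulting contraction of the ratio of two orbits yields a positive
   eigenfunction phi, with eigenvalue lambda, and a spectral gap
   K^n f = k_f lambda^n phi + O((rho lambda)^n) with rho < 1.  Hence every other
   eigenvalue is smaller in modulus.  Bernstein polynomials count the relative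
   position of the last letter, which expresses alpha_n / n! through the iterates
   of K on the constant 1 and gives the asymptotics.
   An eigenfunction of K solves a linear differential system whose solutions are
   spanned by exp(z x / lambda) with z^4 = z^2 + 1, that is z = +-tau, +-i sigma,
   and splits into parts that are even and odd under exchanging a, b and x, 1 - x.
   The boundary conditions of the two parts have determinants whose product is,
   up to a positive factor, the given equation.  So every positive root is an
   eigenvalue of K, hence at most lambda, and lambda is a root because
   symmetrizing phi > 0 gives a nonzero even eigenfunction. *)

(** The eigenpair and the gap come from explicit inequalities; no theory of compact operators is
    used. The obstacle is that K does not make functions positive everywhere: (K f)_ab vanishes at 0
    and (K f)_ba at 1. Iterates are therefore compared with [profile], which has just these zeros.
    The size of a quadruple is measured by [weight], whose densities (1 - t)^2, 1 - t, t, t^2 on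
    f_aa, f_ab, f_ba, f_bb discount mass near an endpoint where the integrals hardly see it. The
    power is 13 = 9 + 3 + 1: nine steps let every part of the weight reach the aa part, three turn
    that part into a pointwise bound on the components with equal letters, one produces the zeros of
    the other two. Nine steps suffice because the aa and bb weights feed each other in two steps as
    well as in three, so there is no periodicity. An L^2 eigenfunction with nonzero eigenvalue is
    brought to the continuous setting by applying T twice, to reach functions of a letter pattern,
    and K once more, to make them continuous. *)

Section Primitives.
Variable R : realType.
Notation mu := (@lebesgue_measure R).
Implicit Types (f g F : R -> R) (a b c x y : R).

Definition cont01 f := {within `[0, 1], continuous f}.

Definition lint f x := \int[mu]_(t in `[0, x]) f t.
Definition rint f x := \int[mu]_(t in `[x, 1]) f t.

Lemma lintE f x : lint f x = \int[mu]_(t in `[0, x]) f t. Proof. by []. Qed.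

Lemma rintE f x : rint f x = \int[mu]_(t in `[x, 1]) f t. Proof. by []. Qed.

Lemma cont01_sub f a b : 0 <= a -> b <= 1 -> cont01 f -> {within `[a, b], continuous f}.
Proof.
by move=> a0 b1; apply: continuous_subspaceW; apply: subset_itv; rewrite bnd_simp.
Qed.

Lemma cont01_integrable f a b : 0 <= a -> b <= 1 -> cont01 f ->
  mu.-integrable `[a, b] (EFin \o f).
Proof.
move=> a0 b1 cf; apply: continuous_compact_integrable; first exact: segment_compact.
exact: cont01_sub cf.
Qed.

Lemma continuous_cont01 f : continuous f -> cont01 f.
Proof. exact: continuous_subspaceT. Qed.

Lemma cont01D f g : cont01 f -> cont01 g -> cont01 (fun x => f x + g x).
Proof. by move=> cf cg x; apply: continuousD; [exact: cf|exact: cg]. Qed.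

Lemma cont01B f g : cont01 f -> cont01 g -> cont01 (fun x => f x - g x).
Proof. by move=> cf cg x; apply: continuousB; [exact: cf|exact: cg]. Qed.

Lemma cont01M f g : cont01 f -> cont01 g -> cont01 (fun x => f x * g x).
Proof. by move=> cf cg x; apply: continuousM; [exact: cf|exact: cg]. Qed.

Lemma cont01_cst c : cont01 (fun=> c).
Proof. by apply: continuous_cont01 => x; exact: cvg_cst. Qed.

Lemma cont01Z c f : cont01 f -> cont01 (fun x => c * f x).
Proof. by apply: cont01M; exact: cont01_cst. Qed.

Lemma cont01_congr f g : (forall x, 0 <= x <= 1 -> f x = g x) -> cont01 f -> cont01 g.
Proof.
by move=> fg; apply: subspace_eq_continuous => x; rewrite inE/= in_itv/=; exact: fg.
Qed.

Lemma lint_rint f x : cont01 f -> 0 <= x <= 1 -> rint f x = lint f 1 - lint f x.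
Proof.
move=> cf /andP[x0 x1]; rewrite /lint Rintegral_itvB//; last first.
  exact: cont01_integrable.
rewrite Rintegral_itv_obnd_cbnd//.
apply: (@integrableS _ _ _ mu `[0, 1]%classic) => //; last exact: cont01_integrable.
by apply: subset_itvr; rewrite bnd_simp.
Qed.

Lemma lint0 f : lint f 0 = 0.
Proof. by rewrite /lint set_itv1 Rintegral_set1. Qed.

Lemma cont01_lint f : cont01 f -> cont01 (lint f).
Proof.
move=> cf; apply: (@parameterized_integral_continuous R 0 1 f) => //.
exact: cont01_integrable.
Qed.

Lemma cont01_rint f : cont01 f -> cont01 (rint f).
Proof.
move=> cf; apply: (@cont01_congr (fun x => lint f 1 - lint f x)).
  by move=> x x01; rewrite lint_rint.
apply: cont01B; [exact: cont01_cst|exact: cont01_lint].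
Qed.

Lemma lintD f g x : x <= 1 -> cont01 f -> cont01 g ->
  lint (fun x => f x + g x) x = lint f x + lint g x.
Proof. by move=> x1 cf cg; rewrite /lint RintegralD//; exact: cont01_integrable. Qed.

Lemma lintZ c f x : x <= 1 -> cont01 f -> lint (fun x => c * f x) x = c * lint f x.
Proof. by move=> x1 cf; rewrite /lint RintegralZl//; exact: cont01_integrable. Qed.

Lemma le_lint f g x : x <= 1 -> cont01 f -> cont01 g ->
  (forall y, 0 <= y <= 1 -> f y <= g y) -> lint f x <= lint g x.
Proof.
move=> x1 cf cg fg; apply: le_Rintegral => //; try exact: cont01_integrable.
by move=> y /=; rewrite in_itv/= => /andP[y0 yx]; apply: fg; rewrite y0 (le_trans yx).
Qed.

Lemma le_rint f g x : 0 <= x -> cont01 f -> cont01 g ->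
  (forall y, 0 <= y <= 1 -> f y <= g y) -> rint f x <= rint g x.
Proof.
move=> x1 cf cg fg; apply: le_Rintegral => //; try exact: cont01_integrable.
by move=> y /=; rewrite in_itv/= => /andP[y0 yx]; apply: fg; rewrite yx andbT (le_trans x1).
Qed.

Lemma lint_ge0 f x : x <= 1 -> (forall y, 0 <= y <= 1 -> 0 <= f y) -> 0 <= lint f x.
Proof.
move=> x1 f0; apply: Rintegral_ge0 => y /=; rewrite in_itv/= => /andP[y0 yx].
by apply: f0; rewrite y0 (le_trans yx).
Qed.

Lemma rint_ge0 f x : 0 <= x -> (forall y, 0 <= y <= 1 -> 0 <= f y) -> 0 <= rint f x.
Proof.
move=> x1 f0; apply: Rintegral_ge0 => y /=; rewrite in_itv/= => /andP[y0 yx].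
by apply: f0; rewrite yx andbT (le_trans x1).
Qed.

Lemma eq_lint f g x : x <= 1 -> (forall y, 0 <= y <= 1 -> f y = g y) -> lint f x = lint g x.
Proof.
move=> x1 fg; apply: eq_Rintegral => y; rewrite inE/= in_itv/= => /andP[y0 yx].
by apply: fg; rewrite y0 (le_trans yx).
Qed.

Lemma eq_rint f g x : 0 <= x -> (forall y, 0 <= y <= 1 -> f y = g y) -> rint f x = rint g x.
Proof.
move=> x1 fg; apply: eq_Rintegral => y; rewrite inE/= in_itv/= => /andP[y0 yx].
by apply: fg; rewrite yx andbT (le_trans x1).
Qed.

Lemma is_derive_lint f x : cont01 f -> 0 < x < 1 -> is_derive x 1 (lint f) (f x).
Proof.
move=> cf /andP[x0 x1].
have cfx : {for x, continuous f}.
  by apply: (@within_continuous_continuous _ _ _ 0 1) => //; rewrite in_itv/= x0.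
have [] := @continuous_FTC1_closed R f 0 x 1 x1 _ x0 cfx.
  exact: cont01_integrable.
by move=> dF F'; apply: DeriveDef => //; rewrite -derive1E.
Qed.

(** The fundamental theorem with differentiability in the open interval only, which is what
    [is_derive_lint] provides; explicit integrals below are evaluated through it. *)
Lemma lint_unique f F x : cont01 f -> cont01 F ->
  (forall y, 0 < y < 1 -> is_derive y 1 F (f y)) ->
  0 <= x <= 1 -> lint f x = F x - F 0.
Proof.
move=> cf cF dF /andP[x0 x1].
move: x0; rewrite le_eqVlt => /predU1P[<-|x0]; first by rewrite lint0 subrr.
rewrite /lint /Rintegral (@continuous_FTC2 R f F 0 x)//=.
- exact: cont01_sub cf.
- have cFx : {within `[0, x], continuous F} by exact: cont01_sub cF.
  move/continuous_within_itvP : cFx => /(_ x0)[_ c0 cx]; split => //.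
  move=> y; rewrite in_itv/= => /andP[y0 yx].
  by have [] : is_derive y 1 F (f y) by apply: dF; rewrite y0 (lt_le_trans yx).
- move=> y; rewrite in_itv/= => /andP[y0 yx]; rewrite derive1E.
  by have [] : is_derive y 1 F (f y) by apply: dF; rewrite y0 (lt_le_trans yx).
Qed.
End Primitives.
Opaque lint rint.

(** * Integration by parts and reflection on [0,1] *)

Section ByParts.
Variable R : realType.
Implicit Types (f g h w W F : R -> R) (x y : R).

Lemma cont01_id : cont01 (fun x : R => x).
Proof. by apply: continuous_cont01 => x; exact: cvg_id. Qed.

Lemma cont01X n f : cont01 f -> cont01 (fun x => f x ^+ n).
Proof.
move=> cf; elim: n => [|n IH]; first exact: cont01_cst.
by apply: (@cont01_congr _ (fun x => f x * f x ^+ n)) => [x _|];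
  [rewrite exprS|exact: cont01M].
Qed.

Lemma cont01P f : cont01 f <-> forall x, 0 <= x <= 1 -> forall e, 0 < e ->
  exists2 d, 0 < d & forall y, 0 <= y <= 1 -> `|x - y| < d -> `|f x - f y| < e.
Proof.
split=> [/subspace_continuousP cf x x01 e e0|cf].
  have {}x01 : `[0, 1]%classic x by rewrite /= in_itv.
  move/cvgrPdist_lt : (cf _ x01) => /(_ _ e0)[/= d d0 fd].
  by exists d => // y y01 xy; apply: fd; rewrite //= in_itv.
apply/subspace_continuousP => x /=; rewrite in_itv/= => x01.
apply/cvgrPdist_lt => e e0; have [d d0 fd] := cf _ x01 _ e0.
by exists d => //= y /= xy; rewrite in_itv/= => y01; exact: fd.
Qed.

Lemma cont01_onem f : cont01 f -> cont01 (fun x => f (1 - x)).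
Proof.
move=> /cont01P cf; apply/cont01P => x x01 e e0.
have x01' : 0 <= 1 - x <= 1 by move: x01 => /andP[? ?]; apply/andP; split; lra.
have [d d0 fd] := cf _ x01' _ e0; exists d => // y /andP[y0 y1] xy.
apply: fd; first by apply/andP; split; lra.
by rewrite (_ : 1 - x - (1 - y) = - (x - y)) ?normrN//; ring.
Qed.

(** W x - W 1 is the integral of w over [x, 1]: a density against a primitive of f becomes a density
    against f, as if the order of integration were exchanged. *)
Lemma lint_bypart w W f : cont01 w -> cont01 W -> cont01 f ->
  (forall y, 0 < y < 1 -> is_derive y 1 W (- w y)) ->
  lint (fun x => w x * lint f x) 1 = lint (fun x => (W x - W 1) * f x) 1.
Proof.
move=> cw cW cf dW.
have cif := cont01_lint cf.
(* F vanishes at both ends, so the integral of its derivative is zero. *)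
pose F x := W 1 * lint f x - W x * lint f x.
have cF : cont01 F.
  by apply: cont01B; [exact: cont01Z|exact: cont01M].
have e : lint (fun x => w x * lint f x + (W 1 - W x) * f x) 1 = F 1 - F 0.
  apply: lint_unique => //; last by rewrite ler01 lexx.
    by apply: cont01D; apply: cont01M => //; apply: cont01B => //; exact: cont01_cst.
  move=> y y01; have dWy := dW _ y01; have dfy := is_derive_lint cf y01.
  rewrite /F; apply: is_derive_eq; rewrite /GRing.scale/=; ring.
have {e} : lint (fun x => w x * lint f x + (W 1 - W x) * f x) 1 = 0.
  by rewrite e /F lint0; ring.
rewrite lintD//; last 2 first.
- exact: cont01M.
- by apply: cont01M => //; apply: cont01B => //; exact: cont01_cst.
move/eqP; rewrite addr_eq0 => /eqP ->.
rewrite -mulN1r -lintZ//; last first.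
  by apply: cont01M => //; apply: cont01B => //; exact: cont01_cst.
by apply: eq_lint => // x _; ring.
Qed.

Lemma rint_bypart w W f : cont01 w -> cont01 W -> cont01 f ->
  (forall y, 0 < y < 1 -> is_derive y 1 W (- w y)) ->
  lint (fun x => w x * rint f x) 1 = lint (fun x => (W 0 - W x) * f x) 1.
Proof.
move=> cw cW cf dW; have cif := cont01_lint cf.
have Iw : lint w 1 = W 0 - W 1.
  have -> : lint w 1 = - W 1 - - W 0; last by ring.
  apply: (@lint_unique _ w (fun x => - W x)); rewrite ?ler01 ?lexx//.
    by apply: (@cont01_congr _ (fun x => (-1) * W x)) => [x _|]; [ring|exact: cont01Z].
  by move=> y y01; have dWy := dW _ y01; apply: is_derive_eq; rewrite opprK.
rewrite (@eq_lint _ _ (fun x => lint f 1 * w x + (-1) * (w x * lint f x)))//; last first.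
  by move=> x x01; rewrite lint_rint//; ring.
rewrite lintD//; last 2 first.
- exact: cont01Z.
- by apply: cont01Z; exact: cont01M.
rewrite !lintZ//; last exact: cont01M.
rewrite (lint_bypart cw cW)// Iw [LHS](_ : _ = (W 0 - W 1) * lint f 1 + (-1) * lint (fun x => (W x - W 1) * f x) 1); last by ring.
rewrite -!lintZ//; last by apply: cont01M => //; apply: cont01B => //; exact: cont01_cst.
rewrite -lintD//.
- by apply: eq_lint => // x _; ring.
- exact: cont01Z.
- by apply: cont01Z; apply: cont01M => //; apply: cont01B => //; exact: cont01_cst.
Qed.

Lemma lint_onem f x : cont01 f -> 0 <= x <= 1 ->
  lint (fun y => f (1 - y)) x = rint f (1 - x).
Proof.
move=> cf /andP[x0 x1]; have cf' := cont01_onem cf.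
have cif := cont01_lint cf.
transitivity (- lint f (1 - x) - - lint f (1 - 0)); last first.
  by rewrite subr0 lint_rint// ?opprK 1?addrC//; apply/andP; split; lra.
apply: (@lint_unique _ _ (fun y => - lint f (1 - y))) => //; last by rewrite x0.
  apply: (@cont01_congr _ (fun x => (-1) * lint f (1 - x))) => [y _|]; first by ring.
  by apply: cont01Z; exact: (cont01_onem cif).
move=> y /andP[y0 y1].
have d1 : is_derive (1 - y) 1 (lint f) (f (1 - y)).
  by apply: is_derive_lint => //; apply/andP; split; lra.
have d2 : is_derive y 1 (fun y : R => 1 - y) (-1).
  by apply: is_derive_eq; rewrite add0r mul1r.
have d3 := @is_derive1_comp _ (lint f) (fun y => 1 - y) y _ _ d1 d2.
by apply: is_derive_eq; rewrite mulrN1 opprK.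
Qed.

Lemma rint_onem f x : cont01 f -> 0 <= x <= 1 ->
  rint (fun y => f (1 - y)) x = lint f (1 - x).
Proof.
move=> cf /andP[x0 x1].
rewrite -{1}(subKr 1 x) -lint_onem; last 2 first.
- exact: cont01_onem.
- by apply/andP; split; lra.
by apply: eq_lint => [|y _]; [lra|rewrite subKr].
Qed.
End ByParts.

(** * The transfer operator on quadruples: linearity, positivity, symmetry *)

Definition vec4 (R : realType) := bool -> bool -> R -> R.

Definition cont4 (R : realType) (f : vec4 R) := forall v w, cont01 (f v w).

Ltac cont01_step := lazymatch goal with
  | |- cont01 (fun x => x) => exact: cont01_id
  | |- cont01 (fun _ => ?c) => exact: cont01_cst
  | |- cont01 (fun x => @?f x + (- @?g x)) => apply: (@cont01B _ f g)
  | |- cont01 (fun x => @?f x + @?g x) => apply: (@cont01D _ f g)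
  | |- cont01 (fun x => @?f x * @?g x) => apply: (@cont01M _ f g)
  | |- cont01 (fun x => @?f x ^+ ?n) => apply: (@cont01X _ n f)
  | |- cont01 (lint _) => apply: cont01_lint
  | |- cont01 (fun x => lint ?f x) => apply: (@cont01_lint _ f)
  | |- cont01 (rint _) => apply: cont01_rint
  | |- cont01 (fun x => rint ?f x) => apply: (@cont01_rint _ f)
  | h : forall v w, cont01 (?f v w) |- cont01 (?f _ _) => apply: h
  | h : forall v w, cont01 (?f v w) |- cont01 (fun x => ?f _ _ x) => apply: h
  | h : cont4 ?f |- cont01 (?f _ _) => apply: h
  | h : cont4 ?f |- cont01 (fun x => ?f _ _ x) => apply: h
  | |- cont01 _ => assumption
  end.
Ltac cont01 := repeat cont01_step.

Section TransferOperator.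
Variable R : realType.
Local Notation vec4 := (vec4 R).

Implicit Types (f g h : vec4) (u v w : bool) (x y c : R).

Definition allowed u v w := (u == v) || (v == w).

Definition transfer f : vec4 := fun v w x =>
  (allowed false v w)%:R * lint (f false v) x + (allowed true v w)%:R * rint (f true v) x.

Definition le4 f g := forall v w x, 0 <= x <= 1 -> f v w x <= g v w x.

Definition zero4 : vec4 := fun _ _ _ => 0.

Definition lin4 c f d g : vec4 := fun v w x => c * f v w x + d * g v w x.

(** The trace of complementing a permutation, which reverses the order of the values and exchanges
    ascents and descents. *)
Definition flip4 f : vec4 := fun v w x => f (~~ v) (~~ w) (1 - x).

Lemma cont4_transfer f : cont4 f -> cont4 (transfer f).
Proof. by move=> cf v w; apply: cont01D; apply: cont01Z; cont01. Qed.

Lemma cont4_lin c f d g : cont4 f -> cont4 g -> cont4 (lin4 c f d g).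
Proof. by move=> cf cg v w; apply: cont01D; apply: cont01Z; cont01. Qed.

Lemma cont4_flip f : cont4 f -> cont4 (flip4 f).
Proof. by move=> cf v w; apply: cont01_onem. Qed.

Lemma cont4_iter n f : cont4 f -> cont4 (iter n transfer f).
Proof. by move=> cf; elim: n => //= n IH; exact: cont4_transfer. Qed.

Lemma le_transfer f g : cont4 f -> cont4 g -> le4 f g -> le4 (transfer f) (transfer g).
Proof.
move=> cf cg fg v w x x01; have /andP[x0 x1] := x01.
by apply: lerD; apply: ler_wpM2l => //; [apply: le_lint|apply: le_rint] => // y y01;
  apply: fg.
Qed.

Lemma transfer_ge0 f : le4 zero4 f -> le4 zero4 (transfer f).
Proof.
move=> f0 v w x /andP[x0 x1].
by apply: addr_ge0; apply: mulr_ge0 => //; [apply: lint_ge0|apply: rint_ge0] => // y y01;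
  apply: f0.
Qed.

Lemma iter_transfer_ge0 n f : le4 zero4 f -> le4 zero4 (iter n transfer f).
Proof. by move=> f0; elim: n => //= n IH; exact: transfer_ge0. Qed.

Lemma le_iter_transfer n f g : cont4 f -> cont4 g -> le4 f g ->
  le4 (iter n transfer f) (iter n transfer g).
Proof.
move=> cf cg fg; elim: n => //= n IH.
by apply: le_transfer => //; exact: cont4_iter.
Qed.

Lemma transfer_congr f g : (forall v w x, 0 <= x <= 1 -> f v w x = g v w x) ->
  forall v w x, 0 <= x <= 1 -> transfer f v w x = transfer g v w x.
Proof.
move=> fg v w x /andP[x0 x1].
by congr (_ * _ + _ * _); [apply: eq_lint|apply: eq_rint] => // y; apply: fg.
Qed.

Lemma transfer_lin c f d g v w x : cont4 f -> cont4 g -> 0 <= x <= 1 ->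
  transfer (lin4 c f d g) v w x = lin4 c (transfer f) d (transfer g) v w x.
Proof.
move=> cf cg x01; have /andP[x0 x1] := x01.
have cl u : cont01 (fun y => c * f u v y + d * g u v y) by cont01.
rewrite /transfer /lin4 !lint_rint // !lintD ?lintZ//; cont01.
ring.
Qed.

Lemma iter_transfer_lin n c f d g v w x : cont4 f -> cont4 g -> 0 <= x <= 1 ->
  iter n transfer (lin4 c f d g) v w x =
  lin4 c (iter n transfer f) d (iter n transfer g) v w x.
Proof.
move=> cf cg; elim: n v w x => // n IH v w x x01; rewrite !iterS.
by rewrite (transfer_congr IH)// transfer_lin//; exact: cont4_iter.
Qed.

Lemma transfer_flip f v w x : cont4 f -> 0 <= x <= 1 ->
  transfer (flip4 f) v w x = flip4 (transfer f) v w x.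
Proof.
move=> cf x01; rewrite /transfer /flip4 lint_onem// rint_onem//=.
by rewrite addrC /allowed; move: v w => [] [].
Qed.

Lemma iter_transfer_flip n f v w x : cont4 f -> 0 <= x <= 1 ->
  iter n transfer (flip4 f) v w x = flip4 (iter n transfer f) v w x.
Proof.
move=> cf; elim: n v w x => // n IH v w x x01; rewrite !iterS.
by rewrite (transfer_congr IH)// transfer_flip//; exact: cont4_iter.
Qed.

Lemma transfer_aa f x : transfer f false false x = lint (f false false) x + rint (f true false) x.
Proof. by rewrite /transfer !mul1r. Qed.
Lemma transfer_ab f x : transfer f false true x = lint (f false false) x.
Proof. by rewrite /transfer !mul1r mul0r addr0. Qed.
Lemma transfer_ba f x : transfer f true false x = rint (f true true) x.
Proof. by rewrite /transfer !mul1r mul0r add0r. Qed.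
Lemma transfer_bb f x : transfer f true true x = lint (f false true) x + rint (f true true) x.
Proof. by rewrite /transfer !mul1r. Qed.

End TransferOperator.
Arguments zero4 : clear implicits.
Arguments cont4_iter {R} n {f}.
Arguments iter_transfer_ge0 {R} n {f}.

(** * Weights of a nonnegative quadruple and how the operator moves them *)

Section Estimates.
Variable R : realType.
Implicit Types (f g h : vec4 R) (u v w : bool) (x y c : R).

(** Up to the factor 2, the density (1 - t)^2 is what integrating f_aa twice from 0 and then over
    [0, 1] produces. The density t of [wt_ba] arises likewise from a single integral of f_ba up to
    1. *)
Definition wt_aa f := lint (fun t => (1 - t) ^+ 2 * f false false t) 1.
Definition wt_ba f := lint (fun t => t * f true false t) 1.
Definition weight f := wt_aa f + wt_ba f + (wt_aa (flip4 f) + wt_ba (flip4 f)).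
Ltac generalize_weights := repeat match goal with
  | |- context [wt_aa ?f] => generalize (wt_aa f); intro
  | |- context [wt_ba ?f] => generalize (wt_ba f); intro
  end.

Definition profile : vec4 R := fun v w x => if v == w then 1 else if v then 1 - x else x.

Lemma ge0_flip4 f : le4 (zero4 R) f -> le4 (zero4 R) (flip4 f).
Proof. by move=> f0 v w x /andP[x0 x1]; apply: (f0 (~~ v) (~~ w)); apply/andP; split; lra. Qed.

Lemma flip4K f : flip4 (flip4 f) = f.
Proof. by apply/funext => v; apply/funext => w; apply/funext => x; rewrite /flip4 !negbK subKr. Qed.

Lemma weight_flip f : weight (flip4 f) = weight f.
Proof. by rewrite /weight flip4K addrC. Qed.

Lemma wt_aa_transfer f : cont4 f -> wt_aa (transfer f) =
  lint (fun t => (1 - t) ^+ 3 / 3 * f false false t) 1 +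
  lint (fun t => (1 - (1 - t) ^+ 3) / 3 * f true false t) 1.
Proof.
move=> cf; rewrite /wt_aa.
have dW y : 0 < y < 1 -> is_derive y 1 (fun t : R => (1 - t) ^+ 3 / 3) (- (1 - y) ^+ 2).
  by move=> _; apply: is_derive_eq; rewrite /GRing.scale/=; field.
have cW : cont01 (fun t : R => (1 - t) ^+ 3 / 3) by cont01.
have cw : cont01 (fun t : R => (1 - t) ^+ 2) by cont01.
rewrite (@eq_lint _ _ (fun t => (1 - t) ^+ 2 * lint (f false false) t +
   (1 - t) ^+ 2 * rint (f true false) t))//; last first.
  by move=> y _; rewrite transfer_aa; ring.
rewrite lintD//; [|by cont01|by cont01].
rewrite (lint_bypart cw cW _ dW)// (rint_bypart cw cW _ dW)//.
by congr (_ + _); apply: eq_lint => // y _; field.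
Qed.

Lemma wt_ba_transfer f : cont4 f -> wt_ba (transfer f) =
  lint (fun t => t ^+ 2 / 2 * f true true t) 1.
Proof.
move=> cf; rewrite /wt_ba.
have dW y : 0 < y < 1 -> is_derive y 1 (fun t : R => - t ^+ 2 / 2) (- y).
  by move=> _; apply: is_derive_eq; rewrite /GRing.scale/=; field.
have cW : cont01 (fun t : R => - t ^+ 2 / 2).
  by apply: (@cont01_congr _ (fun t : R => t ^+ 2 * (- 1 / 2))) => [t _|]; [ring|cont01].
rewrite (@eq_lint _ _ (fun t => t * rint (f true true) t))//; last first.
  by move=> y _; rewrite transfer_ba.
rewrite (rint_bypart _ cW _ dW)//; last by cont01.
by apply: eq_lint => // y _; field.
Qed.

Lemma wt_aa_flip f : cont4 f -> wt_aa (flip4 f) = lint (fun t => t ^+ 2 * f true true t) 1.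
Proof.
move=> cf; rewrite /wt_aa /flip4 /=.
have cg : cont01 (fun t => t ^+ 2 * f true true t) by cont01.
have -> : lint (fun t => t ^+ 2 * f true true t) 1 = rint (fun t => t ^+ 2 * f true true t) (1 - 1).
  by rewrite subrr.
by rewrite -lint_onem// ler01 lexx.
Qed.

Lemma wt_aa_ge0 f : le4 (zero4 R) f -> 0 <= wt_aa f.
Proof. by move=> f0; apply: lint_ge0 => // y y01; rewrite mulr_ge0 ?exprn_even_ge0//; exact: f0. Qed.

Lemma wt_ba_ge0 f : le4 (zero4 R) f -> 0 <= wt_ba f.
Proof.
by move=> f0; apply: lint_ge0 => // y /[dup] /andP[y0 y1] y01; rewrite mulr_ge0//; exact: f0.
Qed.

Lemma weight_ge0 f : le4 (zero4 R) f -> 0 <= weight f.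
Proof.
by move=> f0; have f0' := ge0_flip4 f0; rewrite !addr_ge0 ?wt_aa_ge0 ?wt_ba_ge0.
Qed.

(** Only the f_ba term is kept: the density (1 - t)^3 on f_aa dominates no multiple of (1 - t)^2
    near 1. *)
Lemma wt_aa_transfer_ge f : cont4 f -> le4 (zero4 R) f -> wt_ba f / 3 <= wt_aa (transfer f).
Proof.
move=> cf f0; rewrite wt_aa_transfer// ler_wpDl//.
  apply: lint_ge0 => // y /[dup] /andP[y0 y1] y01; rewrite !mulr_ge0 ?exprn_ge0 ?subr_ge0//.
  exact: f0.
rewrite mulrC -lintZ//; last by cont01.
apply: le_lint; [by []|by apply: cont01Z; cont01|by cont01|].
move=> y /[dup] /andP[y0 y1] y01.
rewrite mulrA; apply: ler_wpM2r; first exact: f0.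
rewrite mulrC; apply: ler_wpM2r => //.
have : (1 - y) ^+ 3 <= 1 - y by rewrite -[leRHS]expr1 ler_wiXn2l//; lra.
lra.
Qed.

Lemma wt_aa_transfer_le f : cont4 f -> le4 (zero4 R) f -> wt_aa (transfer f) <= wt_aa f + wt_ba f.
Proof.
move=> cf f0; rewrite wt_aa_transfer//; apply: lerD; apply: le_lint => //; try cont01.
  move=> y /[dup] /andP[y0 y1] y01; apply: ler_wpM2r; first exact: f0.
  have : (1 - y) ^+ 3 <= (1 - y) ^+ 2 by rewrite ler_wiXn2l//; lra.
  have : 0 <= (1 - y) ^+ 2 by rewrite exprn_ge0//; lra.
  lra.
move=> y /[dup] /andP[y0 y1] y01; apply: ler_wpM2r; first exact: f0.
have -> : (1 - (1 - y) ^+ 3) / 3 = y - y ^+ 2 * (1 - y / 3) by field.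
by rewrite gerBl mulr_ge0// ?exprn_ge0//; lra.
Qed.

Lemma wt_ba_transfer_flip f : cont4 f -> wt_ba (transfer f) = wt_aa (flip4 f) / 2.
Proof.
move=> cf; rewrite wt_ba_transfer// wt_aa_flip// mulrC -lintZ//; last by cont01.
by apply: eq_lint => // y _; field.
Qed.

Lemma weight_congr f g : (forall v w x, 0 <= x <= 1 -> f v w x = g v w x) -> weight f = weight g.
Proof.
move=> fg; have fg' v w x : 0 <= x <= 1 -> flip4 f v w x = flip4 g v w x.
  by move=> /andP[x0 x1]; apply: fg; apply/andP; split; lra.
by congr (_ + _ + (_ + _)); apply: eq_lint => // y y01; congr (_ * _); auto.
Qed.

Lemma wt_aa_congr f g : (forall v w x, 0 <= x <= 1 -> f v w x = g v w x) -> wt_aa f = wt_aa g.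
Proof. by move=> fg; apply: eq_lint => // y y01; congr (_ * _); auto. Qed.

Lemma wt_ba_congr f g : (forall v w x, 0 <= x <= 1 -> f v w x = g v w x) -> wt_ba f = wt_ba g.
Proof. by move=> fg; apply: eq_lint => // y y01; congr (_ * _); auto. Qed.

Lemma wt_aa_flip_iter n f : cont4 f ->
  wt_aa (flip4 (iter n (@transfer R) f)) = wt_aa (iter n (@transfer R) (flip4 f)).
Proof. by move=> cf; apply: wt_aa_congr => v w x x01; rewrite iter_transfer_flip. Qed.

Lemma wt_ba_flip_iter n f : cont4 f ->
  wt_ba (flip4 (iter n (@transfer R) f)) = wt_ba (iter n (@transfer R) (flip4 f)).
Proof. by move=> cf; apply: wt_ba_congr => v w x x01; rewrite iter_transfer_flip. Qed.

(** Each part of the weight is passed on in the cyclic order bb, ba, aa, ab, at the cost of a factor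
    2 or 3. *)
Lemma weight_transfer_ge f : cont4 f -> le4 (zero4 R) f -> weight f / 3 <= weight (transfer f).
Proof.
move=> cf f0; have cf' := cont4_flip cf; have f0' := ge0_flip4 f0.
have := wt_aa_transfer_ge cf f0; have := wt_aa_transfer_ge cf' f0'.
have := wt_ba_transfer_flip cf; have := wt_ba_transfer_flip cf'.
have := @wt_aa_flip_iter 1 f cf; have := @wt_ba_flip_iter 1 f cf; rewrite /= flip4K.
have := wt_aa_ge0 f0; have := wt_aa_ge0 f0'.
rewrite /weight; generalize_weights; lra.
Qed.

Lemma weight_transfer_le f : cont4 f -> le4 (zero4 R) f -> weight (transfer f) <= 2 * weight f.
Proof.
move=> cf f0; have cf' := cont4_flip cf; have f0' := ge0_flip4 f0.
have := wt_aa_transfer_le cf f0; have := wt_aa_transfer_le cf' f0'.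
have := wt_ba_transfer_flip cf; have := wt_ba_transfer_flip cf'.
have := @wt_aa_flip_iter 1 f cf; have := @wt_ba_flip_iter 1 f cf; rewrite /= flip4K.
have := wt_aa_ge0 f0; have := wt_aa_ge0 f0'; have := wt_ba_ge0 f0; have := wt_ba_ge0 f0'.
rewrite /weight; generalize_weights; lra.
Qed.

Lemma weight_iter_ge n f : cont4 f -> le4 (zero4 R) f ->
  weight f / 3 ^+ n <= weight (iter n (@transfer R) f).
Proof.
move=> cf f0; elim: n => [|n IH]; first by rewrite expr0 divr1.
have := weight_transfer_ge (cont4_iter n cf) (iter_transfer_ge0 n f0).
apply: le_trans; rewrite exprSr invfM mulrA; exact: ler_wpM2r.
Qed.

Lemma weight_iter_le n f : cont4 f -> le4 (zero4 R) f ->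
  weight (iter n (@transfer R) f) <= 2 ^+ n * weight f.
Proof.
move=> cf f0; elim: n => [|n IH]; first by rewrite expr0 mul1r.
apply: le_trans (weight_transfer_le (cont4_iter n cf) (iter_transfer_ge0 n f0)) _.
by rewrite exprS -mulrA; apply: ler_wpM2l.
Qed.

Lemma lint_lint (f : R -> R) : cont01 f -> lint (lint f) 1 = lint (fun t : R => (1 - t) * f t) 1.
Proof.
move=> cf.
have dW y : 0 < y < 1 -> is_derive y 1 (fun t : R => 1 - t) (- 1).
  by move=> _; apply: is_derive_eq; rewrite add0r mul1r.
have cW : cont01 (fun t : R => 1 - t) by cont01.
transitivity (lint (fun x => 1 * lint f x) 1).
  by apply: eq_lint => // y _; rewrite mul1r.
by rewrite (lint_bypart _ cW _ dW)//; [apply: eq_lint => // y _; ring|cont01].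
Qed.

Lemma lint_rint1 (f : R -> R) : cont01 f -> lint (rint f) 1 = lint (fun t : R => t * f t) 1.
Proof.
move=> cf.
have dW y : 0 < y < 1 -> is_derive y 1 (fun t : R => 1 - t) (- 1).
  by move=> _; apply: is_derive_eq; rewrite add0r mul1r.
have cW : cont01 (fun t : R => 1 - t) by cont01.
transitivity (lint (fun x => 1 * rint f x) 1).
  by apply: eq_lint => // y _; rewrite mul1r.
by rewrite (rint_bypart _ cW _ dW)//; [apply: eq_lint => // y _; ring|cont01].
Qed.

Lemma lint_onem_lint (f : R -> R) : cont01 f ->
  lint (fun x : R => (1 - x) * lint f x) 1 = lint (fun t : R => (1 - t) ^+ 2 / 2 * f t) 1.
Proof.
move=> cf.
have dW y : 0 < y < 1 -> is_derive y 1 (fun t : R => (1 - t) ^+ 2 / 2) (- (1 - y)).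
  by move=> _; apply: is_derive_eq; rewrite /GRing.scale/=; field.
have cW : cont01 (fun t : R => (1 - t) ^+ 2 / 2) by cont01.
by rewrite (lint_bypart _ cW _ dW)//; [apply: eq_lint => // y _; field|cont01].
Qed.

Lemma lintS (f : R -> R) x : cont01 f -> 0 <= x <= 1 -> lint f x + rint f x = lint f 1.
Proof. by move=> cf x01; rewrite lint_rint//; ring. Qed.

(** f_aa reaches the bb component along aa, aa, ab, bb and along aa, ab, bb, bb. Both paths
    integrate the same double primitive G, over [0, x] and over [x, 1], so that the sum does not
    depend on x. *)
Lemma transfer3_bb_ge f x : cont4 f -> le4 (zero4 R) f -> 0 <= x <= 1 ->
  wt_aa f / 2 <= iter 3 (@transfer R) f true true x.
Proof.
move=> cf f0 /[dup] x01 /andP[x0 x1]; have cf1 := cont4_transfer cf.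
have cf2 := cont4_transfer cf1; have f1 := transfer_ge0 f0; have f2 := transfer_ge0 f1.
rewrite !iterS/= transfer_bb.
pose G := lint (lint (f false false)).
have cG : cont01 G by rewrite /G; cont01.
have -> : wt_aa f / 2 = lint G 1.
  rewrite /G lint_lint; last by cont01.
  rewrite lint_onem_lint// /wt_aa mulrC -lintZ//; last by cont01.
  by apply: eq_lint => // y _; field.
rewrite -(lintS cG x01); apply: lerD; [apply: le_lint|apply: le_rint]; try cont01; move=> //=.
  move=> y /andP[y0 y1]; rewrite transfer_ab; apply: le_lint; try cont01; move=> //.
  by move=> z z01; rewrite transfer_aa lerDl rint_ge0//; [case/andP : z01|move=> t t01; apply: f0].
move=> y /andP[y0 y1]; rewrite transfer_bb ler_wpDr//.
  by apply: rint_ge0 => // t t01; apply: f1.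
by apply: le_lint; try cont01; move=> // z z01; rewrite transfer_ab.
Qed.

Lemma transfer3_aa_ge f x : cont4 f -> le4 (zero4 R) f -> 0 <= x <= 1 ->
  wt_aa (flip4 f) / 2 <= iter 3 (@transfer R) f false false x.
Proof.
move=> cf f0 /[dup] x01 /andP[x0 x1].
have x01' : 0 <= 1 - x <= 1 by apply/andP; split; lra.
have := transfer3_bb_ge (cont4_flip cf) (ge0_flip4 f0) x01'.
by rewrite iter_transfer_flip// /flip4 subKr.
Qed.

Lemma wt_aa_iter3_ge f : cont4 f -> le4 (zero4 R) f ->
  wt_aa (flip4 f) / 6 <= wt_aa (iter 3 (@transfer R) f).
Proof.
move=> cf f0; set b := wt_aa (flip4 f).
have -> : b / 6 = lint (fun t : R => (1 - t) ^+ 2 * (b / 2)) 1.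
  have -> : lint (fun t : R => (1 - t) ^+ 2 * (b / 2)) 1 =
     - ((1 - 1) ^+ 3 * (b / 6)) - - ((1 - 0) ^+ 3 * (b / 6)); last by field.
  apply: (@lint_unique _ _ (fun t : R => - ((1 - t) ^+ 3 * (b / 6)))).
  - by cont01.
  - by apply: (@cont01_congr _ (fun t : R => (1 - t) ^+ 3 * - (b / 6))) => [t _|]; [ring|cont01].
  - by move=> y _; apply: is_derive_eq; rewrite /GRing.scale/=; field.
  - by rewrite ler01 lexx.
have c3 := cont4_iter 3 cf; apply: le_lint => //; try cont01; move=> y y01.
by apply: ler_wpM2l; [rewrite exprn_even_ge0|exact: transfer3_aa_ge].
Qed.

(** A second passage from the bb weight to the aa weight, of length two beside the three of
    [wt_aa_iter3_ge]; with coprime lengths all parts can be made to arrive at the same time. *)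
Lemma wt_aa_iter2_ge f : cont4 f -> le4 (zero4 R) f ->
  wt_aa (flip4 f) / 6 <= wt_aa (iter 2 (@transfer R) f).
Proof.
move=> cf f0; have := wt_aa_transfer_ge (cont4_transfer cf) (transfer_ge0 f0).
by rewrite wt_ba_transfer_flip//=; generalize_weights; lra.
Qed.

(** Every passage of length two or three exchanges aa and bb and costs a factor 6, so aa needs an
    even number of passages and bb an odd one: 9 = 3 + 2 + 2 + 2 for aa and 3 + 3 + 3 for bb. One
    initial step of cost 3 leads from ba to aa and from ab to bb, and the remaining 8 is 2 + 2 + 2 +
    2, respectively 3 + 3 + 2. The largest cost is 3 * 6^4 = 3888, and 15552 = 4 * 3888 accounts for
    the four parts. *)
Lemma wt_aa_iter9_ge f : cont4 f -> le4 (zero4 R) f ->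
  weight f / 15552 <= wt_aa (iter 9 (@transfer R) f).
Proof.
move=> cf f0.
have step2 m n g : cont4 g -> le4 (zero4 R) g -> m = n.+2 ->
    wt_aa (iter n (@transfer R) (flip4 g)) / 6 <= wt_aa (iter m (@transfer R) g).
  move=> cg g0 ->; have := wt_aa_iter2_ge (cont4_iter n cg) (iter_transfer_ge0 n g0).
  by rewrite -iterD addnC addn2 wt_aa_flip_iter.
have step3 m n g : cont4 g -> le4 (zero4 R) g -> m = n.+3 ->
    wt_aa (iter n (@transfer R) (flip4 g)) / 6 <= wt_aa (iter m (@transfer R) g).
  move=> cg g0 ->; have := wt_aa_iter3_ge (cont4_iter n cg) (iter_transfer_ge0 n g0).
  by rewrite -iterD addnC addn3 wt_aa_flip_iter.
have step1 : wt_aa (iter 9 (@transfer R) f) = wt_aa (iter 8 (@transfer R) (transfer f)).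
  by rewrite iterSr.
have cf' := cont4_flip cf; have f0' := ge0_flip4 f0.
have from_aa : wt_aa f / 1296 <= wt_aa (iter 9 (@transfer R) f).
  have := step3 9%N 6%N _ cf f0 erefl; have := step2 6%N 4%N _ cf' f0' erefl; have := step2 4%N 2%N _ cf f0 erefl.
  have := wt_aa_iter2_ge cf' f0'; rewrite ?flip4K; generalize_weights; lra.
have from_bb : wt_aa (flip4 f) / 216 <= wt_aa (iter 9 (@transfer R) f).
  have := step3 9%N 6%N _ cf f0 erefl; have := step3 6%N 3%N _ cf' f0' erefl; have := wt_aa_iter3_ge cf f0.
  rewrite ?flip4K; generalize_weights; lra.
have c1 := cont4_transfer cf; have g1 := transfer_ge0 f0.
have from_ba : wt_ba f / 3888 <= wt_aa (iter 9 (@transfer R) f).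
  have := step2 8%N 6%N _ c1 g1 erefl; have := step2 6%N 4%N _ (cont4_flip c1) (ge0_flip4 g1) erefl.
  have := step2 4%N 2%N _ c1 g1 erefl; have := wt_aa_iter2_ge (cont4_flip c1) (ge0_flip4 g1).
  rewrite ?(flip4K (transfer f)); have := step1; have := wt_aa_transfer_ge cf f0.
  generalize_weights; lra.
have from_ab : wt_ba (flip4 f) / 648 <= wt_aa (iter 9 (@transfer R) f).
  have := step3 8%N 5%N _ c1 g1 erefl; have := step3 5%N 2%N _ (cont4_flip c1) (ge0_flip4 g1) erefl.
  have := wt_aa_iter2_ge c1 g1.
  rewrite ?(flip4K (transfer f)); have := step1; have := wt_aa_transfer_ge cf' f0'.
  rewrite -(@wt_aa_flip_iter 1 f cf).
  rewrite -[iter 1 _ f]/(transfer f); generalize_weights; lra.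
move: from_aa from_bb from_ba from_ab; have := wt_aa_ge0 f0; have := wt_aa_ge0 f0'; have := wt_ba_ge0 f0; have := wt_ba_ge0 f0'.
rewrite /weight; generalize_weights; lra.
Qed.

End Estimates.

(** * Two-sided bounds of the thirteenth iterate by the profile *)

Section TwoSidedBounds.
Variable R : realType.
Implicit Types (f g h : vec4 R) (u v w : bool) (x y c : R).
Local Notation K := (@transfer R).

Lemma lint_cst c x : 0 <= x <= 1 -> lint (fun=> c) x = c * x.
Proof.
move=> x01; rewrite (_ : c * x = c * x - c * 0); last by rewrite mulr0 subr0.
apply: (@lint_unique _ _ (fun t => c * t)) => //; try cont01.
by move=> y _; apply: is_derive_eq; rewrite /GRing.scale/=; ring.
Qed.

Lemma rint_cst c x : 0 <= x <= 1 -> rint (fun=> c) x = c * (1 - x).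
Proof. by move=> x01; rewrite lint_rint; [rewrite !lint_cst ?ler01 ?lexx//; ring|cont01|]. Qed.

Lemma profile_ge0 v w x : 0 <= x <= 1 -> 0 <= @profile R v w x.
Proof. by rewrite /profile => /andP[x0 x1]; case: eqP => // _; case: v => //; rewrite subr_ge0. Qed.

Lemma profile_le1 v w x : 0 <= x <= 1 -> @profile R v w x <= 1.
Proof. by rewrite /profile => /andP[x0 x1]; case: eqP => // _; case: v => //; lra. Qed.

Definition mass f := lint (f false false) 1 + lint (f false true) 1 +
  (lint (f true false) 1 + lint (f true true) 1).

Lemma rint_le f v w x : cont4 f -> le4 (zero4 R) f -> 0 <= x <= 1 -> rint (f v w) x <= lint (f v w) 1.
Proof.
move=> cf f0 /[dup] x01 /andP[x0 x1]; rewrite (lint_rint (cf v w) x01).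
by rewrite lerBlDr lerDl lint_ge0// => y y01; apply: f0.
Qed.

Lemma lint_le f v w x : cont4 f -> le4 (zero4 R) f -> 0 <= x <= 1 -> lint (f v w) x <= lint (f v w) 1.
Proof.
move=> cf f0 /[dup] x01 /andP[x0 x1]; have := lint_rint (cf v w) x01.
have : 0 <= rint (f v w) x by apply: rint_ge0 => // y y01; apply: f0.
by move: (lint _ _) (rint _ _) (lint _ _) => a b d; lra.
Qed.

Lemma transfer_le_mass f v w x : cont4 f -> le4 (zero4 R) f -> 0 <= x <= 1 ->
  K f v w x <= mass f.
Proof.
move=> cf f0 x01.
have l v' w' : 0 <= lint (f v' w') 1 by apply: lint_ge0 => // y y01; apply: f0.
have le u' v' (b : bool) : b%:R * lint (f u' v') x <= lint (f u' v') 1.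
  by case: b; rewrite ?mul1r ?mul0r// lint_le.
have re u' v' (b : bool) : b%:R * rint (f u' v') x <= lint (f u' v') 1.
  by case: b; rewrite ?mul1r ?mul0r// rint_le.
rewrite /transfer /mass.
move: (l false false) (l false true) (l true false) (l true true).
move: (le false v (allowed false v w)) (re true v (allowed true v w)).
move: (_ * lint _ _) (_ * rint _ _) => a b; case: v => /=.
  move: (lint (f false false) 1) (lint (f false true) 1) (lint (f true false) 1) (lint (f true true) 1).
  by move=> *; lra.
move: (lint (f false false) 1) (lint (f false true) 1) (lint (f true false) 1) (lint (f true true) 1).
by move=> *; lra.
Qed.

Definition mass1 f := lint (fun t => (1 - t) * f false false t) 1 +
  lint (fun t => (1 - t) * f false true t) 1 +
  (lint (fun t => t * f true false t) 1 + lint (fun t => t * f true true t) 1).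

Lemma mass_transfer_le f : cont4 f -> le4 (zero4 R) f -> mass (K f) <= 2 * mass1 f.
Proof.
move=> cf f0; rewrite /mass /mass1.
have -> : lint (K f false false) 1 = lint (fun x => lint (f false false) x + rint (f true false) x) 1.
  by apply: eq_lint => // x _; rewrite transfer_aa.
have -> : lint (K f false true) 1 = lint (fun x => lint (f false false) x) 1.
  by apply: eq_lint => // x _; rewrite transfer_ab.
have -> : lint (K f true false) 1 = lint (fun x => rint (f true true) x) 1.
  by apply: eq_lint => // x _; rewrite transfer_ba.
have -> : lint (K f true true) 1 = lint (fun x => lint (f false true) x + rint (f true true) x) 1.
  by apply: eq_lint => // x _; rewrite transfer_bb.
rewrite !lintD//; try cont01.
have := lint_lint (cf false false); have := lint_lint (cf false true).
have := lint_rint1 (cf true false); have := lint_rint1 (cf true true).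
have h1 : 0 <= lint (fun t => (1 - t) * f false true t) 1.
  by apply: lint_ge0 => // t /[dup] t01 /andP[t0 t1]; rewrite mulr_ge0 ?subr_ge0//; apply: f0.
have h2 : 0 <= lint (fun t => t * f true false t) 1.
  by apply: lint_ge0 => // t /[dup] t01 /andP[t0 t1]; rewrite mulr_ge0//; apply: f0.
move=> -> -> -> ->; move: h1 h2.
do 4 (move: (lint _ 1) => ?); lra.
Qed.

Lemma mass1_transfer_le f : cont4 f -> le4 (zero4 R) f -> mass1 (K f) <= 2 * weight f.
Proof.
move=> cf f0; have cf' := cont4_flip cf; have f0' := ge0_flip4 f0.
have half (g : vec4 R) : cont4 g -> le4 (zero4 R) g ->
  lint (fun t => (1 - t) * K g false false t) 1 + lint (fun t => (1 - t) * K g false true t) 1 <=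
  wt_aa g + wt_ba g.
  move=> cg g0.
  have -> : lint (fun t => (1 - t) * K g false false t) 1 =
     lint (fun t => (1 - t) * lint (g false false) t + (1 - t) * rint (g true false) t) 1.
    by apply: eq_lint => // t _; rewrite transfer_aa; ring.
  have -> : lint (fun t => (1 - t) * K g false true t) 1 =
     lint (fun t => (1 - t) * lint (g false false) t) 1.
    by apply: eq_lint => // t _; rewrite transfer_ab.
  rewrite lintD//; try cont01.
  have -> : wt_aa g = lint (fun t => (1 - t) * lint (g false false) t) 1 +
                   lint (fun t => (1 - t) * lint (g false false) t) 1.
    rewrite (lint_onem_lint (cg _ _)) -lintD//; try cont01.
    by apply: eq_lint => // t _; field.
  rewrite -addrA.
  have : lint (fun t => (1 - t) * rint (g true false) t) 1 <= wt_ba g.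
    have -> : wt_ba g = lint (rint (g true false)) 1 by rewrite lint_rint1.
    apply: le_lint => //; try cont01; move=> y /andP[y0 y1].
    rewrite ler_piMl//; last lra.
    by apply: rint_ge0 => // t t01; apply: g0.
  by move: (lint _ _) (lint _ _) (wt_ba g) => a b d; lra.
have := half _ cf f0; have := half _ cf' f0'; rewrite /mass1 /weight.
have flip_eq b : lint (fun t => t * K f true b t) 1 = lint (fun t => (1 - t) * K (flip4 f) false (~~ b) t) 1.
  have cg : cont01 (fun t => t * K f true b t).
    by apply: cont01M; [exact: cont01_id|exact: cont4_transfer].
  transitivity (lint (fun t => (1 - t) * K f true b (1 - t)) 1).
    rewrite (lint_onem cg) ?ler01 ?lexx// subrr.
    by rewrite lint_rint ?ler01 ?lexx// lint0 subr0.
  apply: eq_lint => // t t01; rewrite transfer_flip// /flip4 negbK//.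
rewrite !flip_eq /=.
have ge g : le4 (zero4 R) g -> 0 <= wt_aa g + wt_ba g.
  by move=> g0; rewrite addr_ge0 ?wt_aa_ge0 ?wt_ba_ge0.
have := ge _ f0; have := ge _ f0'.
move: (wt_aa f + wt_ba f) (wt_aa (flip4 f) + wt_ba (flip4 f)) => a b.
do 4 (move: (lint _ 1) => ?); lra.
Qed.

(** Values of K g are at most [mass g]; going back one step replaces [mass] by twice [mass1], and
    one more replaces [mass1] by twice [weight]. So three steps give the constant 4. The fourth
    supplies the zeros of [profile], and for equal letters the factor 2 of [weight_transfer_le]. *)
Lemma transfer4_le f v w x : cont4 f -> le4 (zero4 R) f -> 0 <= x <= 1 ->
  iter 4 K f v w x <= 8 * weight f * profile v w x.
Proof.
move=> cf f0 /[dup] x01 /andP[x0 x1].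
have le3 g v' w' y : cont4 g -> le4 (zero4 R) g -> 0 <= y <= 1 -> iter 3 K g v' w' y <= 4 * weight g.
  move=> cg g0 y01.
  have := transfer_le_mass v' w' (cont4_iter 2 cg) (iter_transfer_ge0 2 g0) y01.
  have := mass_transfer_le (cont4_transfer cg) (transfer_ge0 g0).
  have := mass1_transfer_le cg g0.
  rewrite !iterS -[iter 0 K g]/g; move: (mass1 _) (weight g) (mass _) (transfer _ _ _ _).
  by move=> *; lra.
have wf := weight_ge0 f0.
rewrite /profile; case: eqP => [_|/eqP].
  have := le3 _ v w _ (cont4_transfer cf) (transfer_ge0 f0) x01.
  rewrite -iterSr; have := weight_transfer_le cf f0; move: (weight _) (weight _) (iter _ _ _ _ _ _).
  by move=> *; lra.
case: v; case: w => // _.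
  rewrite iterS transfer_ba.
  apply: (@le_trans _ _ (rint (fun=> 4 * weight f) x)).
    apply: le_rint => //; try cont01; first exact: cont4_iter.
    by move=> y y01; apply: le3.
  by rewrite rint_cst// ler_wpM2r ?subr_ge0// ler_wpM2r// ler_nat.
rewrite iterS transfer_ab.
apply: (@le_trans _ _ (lint (fun=> 4 * weight f) x)).
  apply: le_lint => //; try cont01; first exact: cont4_iter.
  by move=> y y01; apply: le3.
by rewrite lint_cst// ler_wpM2r// ler_wpM2r// ler_nat.
Qed.

(** Nine preliminary steps bring the upper bound to the power at which the lower one is available;
    4096 = 8 * 2^9. *)
Lemma transfer13_le f v w x : cont4 f -> le4 (zero4 R) f -> 0 <= x <= 1 ->
  iter 13 K f v w x <= 4096 * weight f * profile v w x.
Proof.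
move=> cf f0 x01.
have := transfer4_le v w (cont4_iter 9 cf) (iter_transfer_ge0 9 f0) x01.
rewrite -iterD addnE; move/le_trans; apply.
apply: ler_wpM2r; first exact: profile_ge0.
have := weight_iter_le 9 cf f0; rewrite (_ : 2 ^+ 9 = 512); last by ring.
by move: (weight _) (weight _) => *; lra.
Qed.

(** [wt_aa_iter9_ge] followed by [transfer3_aa_ge] bounds the aa component after 12 steps, with a
    factor 2. Applied to K f, of weight at least a third, it covers 13 steps, whence 6 = 2 * 3. For
    different letters the last step integrates the constant bound at 12. *)
Lemma transfer13_ge f v w x : cont4 f -> le4 (zero4 R) f -> 0 <= x <= 1 ->
  weight f / (6 * 15552) * profile v w x <= iter 13 K f v w x.
Proof.
move=> cf f0 x01.
have aa n g y : cont4 g -> le4 (zero4 R) g -> 0 <= y <= 1 -> n = 12%N \/ n = 13%N ->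
  weight g / (6 * 15552) <= iter n K g false false y.
  move=> cg g0 y01.
  have base g' : cont4 g' -> le4 (zero4 R) g' -> weight g' / (2 * 15552) <= iter 12 K g' false false y.
    move=> cg' g0'.
    have := transfer3_aa_ge (cont4_iter 9 cg') (iter_transfer_ge0 9 g0') y01.
    rewrite -iterD addnE wt_aa_flip_iter//.
    have := wt_aa_iter9_ge (cont4_flip cg') (ge0_flip4 g0'); rewrite weight_flip.
    by move: (weight _) (wt_aa _) (iter _ _ _ _ _ _) => *; lra.
  have wg := weight_ge0 g0.
  case=> ->; first by apply: le_trans (base _ cg g0); move: (weight _) wg => *; lra.
  rewrite iterSr; have := base _ (cont4_transfer cg) (transfer_ge0 g0).
  have := weight_transfer_ge cg g0.
  by move: (weight _) (weight _) (iter _ _ _ _ _ _) => *; lra.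
have bb n y : 0 <= y <= 1 -> n = 12%N \/ n = 13%N ->
  weight f / (6 * 15552) <= iter n K f true true y.
  move=> /[dup] y01 /andP[y0 y1] n1213.
  have y01' : 0 <= 1 - y <= 1 by apply/andP; split; lra.
  have := aa n _ _ (cont4_flip cf) (ge0_flip4 f0) y01' n1213.
  by rewrite iter_transfer_flip// weight_flip /flip4 subKr.
have /andP[x0 x1] := x01.
rewrite /profile; case: eqP => [->|/eqP].
  by rewrite mulr1; case: w; [apply: bb; auto|apply: aa; auto].
case: v; case: w => // _.
  rewrite iterS transfer_ba -rint_cst//.
  apply: le_rint => //; try cont01; first exact: cont4_iter.
  by move=> y y01; apply: bb; auto.
rewrite iterS transfer_ab -lint_cst//.
apply: le_lint => //; try cont01; first exact: cont4_iter.
by move=> y y01; apply: aa; auto.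
Qed.
End TwoSidedBounds.

(** * Contraction of the ratio of two orbits *)

Section Contraction.
Variable R : realType.
Implicit Types (f g h : vec4 R) (u v w : bool) (x y c m M : R).
Local Notation K := (@transfer R).

Definition bracket m M g h := forall v w x, 0 <= x <= 1 ->
  m * g v w x <= h v w x <= M * g v w x.

Lemma weight_lin c f d g : cont4 f -> cont4 g ->
  weight (lin4 c f d g) = c * weight f + d * weight g.
Proof.
move=> cf cg.
have wl (p : R -> R) v w (f1 g1 : vec4 R) : cont4 f1 -> cont4 g1 -> cont01 p ->
    lint (fun t => p t * (c * f1 v w t + d * g1 v w t)) 1 =
    c * lint (fun t => p t * f1 v w t) 1 + d * lint (fun t => p t * g1 v w t) 1.
  move=> cf1 cg1 cp; rewrite -!lintZ//; try cont01.
  rewrite -lintD//; try cont01; apply: eq_lint => // t _; ring.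
have cf' := cont4_flip cf; have cg' := cont4_flip cg.
have aa (f1 g1 : vec4 R) : cont4 f1 -> cont4 g1 -> wt_aa (lin4 c f1 d g1) = c * wt_aa f1 + d * wt_aa g1.
  by move=> cf1 cg1; rewrite /wt_aa /lin4 wl//; cont01.
have ba (f1 g1 : vec4 R) : cont4 f1 -> cont4 g1 -> wt_ba (lin4 c f1 d g1) = c * wt_ba f1 + d * wt_ba g1.
  by move=> cf1 cg1; rewrite /wt_ba /lin4 wl//; cont01.
rewrite /weight -[flip4 (lin4 c f d g)]/(lin4 c (flip4 f) d (flip4 g)) !aa// !ba//; ring.
Qed.

Lemma weight_le f g : cont4 f -> cont4 g -> le4 f g -> weight f <= weight g.
Proof.
move=> cf cg fg; rewrite -subr_ge0.
have -> : weight g - weight f = weight (lin4 1 g (-1) f) by rewrite weight_lin//; ring.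
by apply: weight_ge0 => v w x x01; rewrite /lin4 mul1r mulN1r subr_ge0; apply: fg.
Qed.

Lemma weight_bracket m M g h : cont4 g -> cont4 h -> bracket m M g h ->
  m * weight g <= weight h <= M * weight g.
Proof.
move=> cg ch b.
have e c : c * weight g = weight (lin4 c g 0 g) by rewrite weight_lin// mul0r addr0.
rewrite !e; apply/andP; split; apply: weight_le => //; try exact: cont4_lin.
  by move=> v w x x01; rewrite /lin4 mul0r addr0; have /andP[] := b v w x x01.
by move=> v w x x01; rewrite /lin4 mul0r addr0; have /andP[] := b v w x x01.
Qed.

Lemma bracket_iter n m M g h : cont4 g -> cont4 h -> bracket m M g h ->
  bracket m M (iter n K g) (iter n K h).
Proof.
move=> cg ch b v w x x01.
have lo : le4 (zero4 R) (lin4 1 h (- m) g).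
  by move=> v' w' y y01; rewrite /lin4 mul1r mulNr subr_ge0; have /andP[] := b v' w' y y01.
have hi : le4 (zero4 R) (lin4 M g (- 1) h).
  by move=> v' w' y y01; rewrite /lin4 mulN1r subr_ge0; have /andP[] := b v' w' y y01.
have := iter_transfer_ge0 n lo v w x x01; have := iter_transfer_ge0 n hi v w x x01.
rewrite !iter_transfer_lin// /lin4 /zero4 mul1r mulN1r mulNr !subr_ge0 => -> ->.
by [].
Qed.

(** Quotient of the constants of [transfer13_ge] and [transfer13_le]. *)
Definition contr : R := (6 * 15552 * 4096)^-1.

Lemma contr_gt0 : 0 < contr.
Proof.
by rewrite /contr invr_gt0; apply: mulr_gt0; [apply: mulr_gt0|]; rewrite ltr0n.
Qed.

Lemma contr_lt1 : contr < 1.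
Proof.
have := contr_gt0; rewrite /contr invr_gt0 => p; rewrite (invf_lt1 p).
have a : 1 <= 15552 :> R by rewrite ler1n.
have b : 1 <= 4096 :> R by rewrite ler1n.
move: {p} (15552 : R) (4096 : R) a b => a b a1 b1.
have : 1 <= a * b by rewrite mulr_ege1.
by rewrite -mulrA; move: (a * b) => z; lra.
Qed.

(** Let s = weight h / weight g, which lies between m and M. The nonnegative quadruples h - m g and
    M g - h have weights (s - m) and (M - s) times that of g, so their 13th iterates exceed [contr]
    times these multiples of K^13 g. The two gains add up to contr (M - m) whatever s is. *)
Lemma bracket_contract m M g h : cont4 g -> cont4 h -> le4 (zero4 R) g -> 0 < weight g ->
  bracket m M g h ->
  exists m' M', bracket m' M' (iter 13 K g) (iter 13 K h) /\ M' - m' = (1 - contr) * (M - m).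
Proof.
move=> cg ch g0 wg b.
pose s := weight h / weight g.
have /andP[ms sM] := weight_bracket cg ch b.
exists (m + contr * (s - m)), (M - contr * (M - s)); split; last by ring.
move=> v w x x01.
have up := transfer13_le v w cg g0 x01.
have aux q f : cont4 f -> le4 (zero4 R) f -> weight f = q * weight g -> 0 <= q ->
  contr * q * iter 13 K g v w x <= iter 13 K f v w x.
  move=> cf f0 wf q0; apply: le_trans (transfer13_ge v w cf f0 x01).
  rewrite wf; have cq : 0 <= contr * q by rewrite mulr_ge0// ltW// contr_gt0.
  apply: le_trans (ler_wpM2l cq up) _.
  have -> : (6 * 15552 : R)^-1 = contr * 4096 by rewrite /contr; move: (6 * 15552 : R) => z; rewrite invfM mulfVK ?pnatr_eq0.
  move: contr (4096 : R) => e d.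
  by rewrite le_eqVlt; apply/orP; left; apply/eqP; ring.
have lo : contr * (s - m) * iter 13 K g v w x <= iter 13 K (lin4 1 h (- m) g) v w x.
  apply: aux; first exact: cont4_lin.
  - by move=> v' w' y y01; rewrite /lin4 mul1r mulNr subr_ge0; have /andP[] := b v' w' y y01.
  - by rewrite weight_lin// /s; field; rewrite gt_eqF.
  - by rewrite subr_ge0 /s ler_pdivlMr.
have hi : contr * (M - s) * iter 13 K g v w x <= iter 13 K (lin4 M g (-1) h) v w x.
  apply: aux; first exact: cont4_lin.
  - by move=> v' w' y y01; rewrite /lin4 mulN1r subr_ge0; have /andP[] := b v' w' y y01.
  - by rewrite weight_lin// /s; field; rewrite gt_eqF.
  - by rewrite subr_ge0 /s ler_pdivrMr.
move: lo hi; rewrite !iter_transfer_lin// /lin4.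
move: (iter 13 K g v w x) (iter 13 K h v w x) => a d lo hi.
by apply/andP; split; lra.
Qed.

Lemma weight_iter_gt0 n g : cont4 g -> le4 (zero4 R) g -> 0 < weight g -> 0 < weight (iter n K g).
Proof.
move=> cg g0 wg; apply: lt_le_trans (weight_iter_ge n cg g0).
by rewrite divr_gt0// exprn_gt0.
Qed.

Lemma bracket_contract_iter k m M g h : cont4 g -> cont4 h -> le4 (zero4 R) g -> 0 < weight g ->
  bracket m M g h ->
  exists m' M', bracket m' M' (iter (k * 13) K g) (iter (k * 13) K h) /\
    M' - m' = (1 - contr) ^+ k * (M - m).
Proof.
move=> cg ch g0 wg b; elim: k => [|k [m' [M' [b' e]]]].
  by exists m, M; split => //; rewrite expr0 mul1r.
have [m2 [M2 [b2 e2]]] := bracket_contract (cont4_iter _ cg) (cont4_iter _ ch)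
  (iter_transfer_ge0 _ g0) (weight_iter_gt0 _ cg g0 wg) b'.
exists m2, M2; split; last by rewrite e2 e exprS mulrA.
by move: b2; rewrite -!iterD mulSn.
Qed.

(** A substitute for the 13th root of 1 - contr: its 13th power is at least 1 - contr by the
    Bernoulli inequality. *)
Definition rate : R := 1 - contr / 13.

Lemma rate_gt0 : 0 < rate.
Proof. by rewrite /rate; have := contr_gt0; have := contr_lt1; move: contr => e; lra. Qed.

Lemma rate_lt1 : rate < 1.
Proof. by rewrite /rate; have := contr_gt0; move: contr => e; lra. Qed.

Lemma rate13 : 1 - contr <= rate ^+ 13.
Proof.
have e0 := contr_gt0; have e1 := contr_lt1.
have bern n : 1 - (contr / 13) *+ n <= rate ^+ n.
  elim: n => [|n IH]; first by rewrite mulr0n subr0 expr0.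
  have := ler_wpM2l (ltW rate_gt0) IH; rewrite -exprS; apply: le_trans.
  rewrite /rate mulrS.
  have : 0 <= (contr / 13) * ((contr / 13) *+ n) by rewrite mulr_ge0 ?mulrn_wge0// divr_ge0// ltW.
  by move: (_ *+ n) => z; move: contr e0 e1 => e ? ?; lra.
by apply: le_trans (bern 13); rewrite -mulr_natr divfK.
Qed.

Lemma spectral_gap m M g h : cont4 g -> cont4 h -> le4 (zero4 R) g -> 0 < weight g ->
  bracket m M g h ->
  exists k C, 0 <= C /\ forall n v w x, 0 <= x <= 1 ->
    `|iter n K h v w x - k * iter n K g v w x| <= C * rate ^+ n * iter n K g v w x.
Proof.
move=> cg ch g0 wg b.
(* The lower bounds of the ratio at any time. A lower bound at time p and an upper bound at time n
   are compared through the weights at time p + n, so that sup S belongs to all brackets. *)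
pose S := [set a : R | exists n, le4 (lin4 a (iter n K g) 0 (iter n K g)) (iter n K h)].
have brS a A n : bracket a A (iter n K g) (iter n K h) -> S a.
  by move=> ba; exists n => v w x x01; rewrite /lin4 mul0r addr0; have /andP[] := ba v w x x01.
have upS a A n : bracket a A (iter n K g) (iter n K h) -> ubound S A.
  move=> ba c [p cp].
  have cgi q := cont4_iter q cg; have chi q := cont4_iter q ch.
  have b1 : bracket a A (iter (p + n) K g) (iter (p + n) K h).
    by rewrite !iterD; apply: bracket_iter.
  have c0 : le4 (zero4 R) (lin4 1 (iter p K h) (- c) (iter p K g)).
    move=> v w x x01; have := cp v w x x01; rewrite /lin4 mul0r addr0 => z.
    by rewrite mul1r mulNr subr_ge0.
  have c1 := weight_ge0 (iter_transfer_ge0 n c0).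
  have wgn := weight_iter_gt0 (p + n) cg g0 wg.
  have : c * weight (iter (p + n) K g) <= weight (iter (p + n) K h).
    rewrite addnC !iterD -subr_ge0; move: c1.
    rewrite (@weight_congr _ _ (lin4 1 (iter n K (iter p K h)) (- c) (iter n K (iter p K g)))).
      by rewrite weight_lin ?mul1r ?mulNr//; exact: cont4_iter.
    by move=> v w x x01; rewrite iter_transfer_lin.
  have /andP[_ h2] := weight_bracket (cgi _) (chi _) b1.
  by move=> h1; have := le_trans h1 h2; rewrite ler_pM2r.
have S0 : S !=set0 by exists m; exact: (@brS m M 0%N).
have Sub : has_ubound S by exists M; exact: (@upS m M 0%N).
have mM : m <= M.
  have /andP[h1 h2] := weight_bracket cg ch b.
  by have := le_trans h1 h2; rewrite ler_pM2r.
(* Contraction is known at multiples of 13 only; rounding n down costs at most twelve factors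
   [rate]. *)
exists (sup S), ((M - m) / rate ^+ 12); split.
  by rewrite divr_ge0 ?subr_ge0// exprn_ge0// ltW// rate_gt0.
move=> n v w x x01; pose k := (n %/ 13)%N.
have [m' [M' [b' e']]] := bracket_contract_iter k cg ch g0 wg b.
have b2 : bracket m' M' (iter n K g) (iter n K h).
  rewrite (divn_eq n 13) addnC !iterD -/k; apply: bracket_iter => //; exact: cont4_iter.
have h1 : m' <= sup S by apply: ub_le_sup => //; exact: brS b2.
have h2 : sup S <= M' by apply: ge_sup => //; exact: upS b2.
have gn0 := iter_transfer_ge0 n g0 v w x x01.
have /andP[h3 h4] := b2 v w x x01.
apply: (@le_trans _ _ ((M' - m') * iter n K g v w x)).
  move: gn0 h3 h4; rewrite /zero4; move: (iter n K g v w x) (iter n K h v w x) => a d a0 h3 h4.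
  rewrite ler_norml; have := ler_wpM2r a0 h1; have := ler_wpM2r a0 h2 => *.
  by apply/andP; split; lra.
apply: ler_wpM2r => //; rewrite e' [leRHS]mulrC [leRHS]mulrA [leRHS]mulrAC; apply: ler_wpM2r; first by rewrite subr_ge0.
have r0 := rate_gt0.
rewrite ler_pdivlMr ?exprn_gt0//.
apply: (@le_trans _ _ (rate ^+ (k * 13) * rate ^+ 12)).
  apply: ler_wpM2r; first by rewrite exprn_ge0// ltW.
  rewrite mulnC exprM; apply: lerXn2r; rewrite ?nnegrE ?rate13 ?exprn_ge0//; try exact: ltW.
  by rewrite subr_ge0 ltW// contr_lt1.
rewrite -exprD ler_wiXn2l ?(ltW r0) ?(ltW rate_lt1)//.
by rewrite /k {1}(divn_eq n 13) leq_add2l -ltnS ltn_mod.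
Qed.

End Contraction.

(** * Sequences with geometrically small increments *)

Section GeometricLimits.
Variable R : realType.
Implicit Types (a : nat -> R) (b c C r e : R).

Lemma geometric_small C r e : 0 < r < 1 -> 0 < e -> exists n, C * r ^+ n < e.
Proof.
move=> /andP[r0 r1] e0.
have rn : `|r| < 1 by rewrite gtr0_norm.
have /cvgrPdist_lt/(_ (e / (`|C| + 1))) := cvg_expr rn.
have c0 : 0 < `|C| + 1 by rewrite ltr_wpDl.
case=> [|n _ /(_ n (leqnn _)) /=]; first by rewrite divr_gt0.
rewrite sub0r normrN normrX gtr0_norm// ltr_pdivlMr// => h; exists n.
apply: le_lt_trans h; rewrite mulrC; apply: ler_wpM2l; first by rewrite exprn_ge0// ltW.
by rewrite (le_trans (ler_norm C))// lerDl.
Qed.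

Lemma le_geometric b c C r : 0 < r < 1 -> (forall n, b <= c + C * r ^+ n) -> b <= c.
Proof.
move=> r01 h; rewrite leNgt; apply/negP => cb.
have [n] := @geometric_small C r (b - c) r01 ltac:(by rewrite subr_gt0).
by have := h n; move: (_ * _) => z; lra.
Qed.

(** The limit of a sequence with increments at most C r^k: subtracting the geometric tail makes it
    nondecreasing, so the supremum is the limit. *)
Definition geolim C r a := sup (range (fun k => a k - C / (1 - r) * r ^+ k)).

Lemma geolimP C r a k : 0 < r < 1 -> (forall n, `|a n.+1 - a n| <= C * r ^+ n) ->
  `|a k - geolim C r a| <= C / (1 - r) * r ^+ k.
Proof.
move=> /andP[r0 r1] ha.
have r1' : 0 < 1 - r by rewrite subr_gt0.
pose E n := C / (1 - r) * r ^+ n.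
have ES n : E n - E n.+1 = C * r ^+ n by rewrite /E exprS; field; rewrite gt_eqF.
have lo n m : a n - E n <= a (m + n)%N - E (m + n)%N.
  elim: m => [|m IH] //; apply: le_trans IH _; rewrite addSn.
  have := ha (m + n)%N; rewrite ler_norml -ES => /andP[h _]; lra.
have hi n m : a (m + n)%N + E (m + n)%N <= a n + E n.
  elim: m => [|m IH] //; apply: le_trans IH; rewrite addSn.
  have := ha (m + n)%N; rewrite ler_norml -ES => /andP[_ h]; lra.
have C0 : 0 <= C by have := ha 0%N; rewrite expr0 mulr1; apply: le_trans.
have E0 n : 0 <= E n by rewrite /E mulr_ge0 ?exprn_ge0 ?(ltW r0)// divr_ge0// ltW.
have lohi n m : a n - E n <= a m + E m.
  apply: le_trans (hi m n); apply: le_trans (lo n m) _.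
  by rewrite addnC lerD2l ge0_cp.
have ub n : ubound (range (fun k => a k - E k)) (a n + E n).
  by move=> _ [m _ <-].
rewrite -/(E k) ler_norml; apply/andP; split.
  have : geolim C r a <= a k + E k.
    by apply: ge_sup; [exists (a 0%N - E 0%N), 0%N|exact: ub].
  lra.
have : a k - E k <= geolim C r a.
  by apply: ub_le_sup; [exists (a 0%N + E 0%N); exact: ub|exists k].
lra.
Qed.

Lemma cont01_bounded (f : R -> R) : cont01 f -> exists D, forall x, 0 <= x <= 1 -> `|f x| <= D.
Proof.
move=> cf.
have [p _ hp] := EVT_max (@ler01 R) cf; have [q _ hq] := EVT_min (@ler01 R) cf.
exists (Num.max (f p) (- f q)) => x x01.
have xi : x \in `[0, 1] by rewrite in_itv.
by rewrite ler_norml le_max hp // lerNl le_max lerN2 hq ?orbT.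
Qed.

Lemma cont4_bounded (h : vec4 R) : cont4 h ->
  exists2 D, 0 <= D & forall v w x, 0 <= x <= 1 -> `|h v w x| <= D.
Proof.
move=> ch.
have [d0 h0] := cont01_bounded (ch false false); have [d1 h1] := cont01_bounded (ch false true).
have [d2 h2] := cont01_bounded (ch true false); have [d3 h3] := cont01_bounded (ch true true).
exists (`|d0| + `|d1| + `|d2| + `|d3|); first by rewrite !addr_ge0.
move=> v w x x01.
have := ler_norm d0; have := ler_norm d1; have := ler_norm d2; have := ler_norm d3.
have := normr_ge0 d0; have := normr_ge0 d1; have := normr_ge0 d2; have := normr_ge0 d3.
move: `|d0| `|d1| `|d2| `|d3| => e0 e1 e2 e3 *.
move: v w => [] [].
- by apply: le_trans (h3 x _) _ => //; lra.
- by apply: le_trans (h2 x _) _ => //; lra.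
- by apply: le_trans (h1 x _) _ => //; lra.
- by apply: le_trans (h0 x _) _ => //; lra.
Qed.
End GeometricLimits.

Lemma dist_le (R : realType) (a b e : R) : `|a - b| <= e -> b <= a + e /\ a - e <= b.
Proof. by rewrite ler_norml => /andP[? ?]; split; lra. Qed.

Lemma dist_le_of (R : realType) (a b e z : R) : z <= e -> b - z <= a -> a <= b + z -> `|a - b| <= e.
Proof. by move=> *; rewrite ler_norml; apply/andP; split; lra. Qed.

Lemma dist_trans3 (R : realType) (a b c d e1 e2 e3 : R) :
  `|b - c| <= e1 -> `|a - b| <= e2 -> `|c - d| <= e3 -> `|a - d| <= e2 + e3 + e1.
Proof.
by rewrite !ler_norml => /andP[? ?] /andP[? ?] /andP[? ?]; apply/andP; split; lra.
Qed.

(** * The positive eigenfunction *)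

Section Perron.
Variable R : realType.
Implicit Types (f g h : vec4 R) (u v w : bool) (x y c m M : R).
Local Notation K := (@transfer R).
Local Notation rho := (rate R).

Definition one4 : vec4 R := fun _ _ _ => 1.

Lemma cont4_one : cont4 one4.
Proof. by move=> v w; exact: cont01_cst. Qed.

Lemma one4_ge0 : le4 (zero4 R) one4. Proof. by move=> v w x _; exact: ler01. Qed.

Lemma transfer_one_le v w x : 0 <= x <= 1 -> K one4 v w x <= 1.
Proof.
move=> /[dup] x01 /andP[x0 x1]; rewrite /transfer /one4 lint_cst// rint_cst// !mul1r.
by case: (allowed _ _ _); case: (allowed _ _ _); rewrite ?mul1r ?mul0r; lra.
Qed.

Lemma weight_ge_profile c f : cont4 f -> 0 < c ->
  (forall v w x, 0 <= x <= 1 -> c * profile v w x <= f v w x) -> 0 < weight f.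
Proof.
move=> cf c0 fc.
have f0 : le4 (zero4 R) f.
  by move=> v w x x01; apply: le_trans (fc v w x x01); rewrite mulr_ge0 ?profile_ge0// ltW.
have f0' := ge0_flip4 f0.
rewrite /weight; have := wt_ba_ge0 f0; have := wt_ba_ge0 f0'; have := wt_aa_ge0 f0'.
suff : 0 < wt_aa f.
  by move: (wt_aa _) (wt_ba _) (wt_aa _) (wt_ba _) => *; lra.
have : lint (fun t => (1 - t) ^+ 2 * c) 1 <= wt_aa f.
  apply: le_lint => //; try cont01; move=> y y01.
  apply: ler_wpM2l; first by rewrite exprn_even_ge0.
  by have := fc false false y y01; rewrite /profile mulr1.
apply: lt_le_trans.
have -> : lint (fun t => (1 - t) ^+ 2 * c) 1 =
     - ((1 - 1) ^+ 3 * (c / 3)) - - ((1 - 0) ^+ 3 * (c / 3)).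
  apply: (@lint_unique _ _ (fun t : R => - ((1 - t) ^+ 3 * (c / 3)))).
  - by cont01.
  - by apply: (@cont01_congr _ (fun t : R => (1 - t) ^+ 3 * - (c / 3))) => [t _|]; [ring|cont01].
  - by move=> y _; apply: is_derive_eq; rewrite /GRing.scale/=; field.
  - by rewrite ler01 lexx.
by rewrite subrr subr0 expr1n expr0n/= mul0r mul1r oppr0 sub0r opprK divr_gt0.
Qed.

Lemma weight_one_gt0 : 0 < weight one4.
Proof.
apply: (@weight_ge_profile 1); [exact: cont4_one|by []|].
by move=> v w x x01; rewrite mul1r profile_le1.
Qed.

Lemma transfer_scale c f v w x : cont4 f -> 0 <= x <= 1 ->
  K (fun v w x => c * f v w x) v w x = c * K f v w x.
Proof.
move=> cf x01.
rewrite (@transfer_congr _ _ (lin4 c f 0 f))//; last first.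
  by move=> v' w' y _; rewrite /lin4 mul0r addr0.
by rewrite transfer_lin// /lin4 mul0r addr0.
Qed.

Lemma perron : exists lam (phi : vec4 R) c1 c2,
  [/\ 0 < lam, cont4 phi, 0 < c1,
      forall v w x, 0 <= x <= 1 -> c1 * profile v w x <= phi v w x <= c2 * profile v w x &
      forall v w x, 0 <= x <= 1 -> K phi v w x = lam * phi v w x].
Proof.
have c1 := cont4_one; have g1 := one4_ge0; have w1 := weight_one_gt0.
have r0 := rate_gt0 R; have r1 := rate_lt1 R; have r01 : 0 < rho < 1 by rewrite r0.
(* The orbit of 1 is compared with its own shift; the constant given by [spectral_gap] is then the
   eigenvalue, since each iterate is lam times the previous one up to a relative error C rho^n. *)
have br : bracket 0 1 one4 (K one4).
  move=> v w x x01; rewrite mul0r mul1r transfer_one_le// andbT.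
  by have := transfer_ge0 g1 v w x01.
have [lam [C [C0 gap]]] := spectral_gap c1 (cont4_transfer c1) g1 w1 br.
pose u n := iter n K one4; pose N n := weight (u n).
have cu n : cont4 (u n) by exact: cont4_iter.
have u0 n : le4 (zero4 R) (u n) by exact: iter_transfer_ge0.
have N0 n : 0 < N n by exact: weight_iter_gt0.
pose e n := C * rho ^+ n.
have gap' n : bracket (lam - e n) (lam + e n) (u n) (u n.+1).
  move=> v w x x01; have := gap n v w x x01; rewrite -iterSr -/(u n) -/(u n.+1) -/(e n).
  rewrite ler_norml; move: (u n v w x) (u n.+1 v w x) => a b /andP[h1 h2].
  by apply/andP; split; lra.
have gapN n : (lam - e n) * N n <= N n.+1 <= (lam + e n) * N n.
  exact: weight_bracket (gap' n).
have NS n : N n / 3 <= N n.+1 by exact: weight_transfer_ge.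
have lam3 : 1 / 3 <= lam.
  apply: (@le_geometric _ _ _ C rho r01) => n.
  have /andP[_ h] := gapN n; have := le_trans (NS n) h.
  by rewrite mulrC ler_pM2r// mul1r.
have lam0 : 0 < lam by move: lam3; lra.
(* Iterates normalized to weight 1. The shift by four makes [transfer4_le] applicable and yields the
   uniform bound 648 = 8 * 3^4, where 3^4 bounds N k / N (k + 4). *)
pose psi k : vec4 R := fun v w x => (N (k + 4)%N)^-1 * u (k + 4)%N v w x.
have cpsi k : cont4 (psi k) by move=> v w; apply: cont01Z; exact: cu.
have psi0 k v w x : 0 <= x <= 1 -> 0 <= psi k v w x.
  by move=> x01; rewrite /psi mulr_ge0 ?invr_ge0 ?(ltW (N0 _))//; exact: u0.
have psi_le k v w x : 0 <= x <= 1 -> psi k v w x <= 648 * profile v w x.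
  move=> x01; rewrite /psi mulrC ler_pdivrMr//.
  have := transfer4_le v w (cu k) (u0 k) x01; rewrite -iterD -/(u _) addnC.
  move/le_trans; apply; rewrite [leRHS]mulrAC; apply: ler_wpM2r; first exact: profile_ge0.
  have := weight_iter_ge 4 (cu k) (u0 k); rewrite -iterD addnC -/(u _) -/(N _) -/(N _).
  rewrite ler_pdivrMr ?exprn_gt0// (_ : 3 ^+ 4 = 81); last by ring.
  by move: (N _) (N _) => a b; lra.
have psi_le1 k v w x : 0 <= x <= 1 -> psi k v w x <= 648.
  by move=> x01; apply: le_trans (psi_le k v w x x01) _; rewrite ler_piMr ?ler0n ?profile_le1.
(* In a difference of consecutive terms the relative errors of numerator and denominator add up to 2
   e, the value is at most 648, and N n / N (n + 1) is at most 3. *)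
pose D := 6 * 648 * C.
have D0 : 0 <= D by apply: mulr_ge0 C0; apply: mulr_ge0; rewrite ler0n.
have e_le k : e (k + 4)%N <= C * rho ^+ k.
  by apply: ler_wpM2l => //; rewrite ler_wiXn2l ?(ltW r0) ?(ltW r1)// leq_addr.
have e0 n : 0 <= e n by rewrite mulr_ge0// exprn_ge0// ltW.
have psi_step k v w x : 0 <= x <= 1 -> `|psi k.+1 v w x - psi k v w x| <= D * rho ^+ k.
  move=> x01; rewrite /psi addSn; set n := (k + 4)%N.
  have un0 : 0 <= u n v w x := u0 n v w x x01.
  have := psi_le1 k v w x x01; rewrite /psi -/n.
  have Nn := N0 n; have NSn := N0 n.+1; have := NS n; have := e_le k; rewrite -/n.
  have := gap' n v w x x01; have := gapN n.
  move: (u n v w x) (u n.+1 v w x) (N n) (N n.+1) (e n) (e0 n) un0 Nn NSn => a b P Q ep ep0 a0 P0 Q0.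
  move=> /andP[q1 q2] /andP[b1 b2] hep hQ ha.
  have -> : Q^-1 * b - P^-1 * a = (b * P - Q * a) / (P * Q).
    by field; rewrite !gt_eqF.
  rewrite normrM normfV (gtr0_norm (mulr_gt0 P0 Q0)) ler_pdivrMr ?mulr_gt0//.
  apply: (@le_trans _ _ (2 * ep * a * P)).
    have b1P := ler_wpM2r (ltW P0) b1; have b2P := ler_wpM2r (ltW P0) b2.
    have q1a := ler_wpM2r a0 q1; have q2a := ler_wpM2r a0 q2.
    by move: b1P b2P q1a q2a; clear; rewrite ler_norml => *; apply/andP; split; lra.
  have aP : a <= 648 * P by rewrite -ler_pdivrMr// mulrC.
  apply: (@le_trans _ _ (2 * ep * (648 * P) * P)).
    by apply: (ler_wpM2r (ltW P0)); apply: ler_wpM2l aP; rewrite mulr_ge0.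
  have -> : 2 * ep * (648 * P) * P = 1296 * P * ep * P by ring.
  have -> : D * rho ^+ k * (P * Q) = 1296 * P * (C * rho ^+ k) * (3 * Q) by rewrite /D; ring.
  have : 0 <= 1296 * P by apply: mulr_ge0 (ltW P0); rewrite ler0n.
  move: (1296 * P) => Z Z0; apply: ler_pM; [exact: mulr_ge0|exact: ltW|exact: ler_wpM2l|].
  by move: hQ; clear; lra.
pose phi : vec4 R := fun v w x => geolim D rho (fun k => psi k v w x).
pose E k := D / (1 - rho) * rho ^+ k.
have phiE k v w x : 0 <= x <= 1 -> `|psi k v w x - phi v w x| <= E k.
  by move=> x01; apply: (@geolimP _ D rho (fun k => psi k v w x)) => // n; exact: psi_step.
have E0 k : 0 <= E k.
  by rewrite /E mulr_ge0 ?exprn_ge0 ?(ltW r0)// divr_ge0// subr_ge0 ltW.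
have cphi : cont4 phi.
  move=> v w; apply/cont01P => x x01 ep ep0.
  have ep3 : 0 < ep / 3 by rewrite divr_gt0.
  have [k hk] := @geometric_small _ (D / (1 - rho)) rho (ep / 3) r01 ep3.
  have [d d0 hd] := (cont01P (psi k v w)).1 (cpsi k v w) x x01 _ ep3.
  exists d => // y y01 xy; have := hd y y01 xy; have := phiE k v w x x01; have := phiE k v w y y01.
  move: hk; rewrite -/(E k) ler_norml ltr_norml ler_norml ltr_norml.
  clear; move=> hk /andP[? ?] /andP[? ?] /andP[? ?].
  by apply/andP; split; lra.
(* 8192 = 2^13 bounds the growth of the weight during the 13 steps of [transfer13_ge]. *)
pose c := (6 * 15552 * 8192 : R)^-1.
have c0 : 0 < c.
  by rewrite /c invr_gt0; apply: mulr_gt0; [apply: mulr_gt0|]; rewrite ltr0n.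
have psi_ge k v w x : 0 <= x <= 1 -> c * profile v w x <= psi (k + 9)%N v w x.
  move=> x01; rewrite /psi -addnA addnE mulrC mulrC [leRHS]mulrC ler_pdivlMr//.
  have := transfer13_ge v w (cu k) (u0 k) x01; rewrite -iterD addnC -/(u _).
  apply: le_trans; rewrite [leLHS]mulrAC; apply: ler_wpM2r; first exact: profile_ge0.
  have := weight_iter_le 13 (cu k) (u0 k); rewrite -iterD addnC -/(u _) -/(N _) -/(N k) => h.
  apply: le_trans (ler_wpM2l (ltW c0) h) _.
  rewrite mulrA [leRHS]mulrC; apply: ler_wpM2r; first exact: ltW.
  rewrite le_eqVlt; apply/orP; left; apply/eqP.
  have -> : 2 ^+ 13 = 8192 :> R by rewrite -natrX.
  by rewrite /c; move: (6 * 15552 : R) => z; rewrite invfM mulfVK ?pnatr_eq0.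
exists lam, phi, c, 648; split => //.
- move=> v w x x01; apply/andP; split.
    apply: (@le_geometric _ _ _ (E 9) rho r01) => k.
    have [_ h2] := dist_le (phiE (k + 9)%N v w x x01); have h := psi_ge k v w x x01.
    have <- : E (k + 9)%N = E 9 * rho ^+ k by rewrite /E exprD; ring.
    by rewrite -lerBlDr; apply: le_trans h2; rewrite lerD2r.
  apply: (@le_geometric _ _ _ (D / (1 - rho)) rho r01) => k.
  have [h1 _] := dist_le (phiE k v w x x01); apply: le_trans h1 _.
  by rewrite -/(E k) lerD2r; exact: psi_le.
(* Both sides are approximated through psi k; the first summand of the constant collects the two
   errors E k and lam E k, the second the defect of psi k as an eigenfunction. *)
- move=> v w x x01; apply/eqP; rewrite -subr_eq0 -normr_le0.
  apply: (@le_geometric _ _ _ ((1 + lam) * (D / (1 - rho)) + C * 648) rho r01) => k.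
  rewrite add0r mulrDl -mulrA -/(E k).
  have Kpsi : K (psi k) v w x = (N (k + 4)%N)^-1 * u (k + 4).+1 v w x.
    by rewrite transfer_scale.
  have h1 : `|K (psi k) v w x - lam * psi k v w x| <= C * 648 * rho ^+ k.
    rewrite Kpsi /psi mulrCA -mulrBr normrM ger0_norm ?invr_ge0 ?(ltW (N0 _))//.
    rewrite mulrC ler_pdivrMr//.
    have := gap (k + 4)%N v w x x01; rewrite -iterSr -/(u _) -/(u _) => /le_trans; apply.
    rewrite -/(e _).
    have -> : C * 648 * rho ^+ k * N (k + 4)%N = C * rho ^+ k * (648 * N (k + 4)%N) by ring.
    apply: ler_pM => //; first exact: (u0 _ v w x x01).
    by rewrite -ler_pdivrMr// mulrC psi_le1.
  have h2 : `|K phi v w x - K (psi k) v w x| <= E k.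
    have hi : le4 phi (lin4 1 (psi k) (E k) one4).
      move=> v' w' y y01; rewrite /lin4 /one4 mul1r mulr1.
      by have [] := dist_le (phiE k v' w' y y01).
    have lo : le4 (lin4 1 (psi k) (- E k) one4) phi.
      move=> v' w' y y01; rewrite /lin4 /one4 mul1r mulr1.
      by have [] := dist_le (phiE k v' w' y y01).
    have := le_transfer cphi (@cont4_lin _ 1 _ (E k) _ (cpsi k) c1) hi v w x01.
    have := le_transfer (@cont4_lin _ 1 _ (- E k) _ (cpsi k) c1) cphi lo v w x01.
    rewrite !transfer_lin// /lin4 !mul1r mulNr.
    have := ler_wpM2l (E0 k) (transfer_one_le v w x01); rewrite mulr1.
    exact: dist_le_of.
  have h3' : `|lam * psi k v w x - lam * phi v w x| <= lam * E k.
    by rewrite -mulrBr normrM gtr0_norm// ler_wpM2l ?(ltW lam0)//; exact: phiE.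
  have := dist_trans3 h1 h2 h3'; rewrite mulrDl mul1r; apply: le_trans; rewrite lexx //.
Qed.
End Perron.

(** * Consequences of the eigenpair: convergence of orbits and domination of other eigenvalues *)

Section SpectralConsequences.
Local Open Scope complex_scope.
Variable R : realType.
Implicit Types (f g h : vec4 R) (u v w : bool) (x y c m M : R).
Local Notation K := (@transfer R).
Local Notation rho := (rate R).

Section WithPair.
Variables (lam : R) (phi : vec4 R) (c1 c2 : R).
Hypotheses (lam0 : 0 < lam) (cphi : cont4 phi) (c10 : 0 < c1)
  (phi_ge : forall v w x, 0 <= x <= 1 -> c1 * profile v w x <= phi v w x)
  (phi_le : forall v w x, 0 <= x <= 1 -> phi v w x <= c2 * profile v w x)
  (phi_eig : forall v w x, 0 <= x <= 1 -> K phi v w x = lam * phi v w x).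

Lemma perron_ge0 : le4 (zero4 R) phi.
Proof. by move=> v w x x01; apply: le_trans (phi_ge v w x01); rewrite mulr_ge0 ?profile_ge0// ltW. Qed.

Lemma perron_iter n v w x : 0 <= x <= 1 -> iter n K phi v w x = lam ^+ n * phi v w x.
Proof.
elim: n v w x => [|n IH] v w x x01; first by rewrite expr0 mul1r.
rewrite iterS (@transfer_congr _ _ (fun v w x => lam ^+ n * phi v w x))//.
by rewrite transfer_scale// phi_eig// exprSr mulrA.
Qed.

Lemma perron_c2_gt0 : 0 < c2.
Proof.
have x01 : 0 <= (0 : R) <= 1 by rewrite lexx ler01.
have := le_trans (phi_ge false false x01) (phi_le false false x01).
by rewrite /profile/= !mulr1; exact: lt_le_trans.
Qed.

Lemma perron_bound n v w x : 0 <= x <= 1 -> lam ^+ n * phi v w x <= c2 * lam ^+ n.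
Proof.
move=> x01; rewrite mulrC; apply: ler_wpM2r; first by rewrite exprn_ge0// ltW.
by apply: le_trans (phi_le v w x01) _; rewrite ler_piMr ?profile_le1// ltW// perron_c2_gt0.
Qed.

(** An arbitrary h need not vanish where phi does. Thirteen steps applied to the bound of |h| by a
    constant put the iterate between two multiples of phi, where [spectral_gap] takes over. *)
Lemma perron_gap h : cont4 h -> exists k C, 0 <= C /\ forall n v w x, 0 <= x <= 1 ->
    `|iter (n + 13) K h v w x - k * (lam ^+ n * phi v w x)| <= C * (rho * lam) ^+ n.
Proof.
move=> ch; have [D D0 hD] := cont4_bounded ch.
have g1 := @one4_ge0 R; have k1 := @cont4_one R; have w1 := @weight_one_gt0 R.
have wphi := weight_ge_profile cphi c10 phi_ge.
have b1 : bracket (- D) D (@one4 R) h.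
  by move=> v w x x01; rewrite /one4 !mulr1 -ler_norml hD.
have b13 := bracket_iter 13 k1 ch b1.
pose M := 4096 * weight (@one4 R) / c1 * D.
have M_ge v w x : 0 <= x <= 1 -> D * iter 13 K (@one4 R) v w x <= M * phi v w x.
  move=> x01; rewrite /M -mulrA mulrCA; apply: ler_wpM2l => //.
  apply: le_trans (transfer13_le v w k1 g1 x01) _.
  rewrite [leRHS]mulrAC -[leRHS]mulrA; apply: ler_wpM2l.
    by apply: mulr_ge0 (ltW w1); rewrite ler0n.
  by rewrite ler_pdivlMr// mulrC phi_ge.
have br : bracket (- M) M phi (iter 13 K h).
  move=> v w x x01; have /andP[h1 h2] := b13 v w x x01; have h3 := M_ge v w x x01.
  apply/andP; split; last exact: le_trans h3.
  by apply: le_trans h1; rewrite !mulNr lerN2.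
have [k [C [C0 gap]]] := spectral_gap cphi (cont4_iter 13 ch) perron_ge0 wphi br.
exists k, (C * c2); split; first by rewrite mulr_ge0// ltW// perron_c2_gt0.
move=> n v w x x01; have := gap n v w x x01; rewrite -iterD perron_iter//.
move=> /le_trans; apply.
rewrite exprMn -mulrA -[leRHS]mulrA; apply: ler_wpM2l => //.
rewrite [leRHS]mulrCA; apply: ler_wpM2l; first by rewrite exprn_ge0// ltW// rate_gt0.
exact: perron_bound.
Qed.

Let x01 : 0 <= (0 : R) <= 1. Proof. by rewrite lexx ler01. Qed.

(** K^13 h >= c phi with c > 0 by [transfer13_ge], and positivity of K preserves this along the
    orbit, so the limiting coefficient is at least c. *)
Lemma perron_gap_gt0 h k C : cont4 h -> le4 (zero4 R) h -> 0 < weight h ->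
  (forall n v w x, 0 <= x <= 1 ->
    `|iter (n + 13) K h v w x - k * (lam ^+ n * phi v w x)| <= C * (rho * lam) ^+ n) -> 0 < k.
Proof.
move=> ch h0 wh gap.
have c20 := perron_c2_gt0.
pose c := weight h / (6 * 15552) / c2.
have c0 : 0 < c.
  apply: divr_gt0 c20; apply: divr_gt0 wh _.
  by apply: mulr_gt0; rewrite ltr0n.
have lo n : c * (lam ^+ n * phi false false 0) <= iter (n + 13) K h false false 0.
  have b : le4 (fun v w x => c * phi v w x) (iter 13 K h).
    move=> v w x y01; apply: le_trans (transfer13_ge v w ch h0 y01).
    rewrite /c mulrAC ler_pdivrMr// -[leRHS]mulrA; apply: ler_wpM2l.
      by apply: divr_ge0 (ltW wh) _; apply: mulr_ge0; rewrite ler0n.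
    by rewrite mulrC phi_le.
  have cp : cont4 (lin4 c phi 0 phi) by exact: cont4_lin.
  have b' : le4 (lin4 c phi 0 phi) (iter 13 K h).
    by move=> v w x y01; rewrite /lin4 mul0r addr0; exact: b.
  have := le_iter_transfer n cp (cont4_iter 13 ch) b' false false x01.
  by rewrite iter_transfer_lin// /lin4 mul0r addr0 perron_iter// -iterD.
have p0 : 0 < phi false false 0.
  by apply: lt_le_trans (phi_ge false false x01); rewrite mulr_gt0.
suff : c <= k by exact: lt_le_trans.
have r01 : 0 < rho < 1 by rewrite rate_gt0 rate_lt1.
apply: (@le_geometric _ _ _ (C / phi false false 0) rho r01) => n.
have l0 : 0 < lam ^+ n by rewrite exprn_gt0.
have [h1 h2] := dist_le (gap n false false 0 x01).
have := le_trans (lo n) (_ : _ <= k * (lam ^+ n * phi false false 0) + C * (rho * lam) ^+ n).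
rewrite -lerBlDr h2 => /(_ isT).
have -> : k * (lam ^+ n * phi false false 0) + C * (rho * lam) ^+ n =
   (k + C / phi false false 0 * rho ^+ n) * (lam ^+ n * phi false false 0).
  by rewrite exprMn; field; rewrite gt_eqF.
by rewrite ler_pM2r// mulr_gt0.
Qed.

(** Combining consecutive estimates of [perron_gap] eliminates the unknown coefficient k. *)
Lemma perron_step h : cont4 h -> exists2 C, 0 <= C & forall n v w x, 0 <= x <= 1 ->
  `|iter (n + 14) K h v w x - lam * iter (n + 13) K h v w x| <= C * (rho ^+ n * lam ^+ n).
Proof.
move=> ch; have [k [C [C0 gap]]] := perron_gap ch.
have r01 := @rate_lt1 R; have r0 := @rate_gt0 R.
exists (C * (2 * lam)); first by rewrite mulr_ge0// mulr_ge0// ltW.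
move=> n v w x y01; have := gap n v w x y01; have := gap n.+1 v w x y01.
rewrite addSn -addnS (exprS lam) -exprMn.
have : C * (rho * lam) ^+ n.+1 <= C * (lam * (rho * lam) ^+ n).
  apply: ler_wpM2l => //; rewrite exprS; apply: ler_wpM2r.
    by rewrite exprn_ge0// mulr_ge0// ltW.
  by rewrite ler_piMl// ltW.
move: (iter _ _ _ _ _ _) (iter _ _ _ _ _ _) ((rho * lam) ^+ n) => a b z h0 h1 h2.
have h1' := le_trans h1 h0.
have h2' : `|lam * (a - k * (lam ^+ n * phi v w x))| <= lam * (C * z).
  by rewrite normrM gtr0_norm// ler_wpM2l// ltW.
move: h1' h2'; rewrite !ler_norml; move: (lam ^+ n) (phi v w x); clear => t p.
by move=> /andP[? ?] /andP[? ?]; apply/andP; split; lra.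
Qed.

Lemma normc_le (a b : R) : Normc.normc (a +i* b) <= `|a| + `|b|.
Proof.
rewrite /= -[leRHS]ger0_norm ?addr_ge0// -sqrtr_sqr ler_wsqrtr// sqrrD !real_normK ?num_real//.
by rewrite lerD2r lerDl mulrn_wge0// mulr_ge0.
Qed.

Lemma normcX (z : R[i]) n : Normc.normc (z ^+ n) = Normc.normc z ^+ n.
Proof.
elim: n => [|n IH]; first by rewrite !expr0 Normc.normc1.
by rewrite !exprS Normc.normcM IH.
Qed.

(** For F = f + i g the difference K^(n+14) F - lam K^(n+13) F equals mu^(n+13) (mu - lam) F, and it
    is O((rho lam)^n) by [perron_step]. If |mu| were at least lam, this would force (mu - lam) F =
    0. The complex eigenfunction is kept as a pair of real quadruples because K is real. *)
Lemma perron_dominant f g (mu : R[i]) v w x : cont4 f -> cont4 g ->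
  (forall v w x, 0 <= x <= 1 -> K f v w x +i* K g v w x = mu * (f v w x +i* g v w x)) ->
  0 <= x <= 1 -> f v w x +i* g v w x != 0 -> mu != lam%:C ->
  Normc.normc mu < lam.
Proof.
move=> cf cg eig y01 fg0 mul; rewrite ltNge; apply/negP => lemu.
have it n v' w' y : 0 <= y <= 1 ->
    iter n K f v' w' y +i* iter n K g v' w' y = mu ^+ n * (f v' w' y +i* g v' w' y).
  elim: n v' w' y => [|n IH] v' w' y y01'; first by rewrite expr0 mul1r.
  have e1 := @transfer_congr _ (iter n K f) (lin4 (complex.Re (mu ^+ n)) f (- complex.Im (mu ^+ n)) g).
  have e2 := @transfer_congr _ (iter n K g) (lin4 (complex.Im (mu ^+ n)) f (complex.Re (mu ^+ n)) g).
  rewrite !iterS e1 ?e2//; last 2 first.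
  - move=> v1 w1 z z01; have := IH v1 w1 z z01; case: (mu ^+ n) => a b [h1 h2].
    by rewrite h2 /lin4 /=; ring.
  - move=> v1 w1 z z01; have := IH v1 w1 z z01; case: (mu ^+ n) => a b [h1 h2].
    by rewrite h1 /lin4 /=; ring.
  rewrite !transfer_lin// exprSr -mulrA -eig// /lin4.
  by case: (mu ^+ n) => a b; congr (_ +i* _); rewrite /=; ring.
have [C C0 hC] := perron_step cf; have [D D0 hD] := perron_step cg.
have r01 : 0 < rho < 1 by rewrite rate_gt0 rate_lt1.
pose z := Normc.normc (mu - lam%:C) * Normc.normc (f v w x +i* g v w x) * lam ^+ 13.
have nz (t : R[i]) : t != 0 -> 0 < Normc.normc t.
  move=> t0; rewrite lt_neqAle; apply/andP; split.
    by rewrite eq_sym; apply/eqP => /Normc.eq0_normc; apply/eqP.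
  by case: t {t0} => a b; exact: sqrtr_ge0.
have z0 : 0 < z by rewrite /z !mulr_gt0 ?exprn_gt0// nz// subr_eq0.
suff : z <= 0 by rewrite leNgt z0.
apply: (@le_geometric _ _ _ (C + D) rho r01) => n; rewrite add0r.
have ln0 : 0 < lam ^+ n by rewrite exprn_gt0.
rewrite -(ler_pM2r ln0).
have : Normc.normc (mu ^+ (n + 13) * (mu - lam%:C) * (f v w x +i* g v w x)) <= (C + D) * rho ^+ n * lam ^+ n.
  have -> : mu ^+ (n + 13) * (mu - lam%:C) * (f v w x +i* g v w x) =
     (iter (n + 14) K f v w x - lam * iter (n + 13) K f v w x) +i*
     (iter (n + 14) K g v w x - lam * iter (n + 13) K g v w x).
    have e13 := it (n + 13)%N v w x y01.
    have e14 := it (n + 13).+1 v w x y01; rewrite -(addnS n 13) in e14.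
    transitivity ((iter (n + 14) K f v w x +i* iter (n + 14) K g v w x) -
      lam%:C * (iter (n + 13) K f v w x +i* iter (n + 13) K g v w x)).
      by rewrite e14 e13 (addnS n 13) exprS; move: (mu ^+ _) => t; ring.
    by apply/eqP; rewrite eq_complex/= !mul0r subr0 addr0 !eqxx.
  apply: le_trans (normc_le _ _) _; rewrite -mulrA mulrDl; apply: lerD; [exact: hC|exact: hD].
apply: le_trans; rewrite !Normc.normcM normcX /z -[leLHS]mulrA -exprD addnC.
rewrite -[leRHS]mulrA [leRHS]mulrC; apply: ler_wpM2l.
  by apply: mulr_ge0; apply/ltW/nz => //; rewrite subr_eq0.
by apply: lerXn2r; rewrite ?nnegrE ?(ltW lam0)//; exact: le_trans (ltW lam0) _.
Qed.

Lemma perron_real_le f (mu : R) v w x : cont4 f ->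
  (forall v w x, 0 <= x <= 1 -> K f v w x = mu * f v w x) ->
  0 <= x <= 1 -> f v w x != 0 -> mu <= lam.
Proof.
move=> cf eig y01 f0; have [->//|nmu] := eqVneq mu lam.
have c0 : cont4 (zero4 R) by move=> v' w'; exact: cont01_cst.
have k0 v' w' y : 0 <= y <= 1 -> K (zero4 R) v' w' y = 0.
  move=> y01'; have := @transfer_scale R 0 f v' w' y cf y01'; rewrite mul0r => <-.
  by apply: transfer_congr => // v1 w1 z _; rewrite mul0r.
have : Normc.normc mu%:C < lam.
  apply: (@perron_dominant f (zero4 R) mu%:C v w x cf c0) => //.
  - move=> v' w' y y01'; rewrite eig// k0//; apply/eqP; rewrite eq_complex/= /zero4.
    by rewrite !mul0r !mulr0 subr0 addr0 !eqxx.
  - by rewrite eq_complex /= (negbTE f0).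
  - by rewrite eq_complex /= (negbTE nmu).
move=> /ltW; apply: le_trans; rewrite /= expr0n addr0 sqrtr_sqr; exact: ler_norm.
Qed.

End WithPair.

End SpectralConsequences.

(** * Descent words and the recursion on the last value *)

Section DescentWords.
Local Open Scope nat_scope.

Definition descents (s : seq nat) : seq bool :=
  if s is x :: s' then pairmap (fun y z => z < y) x s' else [::].

Definition good_word (u : seq bool) : bool :=
  ~~ infix [:: letter_b; letter_a; letter_b] u &&
  ~~ infix [:: letter_a; letter_b; letter_a] u.

Lemma infix3_rcons (a b c : bool) (u : seq bool) (l v w : bool) :
  infix [:: a; b; c] (rcons (rcons (rcons u l) v) w) =
  infix [:: a; b; c] (rcons (rcons u l) v) || [&& a == l, b == v & c == w].
Proof.
rewrite -infix_rev -[in RHS]infix_rev !rev_rcons.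
rewrite (_ : rev [:: a; b; c] = [:: c; b; a])// [in LHS]infix_consl orbC.
by congr (_ || _); rewrite /= prefix0s andbT andbC andbA [X in X && _]andbC.
Qed.

Lemma good_rcons3 u l v w : good_word (rcons (rcons (rcons u l) v) w) =
  good_word (rcons (rcons u l) v) && allowed l v w.
Proof.
rewrite /good_word !infix3_rcons !negb_or.
by rewrite /allowed; case: l; case: v; case: w => /=; rewrite ?andbT ?andbF.
Qed.

(** A doubled last letter is not isolated. This lets [ending], which tests two further letters, also
    count permutations extended by one letter only. *)
Lemma good_rcons2 u l : good_word (rcons (rcons u l) l) = good_word (rcons u l).
Proof.
case/lastP: u => [|u k]; first by case: l.
by rewrite good_rcons3 /allowed eqxx orbT andbT.
Qed.

Lemma descents_rcons x s y : descents (rcons (x :: s) y) = rcons (descents (x :: s)) (y < last x s).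
Proof. by rewrite /= -cats1 pairmap_cat cats1. Qed.

Lemma descents_map (f : nat -> nat) s : {mono f : x y / x < y} ->
  descents (map f s) = descents s.
Proof.
move=> fm; case: s => //= x s; elim: s x => //= y s IH x.
by rewrite fm IH.
Qed.

Definition values n (s : 'S_n) : seq nat := [seq nat_of_ord (s i) | i <- enum 'I_n].

Lemma descent_wordE n (s : 'S_n) : descent_word s = descents (values s).
Proof. by []. Qed.

Lemma no_isolatedE n (s : 'S_n) : no_isolated s = good_word (descent_word s).
Proof. by []. Qed.

Lemma bump_mono k : {mono bump k : x y / x < y}.
Proof. by move=> x y; rewrite /bump; case: (leqP k x); case: (leqP k y); lia. Qed.

Lemma values_lift_perm n (k : 'I_n.+1) (t : 'S_n) :
  values (lift_perm ord_max k t) = rcons (map (bump k) (values t)) k.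
Proof.
rewrite /values enum_ordSr map_rcons lift_perm_id; congr rcons.
rewrite -!map_comp; apply: eq_map => i /=.
have -> : widen_ord (leqnSn n) i = lift ord_max i.
  by apply: val_inj; rewrite /= /bump leqNgt ltn_ord.
by rewrite lift_perm_lift.
Qed.

Lemma values_last n (t : 'S_n.+1) : exists x s,
  values t = x :: s /\ last x s = t ord_max.
Proof.
rewrite /values enum_ordSr map_rcons.
case e: (map _ _) => [|x s] /=; first by exists (nat_of_ord (t ord_max)), [::].
by exists x, (rcons s (t ord_max)); rewrite last_rcons.
Qed.

(** [lift_perm] appends the value k and raises the old values that are at least k. The old letters
    are unchanged, and the new one is a descent exactly when the old last value has been raised. *)
Lemma descent_word_lift_perm n (k : 'I_n.+2) (t : 'S_n.+1) :
  descent_word (lift_perm ord_max k t) = rcons (descent_word t) (k <= t ord_max).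
Proof.
rewrite !descent_wordE values_lift_perm -(descents_map (values t) (@bump_mono k)).
have [x [s [-> l]]] := values_last t.
rewrite [map _ _]/= descents_rcons last_map l; congr rcons.
rewrite /bump; lia.
Qed.

Lemma lift_perm_bij n : bijective (fun p : 'I_n.+1 * 'S_n => lift_perm ord_max p.1 p.2).
Proof.
apply: inj_card_bij; last first.
  by rewrite card_prod !card_Sn card_ord factS.
move=> [k t] [k' t'] /= e.
have kk : k = k' by rewrite -(lift_perm_id ord_max k t) e lift_perm_id.
rewrite -{k'}kk in e *; congr (_, _); apply/permP => i; apply: (@lift_inj _ k).
by rewrite -!(lift_perm_lift ord_max) e.
Qed.

Lemma sum_perm_lift n (F : 'S_n.+1 -> nat) :
  \sum_s F s = \sum_(k < n.+1) \sum_t F (lift_perm ord_max k t).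
Proof.
rewrite pair_bigA /=; apply: reindex.
by apply: onW_bij; exact: lift_perm_bij.
Qed.

(* Permutations of n+1 letters ending at value k whose descent word can be
   continued by the letters v, w. *)
Definition ending n (v w : bool) (k : nat) : nat :=
  \sum_(t : 'S_n.+1) ((t ord_max == k :> nat) && good_word (rcons (rcons (descent_word t) v) w)).

Lemma ending0 v w : ending 0 v w 0 = 1.
Proof.
rewrite /ending (bigD1 (1 : 'S_1)%g)//= big1 ?addn0; last first.
  by move=> t /eqP []; apply/permP => i; rewrite !ord1.
have -> : descent_word (1 : 'S_1)%g = [::].
  rewrite descent_wordE; have [x [s [e _]]] := values_last (1 : 'S_1)%g.
  have es := congr1 size e; rewrite size_map size_enum_ord in es.
  by rewrite e; case: s es {e}.
by rewrite ord1 /=; case: v; case: w.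
Qed.

(** Removing the last value k exposes a last value j, and k <= j says that the letter between them
    is b: the sum splits at k as [transfer] splits at x. *)
Lemma ending_rec n v w k : k < n.+2 ->
  ending n.+1 v w k = \sum_(j < n.+1) allowed (k <= j) v w * ending n (k <= j) v j.
Proof.
move=> kn; rewrite /ending sum_perm_lift (bigD1 (Ordinal kn))//= [X in _ + X = _]big1 ?addn0; last first.
  move=> k' k'k; rewrite big1// => t _; rewrite lift_perm_id.
  case: eqP => // e; case/eqP: k'k; exact: val_inj.
under eq_bigr do rewrite lift_perm_id eqxx descent_word_lift_perm/= good_rcons3.
under [RHS]eq_bigr do rewrite big_distrr/=.
rewrite exchange_big/=; apply: eq_bigr => t _.
rewrite (bigD1 (t ord_max))//= big1 ?addn0; last first.
  by move=> j jt; rewrite eq_sym (negbTE (_ : j != t ord_max :> nat))//= muln0.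
by rewrite eqxx/=; case: (good_word _); case: (allowed _ _ _).
Qed.

Lemma alpha_ending n :
  alpha n.+2 = \sum_(k < n.+2) \sum_(j < n.+1) ending n (k <= j) (k <= j) j.
Proof.
rewrite /alpha -sum1_card.
transitivity (\sum_(s : 'S_n.+2) no_isolated s : nat).
  rewrite big_mkcond/=; apply: eq_bigr => s _; rewrite inE; by case: (no_isolated s).
rewrite sum_perm_lift; apply: eq_bigr => k _.
rewrite /ending exchange_big/=; apply: eq_bigr => t _.
rewrite (bigD1 (t ord_max))//= big1 ?addn0; last first.
  by move=> j jt; rewrite eq_sym (negbTE (_ : j != t ord_max :> nat)).
by rewrite eqxx/= good_rcons2 no_isolatedE descent_word_lift_perm.
Qed.

End DescentWords.

(** * Bernstein sums: the counts as coefficients of iterates of the operator *)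

Section Bernstein.
Variable R : realType.
Implicit Types (x y : R) (c : nat -> R) (n m k : nat).
Local Notation K := (@transfer R).

(** Among n uniform points, k lie below a given last point x with probability n! / (k! (n-k)!) x^k
    (1-x)^(n-k), and n! orders of the n + 1 points have last value k. If c k counts the favourable
    ones among these, the sum is the probability of the favourable case given x. *)
Definition bern_sum n c : {poly R} := \sum_(k < n.+1)
  c k *: ((k`!%:R^-1 *: 'X^k) * ((n - k)`!%:R^-1 *: (1 - 'X) ^+ (n - k))).

Let P m : {poly R} := m`!%:R^-1 *: 'X^m.
Let Q m : {poly R} := m`!%:R^-1 *: (1 - 'X) ^+ m.

Let fact_inv m : m.+1`!%:R^-1 * m.+1%:R = m`!%:R^-1 :> R.
Proof. by rewrite factS natrM invfM mulrAC mulVf ?mul1r// pnatr_eq0. Qed.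

Let derivP m : (P m.+1)^`() = P m.
Proof. by rewrite /P derivZ derivXn -[_ *+ m.+1]scaler_nat scalerA fact_inv. Qed.

Let deriv1 : (1 : {poly R})^`() = 0.
Proof. by rewrite -polyC1 derivC. Qed.

Let derivQ m : (Q m.+1)^`() = - Q m.
Proof.
rewrite /Q derivZ deriv_exp derivB derivX deriv1 sub0r mulN1r mulNrn scalerN.
by rewrite -[_ *+ m.+1]scaler_nat scalerA fact_inv.
Qed.

Lemma deriv_bern_sum n c :
  (bern_sum n.+1 c)^`() = bern_sum n (fun k => c k.+1 - c k).
Proof.
rewrite /bern_sum raddf_sum/=.
transitivity (\sum_(k < n.+2) c k *: ((P k)^`() * Q (n.+1 - k)) +
  \sum_(k < n.+2) c k *: (P k * (Q (n.+1 - k))^`())).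
  by rewrite -big_split; apply: eq_bigr => k _; rewrite derivZ derivM scalerDr.
rewrite big_ord_recl [X in _ + X]big_ord_recr/= subnn.
have -> : (P 0%N)^`() = 0 by rewrite /P derivZ expr0 deriv1 scaler0.
rewrite mul0r mulr0 !scaler0 add0r addr0 -big_split; apply: eq_bigr => k _ /=.
have kn : (k <= n)%N by rewrite -ltnS.
by rewrite /bump leq0n add1n subSS derivP subSn// derivQ mulrN scalerN -scalerBl.
Qed.

Lemma bern_sum0 n c : (bern_sum n c).[0] = c 0%N / n`!%:R.
Proof.
rewrite /bern_sum horner_sum big_ord_recl big1 => [|k _] /=; last first.
  by rewrite hornerZ hornerM !hornerZ hornerXn expr0n/= mulr0 mul0r mulr0.
rewrite addr0 subn0 hornerZ hornerM !hornerZ !horner_exp hornerD hornerN !hornerX -polyC1 hornerC.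
by rewrite subr0 expr1n expr0 !mulr1 invr1 mul1r.
Qed.

Lemma bern_sum1 n c : (bern_sum n c).[1] = c n / n`!%:R.
Proof.
rewrite /bern_sum horner_sum big_ord_recr big1 => [|k _] /=; last first.
  rewrite hornerZ hornerM !hornerZ !horner_exp hornerD hornerN !hornerX -polyC1 hornerC subrr expr0n.
  by rewrite subn_eq0 leqNgt ltn_ord/= mulr0 mulr0 mulr0.
rewrite add0r subnn hornerZ hornerM !hornerZ !horner_exp hornerX.
by rewrite expr1n expr0 !mulr1 invr1 mulr1.
Qed.

Lemma cont01_poly (p : {poly R}) : cont01 (horner p).
Proof. by apply: continuous_cont01; exact: continuous_horner. Qed.

Lemma eq_bern_sum n c d : (forall k, (k <= n)%N -> c k = d k) -> bern_sum n c = bern_sum n d.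
Proof. by move=> cd; apply: eq_bigr => k _; rewrite cd// -ltnS. Qed.

(** Differentiation takes forward differences of the coefficients, so partial sums give a primitive;
    the empty sum at k = 0 makes it vanish at 0. *)
Lemma lint_bern_sum n c x : 0 <= x <= 1 ->
  lint (horner (bern_sum n c)) x = (bern_sum n.+1 (fun k => \sum_(j < k) c j)).[x].
Proof.
move=> x01; set d := fun k => _.
rewrite -[RHS]subr0 -[X in _ - X](_ : (bern_sum n.+1 d).[0] = 0); last first.
  by rewrite bern_sum0 /d big_ord0 mul0r.
apply: lint_unique => //; try exact: cont01_poly.
move=> y _; have := is_derive_poly (bern_sum n.+1 d) y.
rewrite deriv_bern_sum (@eq_bern_sum n (fun k => d k.+1 - d k) c)// => k _.
by rewrite /d big_ord_recr/= addrC addrK.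
Qed.

Lemma rint_bern_sum n c x : 0 <= x <= 1 ->
  rint (horner (bern_sum n c)) x =
  (bern_sum n.+1 (fun k => \sum_(j < n.+1 | (k <= j)%N) c j)).[x].
Proof.
move=> x01; set d := fun k => _.
have e y : 0 <= y <= 1 -> lint (horner (bern_sum n c)) y =
    - (bern_sum n.+1 d).[y] - - (bern_sum n.+1 d).[0].
  apply: (@lint_unique _ _ (fun y => - (bern_sum n.+1 d).[y])); first exact: cont01_poly.
    apply: (@cont01_congr _ (horner (- bern_sum n.+1 d))) => [z _|]; last exact: cont01_poly.
    by rewrite hornerN.
  move=> z _; have dz := is_derive_poly (bern_sum n.+1 d) z.
  apply: is_derive_eq; rewrite deriv_bern_sum.
  rewrite -hornerN; congr (_.[_]).
  rewrite -scaleN1r /bern_sum scaler_sumr; apply: eq_bigr => k _.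
  rewrite scalerA; congr (_ *: _).
  have -> : d k = c k + d k.+1.
    rewrite /d (bigD1 k)//=; congr (_ + _).
    by apply: eq_bigl => j; rewrite [RHS]ltn_neqAle eq_sym andbC.
  by ring.
rewrite lint_rint ?e ?ler01 ?lexx//; last exact: cont01_poly.
rewrite bern_sum1 (_ : d n.+1 = 0); first by ring.
by rewrite /d big1// => j; rewrite leqNgt ltn_ord.
Qed.

Lemma natr_sum_split n k (F : bool -> nat -> nat) (b : bool -> bool) : (k <= n.+1)%N ->
  (\sum_(j < n.+1) b (k <= j)%N * F (k <= j)%N j)%N%:R =
  (b false)%:R * (\sum_(j < k) (F false j)%:R) +
  (b true)%:R * (\sum_(j < n.+1 | (k <= j)%N) (F true j)%:R) :> R.
Proof.
move=> kn; rewrite natr_sum (bigID (fun j : 'I_n.+1 => (k <= j)%N))/= addrC !big_distrr/=.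
congr (_ + _).
  rewrite (@big_ord_widen _ _ _ k n.+1 (fun j => (b false)%:R * (F false j)%:R))//=.
  under eq_bigl do rewrite -ltnNge.
  by apply: eq_bigr => j; rewrite ltnNge => /negbTE ->; rewrite natrM.
by apply: eq_bigr => j ->; rewrite natrM.
Qed.

Lemma transfer_iter_one n v w x : 0 <= x <= 1 ->
  iter n K (@one4 R) v w x = (bern_sum n (fun k => (ending n v w k)%:R)).[x].
Proof.
elim: n v w x => [|n IH] v w x x01.
  rewrite /bern_sum big_ord1 /= ending0 subnn !expr0 invr1 !scale1r mul1r.
  by rewrite -polyC1 hornerC.
rewrite iterS (@transfer_congr _ _ (fun v w => horner (bern_sum n (fun k => (ending n v w k)%:R))))//.
rewrite /transfer lint_bern_sum// rint_bern_sum//.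
rewrite -!hornerZ -hornerD; congr (_.[_]).
rewrite /bern_sum !scaler_sumr -big_split/=; apply: eq_bigr => k _.
rewrite !scalerA -scalerDl; congr (_ *: _).
rewrite ending_rec; last exact: ltn_ord.
by rewrite (natr_sum_split (fun l => ending n l v) (fun l => allowed l v w))// -ltnS.
Qed.

(** Adds the final value and integrates over it. Equal letters appear because of [good_rcons2]: no
    letter follows the last one. *)
Definition weigh_last (f : vec4 R) := lint (fun x => lint (f false false) x + rint (f true true) x) 1.

Lemma alpha_transfer n : (alpha n.+2)%:R / (n.+2)`!%:R = weigh_last (iter n K (@one4 R)).
Proof.
pose c l k : R := (ending n l l k)%:R.
have e v x : 0 <= x <= 1 -> iter n K (@one4 R) v v x = (bern_sum n (c v)).[x].
  by move=> x01; rewrite transfer_iter_one.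
rewrite /weigh_last (@eq_lint _ _ (horner (bern_sum n.+1
   (fun k => (\sum_(j < n.+1) ending n (k <= j)%N (k <= j)%N j)%N%:R))))//; last first.
  move=> x x01; have /andP[x0 x1] := x01.
  rewrite (eq_lint x1 (e false)) (eq_rint x0 (e true)) lint_bern_sum// rint_bern_sum//.
  rewrite -hornerD; congr (_.[_]).
  rewrite /bern_sum -big_split/=; apply: eq_bigr => k _.
  rewrite -scalerDl; congr (_ *: _).
  have kn : (k <= n.+1)%N by rewrite -ltnS.
  have := natr_sum_split (fun l => ending n l l) (fun=> true) kn.
  by rewrite !mul1r => <-; congr (_%:R); apply: eq_bigr => j _; rewrite mul1n.
rewrite lint_bern_sum ?ler01 ?lexx// bern_sum1 alpha_ending natr_sum.
by [].
Qed.

End Bernstein.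

(** * Asymptotics of the number of permutations *)

Section AlphaAsymptotics.
Variable R : realType.
Local Notation K := (@transfer R).
Local Notation rho := (rate R).
Implicit Types (f g : vec4 R).

Lemma cont01_weigh_last f : cont4 f -> cont01 (fun x => lint (f false false) x + rint (f true true) x).
Proof. by move=> cf; cont01. Qed.

Lemma weigh_last_lin c f d g : cont4 f -> cont4 g ->
  weigh_last (lin4 c f d g) = c * weigh_last f + d * weigh_last g.
Proof.
move=> cf cg; have lf := cont01_weigh_last cf; have lg := cont01_weigh_last cg.
rewrite /weigh_last -!lintZ// -lintD//; try exact: cont01Z.
apply: eq_lint => // x x01; have /andP[x0 x1] := x01.
have cl u : cont01 (fun y => c * f u u y + d * g u u y) by cont01.
rewrite /lin4 !lint_rint// !lintD ?lintZ//; try cont01.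
by ring.
Qed.

Lemma weigh_last_le f g : cont4 f -> cont4 g -> le4 f g -> weigh_last f <= weigh_last g.
Proof.
move=> cf cg fg; apply: le_lint => //; try exact: cont01_weigh_last.
move=> x /andP[x0 x1]; apply: lerD; [apply: le_lint|apply: le_rint] => //; try cont01.
  by move=> y; exact: fg.
by move=> y; exact: fg.
Qed.

Lemma weigh_last_one : weigh_last (@one4 R) = 1.
Proof.
rewrite /weigh_last (@eq_lint _ _ (fun=> 1))//.
  by rewrite lint_cst ?ler01 ?lexx// mul1r.
by move=> x x01; rewrite lint_cst// rint_cst//; ring.
Qed.

Section WithPair.
Variables (lam : R) (phi : vec4 R) (c1 c2 : R).
Hypotheses (lam0 : 0 < lam) (cphi : cont4 phi) (c10 : 0 < c1)
  (phi_ge : forall v w x, 0 <= x <= 1 -> c1 * profile v w x <= phi v w x)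
  (phi_le : forall v w x, 0 <= x <= 1 -> phi v w x <= c2 * profile v w x)
  (phi_eig : forall v w x, 0 <= x <= 1 -> K phi v w x = lam * phi v w x).

Lemma weigh_last_gt0 : 0 < weigh_last phi.
Proof.
have c1c : cont4 (lin4 c1 (@profile R) 0 (@one4 R)).
  move=> v w; apply: (@cont01_congr _ (fun x => c1 * profile v w x)).
    by move=> x _; rewrite /lin4 mul0r addr0.
  rewrite /profile; case: eqP => _; first by cont01.
  by case: v; cont01.
have : weigh_last (lin4 c1 (@profile R) 0 (@one4 R)) <= weigh_last phi.
  by apply: weigh_last_le => // v w x x01; rewrite /lin4 mul0r addr0; exact: phi_ge.
apply: lt_le_trans.
rewrite /weigh_last (@eq_lint _ _ (fun=> c1))//.
  by rewrite lint_cst ?ler01 ?lexx// mulr1.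
move=> x x01; have /andP[x0 x1] := x01.
rewrite (@eq_lint _ _ (fun=> c1))// => [|y _]; last first.
  by rewrite /lin4 /profile /=; ring.
rewrite (@eq_rint _ _ (fun=> c1))// => [|y _]; last first.
  by rewrite /lin4 /profile /=; ring.
by rewrite lint_cst// rint_cst//; ring.
Qed.

(** 15 = 13 + 2: the thirteen steps before [perron_gap] applies, the single value from which the
    iteration starts, and the value added by [weigh_last]. *)
Lemma alpha_gap : exists c C : R, 0 < c /\ forall n,
  `|(alpha (n + 15))%:R / (n + 15)`!%:R - c * lam ^+ n| <= C * (rho * lam) ^+ n.
Proof.
have k1 := @cont4_one R.
have [k [C [C0 gap]]] := perron_gap lam0 cphi c10 phi_ge phi_le phi_eig k1.
have k0 : 0 < k.
  exact: (perron_gap_gt0 lam0 cphi c10 phi_ge phi_le phi_eig k1 (@one4_ge0 R) (@weight_one_gt0 R) gap).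
exists (k * weigh_last phi), C; split; first by rewrite mulr_gt0// weigh_last_gt0.
move=> n; rewrite (_ : (n + 15 = (n + 13).+2)%N); last by rewrite -!addnS.
rewrite alpha_transfer; set u := iter _ _ _.
have cu : cont4 u by exact: cont4_iter.
have E v w x : 0 <= x <= 1 -> `|u v w x - k * (lam ^+ n * phi v w x)| <= C * (rho * lam) ^+ n.
  exact: gap.
move: (C * _) E => e E.
have cl d : cont4 (lin4 (k * lam ^+ n) phi d (@one4 R)) by exact: cont4_lin.
have hi : le4 u (lin4 (k * lam ^+ n) phi e (@one4 R)).
  move=> v w x x01; rewrite /lin4 /one4 mulr1 -mulrA addrC -lerBlDr.
  exact: le_trans (ler_norm _) (E v w x x01).
have lo : le4 (lin4 (k * lam ^+ n) phi (- e) (@one4 R)) u.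
  move=> v w x x01; rewrite /lin4 /one4 mulr1 -mulrA lerBlDr -lerBlDl.
  by apply: le_trans (ler_norm _) _; rewrite distrC; exact: E.
have := weigh_last_le cu (cl e) hi; have := weigh_last_le (cl (- e)) cu lo.
rewrite !weigh_last_lin// weigh_last_one.
rewrite (_ : k * weigh_last phi * lam ^+ n = k * lam ^+ n * weigh_last phi); last by ring.
by rewrite !mulr1 => lo' hi'; exact: (dist_le_of (lexx e) lo' hi').
Qed.

Lemma alpha_bigO : exists c r : R, [/\ 0 < c, 0 < r, r < lam &
  (fun n : nat => (alpha n)%:R / n`!%:R - c * lam ^ (n%:Z - 3) : R)
    =O_\oo (fun n : nat => r ^+ n : R)].
Proof.
have [c [C [c0 gap]]] := alpha_gap.
have r0 := @rate_gt0 R; have r1 := @rate_lt1 R.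
have rl0 : 0 < rho * lam by rewrite mulr_gt0.
(* The exponent n - 3 of the statement is 12 more than the exponent n - 15 of [alpha_gap]. *)
exists (c / lam ^+ 12), (rho * lam); split => //.
- by rewrite divr_gt0// exprn_gt0.
- by rewrite gtr_pMl.
apply/eqO_exP; exists (`|C| / (rho * lam) ^+ 15 + 1).
  by rewrite ltr_wpDl// divr_ge0// exprn_ge0// ltW.
exists 15%N => // m /= m15.
have := gap (m - 15)%N; rewrite subnK//.
have -> : lam ^ (m%:Z - 3) = lam ^+ 12 * lam ^+ (m - 15).
  rewrite -exprD -[RHS]/(lam ^ _%:Z); congr (lam ^ _).
  by rewrite addnBA// addnC; lia.
have -> : c / lam ^+ 12 * (lam ^+ 12 * lam ^+ (m - 15)) = c * lam ^+ (m - 15).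
  by rewrite mulrA divfK// gt_eqF// exprn_gt0.
move=> /le_trans; apply.
rewrite (ger0_norm (_ : 0 <= (rho * lam) ^+ m)); last by rewrite exprn_ge0// ltW.
rewrite -[in leRHS](subnK m15) exprD.
have e0 : 0 <= (rho * lam) ^+ (m - 15) by rewrite exprn_ge0// ltW.
have p0 : 0 < (rho * lam) ^+ 15 by rewrite exprn_gt0.
move: ((rho * lam) ^+ (m - 15)) ((rho * lam) ^+ 15) e0 p0 => a b a0 b0.
rewrite mulrDl mul1r -[leLHS]addr0; apply: lerD; last by rewrite mulr_ge0// ltW.
rewrite (_ : `|C| / b * (a * b) = `|C| * a); last by field; rewrite gt_eqF.
by rewrite ler_wpM2r// ler_norm.
Qed.
End WithPair.
End AlphaAsymptotics.

(** * The constants tau and sigma, and the equation in real form *)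

Section Constants.
Local Open Scope complex_scope.
Variable R : realType.
Local Notation t := (@tau R).
Local Notation s := (@sigma R).

Lemma tau_sqr : t ^+ 2 = (1 + Num.sqrt 5) / 2.
Proof. by rewrite /tau sqr_sqrtr// divr_ge0// addr_ge0// sqrtr_ge0. Qed.

Lemma sqrt5E : Num.sqrt 5 = 2 * t ^+ 2 - 1 :> R.
Proof. by rewrite tau_sqr; field. Qed.

Lemma tau_quartic : t ^+ 4 = t ^+ 2 + 1.
Proof.
rewrite (_ : t ^+ 4 = (t ^+ 2) ^+ 2); last by ring.
rewrite tau_sqr; have := @sqr_sqrtr R 5 (ler0n _ _).
by move: (Num.sqrt 5) => q hq; field: hq.
Qed.

Lemma tau_gt1 : 1 < t.
Proof.
have s5 : 1 < Num.sqrt 5 :> R by rewrite -[ltLHS]sqrtr1 ltr_sqrt ?ltr1n ?ltr0n.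
have h : 1 < (1 + Num.sqrt 5) / 2 :> R by move: s5; move: (Num.sqrt 5) => q *; lra.
by rewrite -[ltLHS]sqrtr1 /tau ltr_sqrt// (lt_trans ltr01).
Qed.

Lemma tau_sqr_lt2 : t ^+ 2 < 2.
Proof.
rewrite ltNge; apply/negP => t2; have := tau_quartic.
rewrite (_ : t ^+ 4 = t ^+ 2 * t ^+ 2); last by ring.
have : 2 * t ^+ 2 <= t ^+ 2 * t ^+ 2 by rewrite ler_wpM2r// sqr_ge0.
by move: (t ^+ 2) t2 => z *; lra.
Qed.

(** sigma is the inverse of tau, and so is t (t^2 - 1) because t^4 - t^2 = 1. In this form all
    constants are polynomials in tau, within reach of [ring]. *)
Lemma sigmaE : s = t ^+ 3 - t.
Proof.
have t1 := tau_gt1; have t4 := tau_quartic.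
have p0 : 0 <= t ^+ 3 - t.
  have -> : t ^+ 3 - t = t * (t ^+ 2 - 1) by ring.
  by rewrite mulr_ge0 ?subr_ge0 ?exprn_ege1// ltW// (lt_trans ltr01).
rewrite -[RHS]ger0_norm// -sqrtr_sqr /sigma; congr Num.sqrt.
rewrite sqrt5E (_ : (t ^+ 3 - t) ^+ 2 = t ^+ 4 * t ^+ 2 - 2 * t ^+ 4 + t ^+ 2); last by ring.
rewrite t4 (_ : (t ^+ 2 + 1) * t ^+ 2 = t ^+ 4 + t ^+ 2); last by ring.
by rewrite t4; field.
Qed.

Lemma sigma_gt0 : 0 < s.
Proof.
have t1 := tau_gt1; rewrite sigmaE (_ : t ^+ 3 - t = t * (t ^+ 2 - 1)); last by ring.
by rewrite mulr_gt0 ?subr_gt0 ?exprn_egt1// (lt_trans ltr01).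
Qed.

Lemma sigma_sqr : s ^+ 2 = t ^+ 2 - 1.
Proof.
rewrite sigmaE (_ : (t ^+ 3 - t) ^+ 2 = t ^+ 4 * t ^+ 2 - 2 * t ^+ 4 + t ^+ 2); last by ring.
rewrite tau_quartic (_ : (t ^+ 2 + 1) * t ^+ 2 = t ^+ 4 + t ^+ 2); last by ring.
by rewrite tau_quartic; ring.
Qed.

(** Half of the given equation: its four terms form two pairs of complex conjugates, so that the
    imaginary part cancels. *)
Definition real_equation (l : R) := let E := expR (t / l) in let E' := expR (- t / l) in
  let c := cos (s / l) in let d := sin (s / l) in let q := Num.sqrt 5 in
  E * ((3 - q * t) * c - (q * s - 1) * d) + E' * ((3 + q * t) * c - (1 + q * s) * d) + 4 = 0.

Lemma cexp_div (a b l : R) :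
  cexp ((a +i* b) / l%:C) = (expR (a / l) * cos (b / l)) +i* (expR (a / l) * sin (b / l)).
Proof.
suff -> : (a +i* b) / l%:C = (a / l) +i* (b / l) by [].
rewrite -[l%:C^-1]/(_ -i* _); have [->|l0] := eqVneq l 0.
  by apply/eqP; rewrite eq_complex/= expr0n/= !invr0 !(mulr0,mul0r,oppr0,subr0,addr0) !eqxx.
by apply/eqP; rewrite eq_complex/=; apply/andP; split; apply/eqP; field.
Qed.

Lemma lambda_equationE (l : R) : lambda_equation l <-> real_equation l.
Proof.
rewrite /lambda_equation /real_equation; cbv zeta.
have e1 : t%:C + s%:C * 'i%C = t +i* s.
  by apply/eqP; rewrite eq_complex/=; apply/andP; split; apply/eqP; ring.
have e2 : t%:C - s%:C * 'i%C = t +i* (- s).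
  by apply/eqP; rewrite eq_complex/=; apply/andP; split; apply/eqP; ring.
have e3 : - t%:C + s%:C * 'i%C = (- t) +i* s.
  by apply/eqP; rewrite eq_complex/=; apply/andP; split; apply/eqP; ring.
have e4 : - t%:C - s%:C * 'i%C = (- t) +i* (- s).
  by apply/eqP; rewrite eq_complex/=; apply/andP; split; apply/eqP; ring.
rewrite e1 e2 e3 e4 !cexp_div !mulNr !cosN !sinN -!mulNr.
move: (expR _) (expR _) (cos _) (sin _) => E E' c d; move: (Num.sqrt 5) (tau R) (sigma R) => q a b.
have i3 (k : nat) : (k%:R : R[i]) = k%:R +i* 0 by rewrite -[LHS](rmorph_nat (real_complex R)).
split.
  rewrite !i3 => /eqP; rewrite eq_complex => /andP[/eqP h _]; move: h => /=.
  by move=> h; clear - h; lra.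
move=> h; apply/eqP; rewrite !i3 eq_complex; apply/andP; split; apply/eqP => /=.
  by clear - h; lra.
by ring.
Qed.

End Constants.

(** * Polynomial identities behind the factorization of the equation *)

Section SecularFactorization.
Variable R : realType.
Variables t s H h C S : R.
Hypotheses (t4 : t ^+ 4 = t ^+ 2 + 1) (sE : s = t ^+ 3 - t) (Hh : H * h = 1)
  (CS : C ^+ 2 + S ^+ 2 = 1).

(* Determinant of the two boundary conditions of [eigen_candidate] below; e = 1 is the
   part symmetric under [flip4], e = -1 the antisymmetric one. *)
Definition secular (e : R) :=
  (h + e * t * (1 - t) * H) * (C + (s + e * s * (1 + s ^+ 2)) * S) -
  ((1 + e * s ^+ 2) * C - e * s * S) * ((1 - t) * H + e * t * (1 - t) * (1 + t) * h).

Let t4' : t ^+ 4 - t ^+ 2 - 1 = 0. Proof. by rewrite t4; ring. Qed.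

(** A reduced form of degree at most 3 in t. The long factor given to [mulr0] is the quotient of the
    difference of both sides by t^4 - t^2 - 1; the next statement is proved in the same way. *)
Let secular1 : secular 1 =
    t ^+ 3 * H * C + t ^+ 3 * h * S - 2 * t ^+ 2 * H * C + t ^+ 2 * H * S - t ^+ 2 * h * S +
    t * H * C - 2 * t * H * S + t * h * C + h * C + h * S.
Proof.
apply/eqP; rewrite -subr_eq0; apply/eqP; rewrite -[RHS](mulr0
   (-t ^+ 7 * H * S + t ^+ 6 * H * S + 2 * t ^+ 5 * H * S + t ^+ 5 * h * C + t ^+ 5 * h * S
    - 2 * t ^+ 4 * H * S + t ^+ 3 * H * C - 2 * t ^+ 3 * H * S - 2 * t ^+ 3 * h * C - 2 * t
    ^+ 3 * h * S - t ^+ 2 * H * C + 2 * t ^+ 2 * H * S - t ^+ 2 * h * S - t * H * C - t * H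
    * S + 2 * t * h * C + 2 * t * h * S + H * C + h * S)) -t4' /secular sE; ring.
Qed.

Let secularN1 : secular (- 1) =
    -t ^+ 3 * H * C - 2 * t ^+ 3 * H * S - 2 * t ^+ 3 * h * C + t ^+ 3 * h * S + 2 * t ^+ 2
    * H * C + t ^+ 2 * H * S - t ^+ 2 * h * S + t * H * C + 2 * t * H * S + 3 * t * h * C -
    2 * t * h * S - 2 * H * C + h * C + h * S.
Proof.
apply/eqP; rewrite -subr_eq0; apply/eqP; rewrite -[RHS](mulr0
   (-t ^+ 7 * H * S + t ^+ 6 * H * S + 2 * t ^+ 5 * H * S + t ^+ 5 * h * C - t ^+ 5 * h * S
    - 2 * t ^+ 4 * H * S - t ^+ 3 * H * C - 2 * t ^+ 3 * H * S - 2 * t ^+ 3 * h * C + 2 * t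
    ^+ 3 * h * S + t ^+ 2 * H * C + 2 * t ^+ 2 * H * S - t ^+ 2 * h * S + t * H * C + t * H
    * S + 2 * t * h * C - 2 * t * h * S - H * C + h * S)) -t4' /secular sE; ring.
Qed.

(* The cofactors of the two relations are those of the polynomial division of the
   difference by [t ^+ 4 - t ^+ 2 - 1], [C ^+ 2 + S ^+ 2 - 1] and [H * h - 1]. *)
Lemma secular_factor (q := 2 * t ^+ 2 - 1) (c := C ^+ 2 - S ^+ 2) (d := 2 * S * C) :
  H ^+ 2 * ((3 - q * t) * c - (q * s - 1) * d) +
  h ^+ 2 * ((3 + q * t) * c - (1 + q * s) * d) + 4 =
  (t ^+ 2 + t ^+ 3) * secular 1 * secular (- 1).
Proof.
apply/eqP; rewrite -subr_eq0; apply/eqP; rewrite secular1 secularN1 /c /d /q sE.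
transitivity ((t ^+ 5 * H ^+ 2 * C ^+ 2 + 2 * t ^+ 5 * H ^+ 2 * C * S + 2 * t ^+ 5 * H * h * C ^+ 2 + 2
    * t ^+ 5 * H * h * S ^+ 2 + 2 * t ^+ 5 * h ^+ 2 * C * S - t ^+ 5 * h ^+ 2 * S ^+ 2 - 3 *
    t ^+ 4 * H ^+ 2 * C ^+ 2 - 2 * t ^+ 4 * H ^+ 2 * C * S + 2 * t ^+ 4 * H ^+ 2 * S ^+ 2 -
    2 * t ^+ 4 * H * h * C ^+ 2 + 2 * t ^+ 4 * H * h * C * S - 2 * t ^+ 4 * H * h * S ^+ 2 +
    t ^+ 4 * h ^+ 2 * S ^+ 2 + t ^+ 3 * H ^+ 2 * C ^+ 2 - 4 * t ^+ 3 * H ^+ 2 * C * S - 3 *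
    t ^+ 3 * H ^+ 2 * S ^+ 2 - 2 * t ^+ 3 * H * h * C ^+ 2 + 2 * t ^+ 3 * h ^+ 2 * C ^+ 2 -
    4 * t ^+ 3 * h ^+ 2 * C * S + 2 * t ^+ 3 * h ^+ 2 * S ^+ 2 + 3 * t ^+ 2 * H ^+ 2 * C ^+
    2 + 2 * t ^+ 2 * H ^+ 2 * C * S - 3 * t ^+ 2 * H ^+ 2 * S ^+ 2 + 2 * t ^+ 2 * H * h * C
    ^+ 2 - 2 * t ^+ 2 * H * h * C * S + 4 * t ^+ 2 * H * h * S ^+ 2 + 4 * t ^+ 2 * h ^+ 2 *
    C ^+ 2 - 2 * t ^+ 2 * h ^+ 2 * S ^+ 2 - t * H ^+ 2 * C ^+ 2 + 2 * t * H ^+ 2 * C * S + t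
    * H ^+ 2 * S ^+ 2 + t * h ^+ 2 * C ^+ 2 + 2 * t * h ^+ 2 * C * S - t * h ^+ 2 * S ^+ 2 -
    3 * H ^+ 2 * C ^+ 2 - 2 * H ^+ 2 * C * S + 3 * H ^+ 2 * S ^+ 2 - 4 * H * h * C ^+ 2 - 4
    * H * h * S ^+ 2 - 3 * h ^+ 2 * C ^+ 2 + 2 * h ^+ 2 * C * S + 3 * h ^+ 2 * S ^+ 2) * (t ^+ 4 - t ^+ 2 - 1)
   - 4 * H * h * (C ^+ 2 + S ^+ 2 - 1) - 4 * (H * h - 1)); first by ring.
by rewrite t4' Hh CS; ring.
Qed.

(** The left side is the determinant of the two linear relations between f_aa(0) and f_ba(0) that
    are derived for a symmetric eigenfunction f. *)
Lemma symmetric_minor :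
  (t * (t - 1) * h - H) * (s ^+ 2 * S + s ^+ 3 * C - (s ^+ 2 - 1) * S) -
  (t * h + t ^+ 2 * (t - 1) * H) * (- s ^+ 3 * C - s ^+ 2 * S - s * C) =
  s * secular 1.
Proof.
apply/eqP; rewrite -subr_eq0; apply/eqP; rewrite secular1 -[RHS](mulr0
   (t ^+ 8 * H * C - t ^+ 7 * H * C + t ^+ 7 * h * C - 2 * t ^+ 6 * H * C + t ^+ 5 * H * C +
    t ^+ 5 * H * S - 2 * t ^+ 5 * h * C + 2 * t ^+ 4 * H * C - t ^+ 4 * H * S - t ^+ 3 * H *
    S + 2 * t ^+ 3 * h * C + t ^+ 3 * h * S - t ^+ 2 * H * C + t ^+ 2 * H * S - t ^+ 2 * h *
    S - t * h * C + H * S)) -t4' sE; ring.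
Qed.

End SecularFactorization.

(** * From a symmetric eigenfunction to a root of the equation *)

Section BoundaryValueProblem.
Local Open Scope complex_scope.
Variable R : realType.
Implicit Types (f : vec4 R) (x y m l e : R).
Local Notation K := (@transfer R).
Local Notation t := (@tau R).
Local Notation s := (@sigma R).

(** Centred at 1/2, so that x -> 1 - x becomes a change of sign. *)
Definition scaled m x := m * (x - 1 / 2).

Lemma is_derive_scaled m y : is_derive y 1 (scaled m) m.
Proof. by rewrite /scaled; apply: is_derive_eq; rewrite /GRing.scale/=; ring. Qed.

Lemma is_derive_expR_scaled m y :
  is_derive y 1 (fun x => expR (scaled m x)) (m * expR (scaled m y)).
Proof.
have := @is_derive1_comp _ (@expR R) (scaled m) y _ _ (is_derive_expR _) (is_derive_scaled m y).
by rewrite mulrC.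
Qed.

Lemma is_derive_cos_scaled m y :
  is_derive y 1 (fun x => cos (scaled m x)) (- (m * sin (scaled m y))).
Proof.
have := @is_derive1_comp _ (@cos R) (scaled m) y _ _ (is_derive_cos _) (is_derive_scaled m y).
by rewrite mulNr mulrC.
Qed.

Lemma is_derive_sin_scaled m y :
  is_derive y 1 (fun x => sin (scaled m x)) (m * cos (scaled m y)).
Proof.
have := @is_derive1_comp _ (@sin R) (scaled m) y _ _ (is_derive_sin _) (is_derive_scaled m y).
by rewrite mulrC.
Qed.

Lemma cont01_derivable (f : R -> R) (df : R -> R) :
  (forall y, is_derive y 1 f (df y)) -> cont01 f.
Proof.
move=> d; apply: continuous_cont01 => y; apply/differentiable_continuous.
by apply/derivable1_diffP; have [] := d y.
Qed.

Lemma derive0_const (G : R -> R) : cont01 G -> (forall y, 0 < y < 1 -> is_derive y 1 G 0) -> G 1 = G 0.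
Proof.
move=> cG dG; apply/eqP; rewrite -subr_eq0; apply/eqP.
rewrite -(@lint_unique _ (fun=> 0) G 1)//; last by rewrite ler01 lexx.
  by rewrite lint_cst ?ler01 ?lexx// mul0r.
exact: cont01_cst.
Qed.

Lemma sigma_quartic : s ^+ 4 = 1 - s ^+ 2.
Proof.
rewrite (_ : s ^+ 4 = (s ^+ 2) ^+ 2); last by ring.
rewrite sigma_sqr (_ : (t ^+ 2 - 1) ^+ 2 = t ^+ 4 - 2 * t ^+ 2 + 1); last by ring.
by rewrite tau_quartic; ring.
Qed.

Lemma real_equation_secular l : 0 < l -> real_equation l <->
  (t ^+ 2 + t ^+ 3) *
  secular t s (expR (t / (2 * l))) (expR (- (t / (2 * l)))) (cos (s / (2 * l))) (sin (s / (2 * l))) 1 *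
  secular t s (expR (t / (2 * l))) (expR (- (t / (2 * l)))) (cos (s / (2 * l))) (sin (s / (2 * l))) (- 1) = 0.
Proof.
move=> l0; have e2 m : m / l = m / (2 * l) + m / (2 * l) by field; rewrite gt_eqF.
rewrite -(secular_factor (tau_quartic R) (sigmaE R)); last 2 first.
- by rewrite -expRD subrr expR0.
- exact: cos2Dsin2.
rewrite /real_equation sqrt5E !mulNr (e2 t) (e2 s) cosD sinD opprD !expRD -!expr2.
by rewrite [sin _ * cos _ + _](_ : _ = 2 * sin (s / (2 * l)) * cos (s / (2 * l)))//; ring.
Qed.

Section Symmetric.
Variables (l : R) (f : vec4 R).
Hypotheses (l0 : 0 < l) (cf : cont4 f)
  (eig : forall v w x, 0 <= x <= 1 -> K f v w x = l * f v w x)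
  (sym : forall v w x, 0 <= x <= 1 -> f (~~ v) (~~ w) (1 - x) = f v w x).

(** By the eigenvalue equation these four functions agree with f on [0, 1]; written through
    primitives, they can be differentiated. *)
Let faa x := l^-1 * (lint (f false false) x + (lint (f true false) 1 - lint (f true false) x)).
Let fab x := l^-1 * lint (f false false) x.
Let fba x := l^-1 * (lint (f true true) 1 - lint (f true true) x).
Let fbb x := l^-1 * (lint (f false true) x + (lint (f true true) 1 - lint (f true true) x)).

Let scaleV x y : l * x = y -> l^-1 * y = x.
Proof. by move=> <-; rewrite mulKf// gt_eqF. Qed.

Let faaE x : 0 <= x <= 1 -> faa x = f false false x.
Proof. by move=> x01; apply: scaleV; rewrite -eig// transfer_aa lint_rint. Qed.
Let fabE x : 0 <= x <= 1 -> fab x = f false true x.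
Proof. by move=> x01; apply: scaleV; rewrite -eig// transfer_ab. Qed.
Let fbaE x : 0 <= x <= 1 -> fba x = f true false x.
Proof. by move=> x01; apply: scaleV; rewrite -eig// transfer_ba lint_rint. Qed.
Let fbbE x : 0 <= x <= 1 -> fbb x = f true true x.
Proof. by move=> x01; apply: scaleV; rewrite -eig// transfer_bb lint_rint. Qed.

Let cfaa : cont01 faa. Proof. by rewrite /faa; cont01. Qed.
Let cfab : cont01 fab. Proof. by rewrite /fab; cont01. Qed.
Let cfba : cont01 fba. Proof. by rewrite /fba; cont01. Qed.
Let cfbb : cont01 fbb. Proof. by rewrite /fbb; cont01. Qed.

Let oo y : 0 < y < 1 -> 0 <= y <= 1.
Proof. by move=> /andP[/ltW -> /ltW ->]. Qed.

Let dlint v w y : 0 < y < 1 -> is_derive y 1 (lint (f v w)) (f v w y).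
Proof. by move=> y01; apply: is_derive_lint. Qed.

Let dfaa y : 0 < y < 1 -> is_derive y 1 faa (l^-1 * (faa y - fba y)).
Proof.
move=> y01; have d1 := dlint false false y01; have d2 := dlint true false y01.
by rewrite faaE ?fbaE ?oo// /faa; apply: is_derive_eq; rewrite /GRing.scale/=; ring.
Qed.
Let dfab y : 0 < y < 1 -> is_derive y 1 fab (l^-1 * faa y).
Proof.
move=> y01; have d1 := dlint false false y01.
by rewrite faaE ?oo// /fab; apply: is_derive_eq; rewrite /GRing.scale/=; ring.
Qed.
Let dfba y : 0 < y < 1 -> is_derive y 1 fba (- (l^-1 * fbb y)).
Proof.
move=> y01; have d1 := dlint true true y01.
by rewrite fbbE ?oo// /fba; apply: is_derive_eq; rewrite /GRing.scale/=; ring.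
Qed.
Let dfbb y : 0 < y < 1 -> is_derive y 1 fbb (l^-1 * (fab y - fbb y)).
Proof.
move=> y01; have d1 := dlint true true y01; have d2 := dlint false true y01.
by rewrite fabE ?fbbE ?oo// /fbb; apply: is_derive_eq; rewrite /GRing.scale/=; ring.
Qed.

Let p := faa 0.
Let q := fba 0.
Let i0 : 0 <= (0 : R) <= 1. Proof. by rewrite lexx ler01. Qed.
Let i1 : 0 <= (1 : R) <= 1. Proof. by rewrite lexx ler01. Qed.

Let fab0 : fab 0 = 0. Proof. by rewrite /fab lint0 mulr0. Qed.
Let fbb0 : fbb 0 = q. Proof. by rewrite /fbb /q /fba lint0 add0r. Qed.
Let fba1 : fba 1 = 0. Proof. by rewrite /fba subrr mulr0. Qed.
Let faa1 : faa 1 = q.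
Proof. by rewrite -fbb0 faaE// fbbE// -(sym true true i0) subr0. Qed.
Let fab1 : fab 1 = q. Proof. by rewrite -faa1 /fab /faa subrr addr0. Qed.
Let fbb1 : fbb 1 = p.
Proof. by rewrite /p fbbE// faaE// -(sym false false i0) subr0. Qed.

Let E := expR (t / (2 * l)).
Let E' := expR (- (t / (2 * l))).
Let C := cos (s / (2 * l)).
Let S := sin (s / (2 * l)).

Let scaled1 m : scaled (m / l) 1 = m / (2 * l).
Proof. by rewrite /scaled; field; rewrite gt_eqF. Qed.
Let scaled0 m : scaled (m / l) 0 = - (m / (2 * l)).
Proof. by rewrite /scaled; field; rewrite gt_eqF. Qed.

(* For a root z of z ^+ 4 = z ^+ 2 + 1, [(z, z (z - 1), - 1, z ^+ 2 (z - 1))] is a left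
   eigenvector of the differential system, so its product with f, times exp (- z x / l),
   is constant; z = tau gives the first relation, z = i sigma the second. *)
Let relation_tau : (t ^+ 2 * q + t ^+ 2 * (t - 1) * p) * E' =
  (t * p - q + t ^+ 2 * (t - 1) * q) * E.
Proof.
pose G x := (t * faa x + t * (t - 1) * fab x - fba x + t ^+ 2 * (t - 1) * fbb x) *
  expR (scaled (- t / l) x).
have : G 1 = G 0.
  apply: derive0_const.
    apply: cont01M; first by cont01.
    exact: cont01_derivable (is_derive_expR_scaled _).
  move=> y y01; have d1 := dfaa y01; have d2 := dfab y01; have d3 := dfba y01; have d4 := dfbb y01.
  have d5 := is_derive_expR_scaled (- t / l) y.
  apply: is_derive_eq; rewrite /GRing.scale/=.
  move: (expR _) (faa y) (fab y) (fba y) (fbb y) => X a b c d.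
  rewrite -[RHS](mulr0 (- X * l^-1 * d)).
  by rewrite -[X in _ = _ * X](subrr (t ^+ 2 + 1)) -{1}tau_quartic; ring.
rewrite /G faa1 fab1 fba1 fbb1 fab0 fbb0 -/p -/q scaled1 scaled0 !mulNr opprK -/E -/E'.
by rewrite mulr0 addr0 => <-; ring.
Qed.

Let relation_sigma :
  p * (- s ^+ 3 * C - s ^+ 2 * S - s * C) + q * (s ^+ 2 * S + s ^+ 3 * C - (s ^+ 2 - 1) * S) = 0.
Proof.
(* A and B are the real and imaginary parts of the product of f with the left eigenvector for z = i
   sigma, and G is the imaginary part after multiplication by exp (- i sigma (x - 1/2) / l). *)
pose A x := s ^+ 2 * (fbb x - fab x) - fba x.
pose B x := s * faa x - s * fab x - s ^+ 3 * fbb x.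
pose G x := B x * cos (scaled (s / l) x) - A x * sin (scaled (s / l) x).
have : G 1 = G 0.
  apply: derive0_const.
    apply: cont01B; apply: cont01M; try by rewrite /A /B; cont01.
      exact: cont01_derivable (is_derive_cos_scaled _).
    exact: cont01_derivable (is_derive_sin_scaled _).
  move=> y y01; have d1 := dfaa y01; have d2 := dfab y01; have d3 := dfba y01; have d4 := dfbb y01.
  have d5 := is_derive_cos_scaled (s / l) y; have d6 := is_derive_sin_scaled (s / l) y.
  rewrite /G /A /B; apply: is_derive_eq; rewrite /GRing.scale/=.
  move: (cos _) (sin _) (faa y) (fab y) (fba y) (fbb y) => X Y a b c d.
  rewrite -[RHS](mulr0 (Y * l^-1 * d)).
  by rewrite -[X in _ = _ * X](subrr (1 - s ^+ 2)) -{1}sigma_quartic; ring.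
rewrite /G /A /B faa1 fab1 fba1 fbb1 fab0 fbb0 -/p -/q scaled1 scaled0 cosN sinN -/C -/S.
by move=> h; rewrite [LHS](_ : _ = (s * q - s * q - s ^+ 3 * p) * C - (s ^+ 2 * (p - q) - 0) * S
  - ((s * p - s * 0 - s ^+ 3 * q) * C - (s ^+ 2 * (q - 0) - q) * - S)); [rewrite h subrr|ring].
Qed.

(** Symmetry leaves only the boundary values p and q, which satisfy two homogeneous linear
    relations. As p is nonzero the determinant vanishes, and it is sigma times the even secular
    factor. *)
Lemma symmetric_eigen_equation : f false false 0 != 0 -> real_equation l.
Proof.
move=> f0; have p0 : p != 0 by rewrite /p faaE.
have t0 : t != 0 by rewrite gt_eqF// (lt_trans ltr01)// tau_gt1.
have EE : E * E' = 1 by rewrite /E /E' -expRD subrr expR0.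
have CS : C ^+ 2 + S ^+ 2 = 1 by rewrite cos2Dsin2.
have r1 : p * (t * (t - 1) * E' - E) + q * (t * E' + t ^+ 2 * (t - 1) * E) = 0.
  apply: (mulfI t0); rewrite mulr0.
  transitivity ((t ^+ 2 * q + t ^+ 2 * (t - 1) * p) * E' - (t * p - t ^+ 3 * (t - 1) * q) * E).
    by ring.
  rewrite relation_tau; transitivity (q * E * (t ^+ 4 - (t ^+ 2 + 1))); first by ring.
  by rewrite tau_quartic subrr mulr0.
have minor : (t * (t - 1) * E' - E) * (s ^+ 2 * S + s ^+ 3 * C - (s ^+ 2 - 1) * S) -
  (t * E' + t ^+ 2 * (t - 1) * E) * (- s ^+ 3 * C - s ^+ 2 * S - s * C) = 0.
  apply: (mulfI p0); rewrite mulr0; have r2 := relation_sigma.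
  rewrite [LHS](_ : _ = (p * (t * (t - 1) * E' - E) + q * (t * E' + t ^+ 2 * (t - 1) * E)) *
      (s ^+ 2 * S + s ^+ 3 * C - (s ^+ 2 - 1) * S) - (t * E' + t ^+ 2 * (t - 1) * E) *
    (p * (- s ^+ 3 * C - s ^+ 2 * S - s * C) + q * (s ^+ 2 * S + s ^+ 3 * C - (s ^+ 2 - 1) * S))).
    by rewrite r1 r2 mul0r mulr0 subr0.
  by ring.
rewrite (symmetric_minor E E' C S (tau_quartic R) (sigmaE R)) in minor.
have sec0 : secular t s E E' C S 1 = 0.
  by move/eqP: minor; rewrite mulf_eq0 gt_eqF ?sigma_gt0//= => /eqP.
rewrite real_equation_secular// -/E -/E' -/C -/S sec0; ring.
Qed.

End Symmetric.
End BoundaryValueProblem.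

(** * From a root of the equation to an eigenfunction *)

Section EigenCandidate.
Local Open Scope complex_scope.
Variable R : realType.
Implicit Types (f : vec4 R) (x y m l e : R).
Local Notation K := (@transfer R).
Local Notation t := (@tau R).
Local Notation s := (@sigma R).

Lemma kernel2 (a b c d : R) : a * d - b * c = 0 ->
  exists P Q : R, [/\ (P != 0) || (Q != 0), P * a + Q * b = 0 & P * c + Q * d = 0].
Proof.
move=> det; have [/andP[/eqP a0 /eqP b0]|ab] := boolP ((a == 0) && (b == 0)).
  have [/andP[/eqP c0 /eqP d0]|cd] := boolP ((c == 0) && (d == 0)).
    by exists 1, 0; rewrite a0 b0 c0 d0 !mulr0 addr0; split => //; rewrite oner_eq0.
  exists d, (- c); rewrite a0 b0 !mulr0 addr0; split => //; last by ring.
  by rewrite oppr_eq0 orbC -negb_and.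
exists b, (- a); split; first by rewrite oppr_eq0 orbC -negb_and.
  by ring.
by rewrite -[RHS]oppr0 -det; ring.
Qed.

Lemma is_derive_scale (c : R) (f : R -> R) (df x : R) :
  is_derive x 1 f df -> is_derive x 1 (fun x => c * f x) (c * df).
Proof. by move=> d; apply: is_derive_eq; rewrite /GRing.scale/=; ring. Qed.

Lemma is_derive_sub (f g : R -> R) (df dg x : R) :
  is_derive x 1 f df -> is_derive x 1 g dg -> is_derive x 1 (fun x => f x - g x) (df - dg).
Proof. by move=> d1 d2; apply: is_derive_eq. Qed.

Section Candidate.
Variables (l e P Q : R).
Hypotheses (l0 : 0 < l) (e2 : e ^+ 2 = 1).

Local Notation Ep x := (expR (scaled (t / l) x)).
Local Notation Em x := (expR (scaled (- t / l) x)).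
Local Notation Cs x := (cos (scaled (s / l) x)).
Local Notation Sn x := (sin (scaled (s / l) x)).

(** If f = e flip f, the system for f reduces to l^2 y'' = l y' - e y(1 - x) with y = f_ab and l y'
    = f_aa. The reflection exchanges the exponentials and changes the sign of the sine, and the
    inner coefficients make each bracket a solution. [dy] and [ddy] stand for l y' and l^2 y''. *)
Let y x := P * (Ep x + e * t * (1 - t) * Em x) + Q * ((1 + e * s ^+ 2) * Cs x + e * s * Sn x).
Let dy x := P * (t * Ep x - e * t ^+ 2 * (1 - t) * Em x) +
  Q * (e * s ^+ 2 * Cs x - s * (1 + e * s ^+ 2) * Sn x).
Let ddy x := P * t ^+ 2 * (Ep x + e * t * (1 - t) * Em x) -
  Q * s ^+ 2 * ((1 + e * s ^+ 2) * Cs x + e * s * Sn x).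

Let scaled_onem m x : scaled (m / l) (1 - x) = - scaled (m / l) x.
Proof. by rewrite /scaled; field; rewrite gt_eqF. Qed.

Let scaledN m x : scaled (- m / l) x = - scaled (m / l) x.
Proof. by rewrite /scaled; field; rewrite gt_eqF. Qed.

Let y_is_derive x : is_derive x 1 y (l^-1 * dy x).
Proof.
have d1 := is_derive_expR_scaled (t / l) x; have d2 := is_derive_expR_scaled (- t / l) x.
have d3 := is_derive_cos_scaled (s / l) x; have d4 := is_derive_sin_scaled (s / l) x.
by rewrite /y; apply: is_derive_eq; rewrite /dy /GRing.scale/=; ring.
Qed.

Let dy_is_derive x : is_derive x 1 dy (l^-1 * ddy x).
Proof.
have d1 := is_derive_expR_scaled (t / l) x; have d2 := is_derive_expR_scaled (- t / l) x.
have d3 := is_derive_cos_scaled (s / l) x; have d4 := is_derive_sin_scaled (s / l) x.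
by rewrite /dy; apply: is_derive_eq; rewrite /ddy /GRing.scale/=; ring.
Qed.

Let ddyE x : ddy x = dy x - e * y (1 - x).
Proof.
rewrite /ddy /dy /y !scaled_onem cosN sinN !scaledN opprK.
move: (expR _) (expR _) (cos _) (sin _) => Y X A B.
apply/eqP; rewrite -subr_eq0; apply/eqP.
transitivity (P * e * Y * (t ^+ 2 + 1 - t ^+ 4) + (e ^+ 2 - 1) * (P * t * (1 - t) * X + Q * (s ^+ 2 * A - s * B)) +
  Q * e * A * (1 - s ^+ 2 - s ^+ 4)); first by ring.
by rewrite e2 tau_quartic sigma_quartic; ring.
Qed.

Hypotheses (y0 : y 0 = 0) (y1 : y 1 = dy 1).

(** The components starting with b are forced by f = e flip f. The condition y 0 = 0 expresses that
    (K f)_ab vanishes at 0, and y 1 = dy 1 that (K f)_aa and (K f)_ab agree at 1. *)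
Definition eigen_candidate : vec4 R := fun v w x =>
  if v then e * (if w then dy (1 - x) else y (1 - x)) else if w then y x else dy x.

Let cy : cont01 y. Proof. exact: cont01_derivable y_is_derive. Qed.
Let cdy : cont01 dy. Proof. exact: cont01_derivable dy_is_derive. Qed.

Lemma cont4_eigen_candidate : cont4 eigen_candidate.
Proof.
by case; case => //; rewrite /eigen_candidate/=; apply: cont01Z; apply: cont01_onem.
Qed.

Let lint_dy x : 0 <= x <= 1 -> lint dy x = l * y x.
Proof.
move=> x01; rewrite -[RHS]subr0 -[X in _ - X](mulr0 l) -y0.
apply: (@lint_unique _ _ (fun x => l * y x)) => //; first exact: cont01Z.
move=> z _; rewrite (_ : dy z = l * (l^-1 * dy z)); last by rewrite mulrA mulfV ?mul1r// gt_eqF.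
exact: is_derive_scale (y_is_derive z).
Qed.

Let rint_y x : 0 <= x <= 1 -> rint (fun x => e * y (1 - x)) x = l * dy x - l * y x.
Proof.
move=> x01; have cy' : cont01 (fun x => e * y (1 - x)) by apply: cont01Z; exact: cont01_onem.
have E z : 0 <= z <= 1 ->
    lint (fun x => e * y (1 - x)) z = (l * y z - l * dy z) - (l * y 0 - l * dy 0).
  apply: (@lint_unique _ _ (fun x => l * y x - l * dy x)) => //.
    by apply: cont01B; exact: cont01Z.
  move=> u _; rewrite (_ : e * _ = l * (l^-1 * dy u) - l * (l^-1 * ddy u)).
    by apply: is_derive_sub; apply: is_derive_scale; [exact: y_is_derive|exact: dy_is_derive].
  by rewrite !(mulrA l) mulfV ?gt_eqF// !mul1r ddyE; move: (dy u) (y _) => a b; ring.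
by rewrite lint_rint// !E ?ler01 ?lexx// y1; ring.
Qed.

Lemma eigen_candidate_eig v w x : 0 <= x <= 1 ->
  K eigen_candidate v w x = l * eigen_candidate v w x.
Proof.
have cf := cont4_eigen_candidate.
have aa z : 0 <= z <= 1 -> K eigen_candidate false false z = l * eigen_candidate false false z.
  by move=> z01; rewrite transfer_aa [lint _ _]lint_dy// [rint _ _]rint_y// /eigen_candidate; ring.
have ab z : 0 <= z <= 1 -> K eigen_candidate false true z = l * eigen_candidate false true z.
  by move=> z01; rewrite transfer_ab [lint _ _]lint_dy.
have flipE v' w' z : eigen_candidate v' w' z = e * flip4 eigen_candidate v' w' z.
  rewrite /eigen_candidate /flip4 subKr; case: v'; case: w' => //=.
    by rewrite mulrA -expr2 e2 mul1r.
  by rewrite mulrA -expr2 e2 mul1r.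
move=> x01; case: v; last by case: w; [exact: ab|exact: aa].
have x01' : 0 <= 1 - x <= 1 by case/andP: x01 => *; apply/andP; split; lra.
rewrite (@transfer_congr _ _ (fun v w x => e * flip4 eigen_candidate v w x))//.
rewrite transfer_scale//; last exact: cont4_flip.
rewrite transfer_flip// [in RHS]flipE /flip4 mulrCA; congr (_ * _).
by case: w; [exact: aa|exact: ab].
Qed.

(** At the fixed point 1/2 of the reflection, y and l^2 y'' are combinations of P (1 + e t (1 - t))
    and Q (1 + e s^2) alone; the factors of P and Q are positive because t > 1 and t^2 < 2. *)
Lemma eigen_candidate_neq0 : e = 1 \/ e = - 1 -> (P != 0) || (Q != 0) ->
  exists v w, eigen_candidate v w (1 / 2) != 0.
Proof.
move=> epm PQ; apply: contrapT => /forallNP all0.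
have z v w : eigen_candidate v w (1 / 2) = 0.
  by apply: contrapT => /eqP h; apply: (all0 v); exists w.
have half : 1 - 1 / 2 = 1 / 2 :> R by field.
have hy : y (1 / 2) = 0 by have := z false true.
have hdd : ddy (1 / 2) = 0.
  by rewrite ddyE half hy mulr0 subr0; have := z false false.
move: hy hdd; rewrite /y /ddy /scaled subrr !mulr0 expR0 cos0 sin0 !mulr1 !mulr0 !addr0 => hy hdd.
have t1 := tau_gt1 R; have t2 := tau_sqr_lt2 R; have s2 := sigma_sqr R.
have s0 : 0 < s ^+ 2 by rewrite exprn_gt0// sigma_gt0.
have a0 : 0 < 1 + e * t * (1 - t).
  case: epm => ->; rewrite ?mul1r ?mulN1r.
    have -> : 1 + t * (1 - t) = 1 + t - t ^+ 2 by ring.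
    by move: (t ^+ 2) t1 t2 => u *; lra.
  have -> : 1 + - t * (1 - t) = 1 + t * (t - 1) by ring.
  by rewrite ltr_wpDr// mulr_ge0// ?subr_ge0 ltW// (lt_trans ltr01).
have b0 : 0 < 1 + e * s ^+ 2.
  case: epm => ->; rewrite ?mul1r ?mulN1r; first by rewrite ltr_wpDr// ltW.
  by rewrite s2; move: (t ^+ 2) t2 => u *; lra.
have hP : P * (1 + e * t * (1 - t)) = 0.
  apply: (mulfI (_ : t ^+ 2 + s ^+ 2 != 0)).
    by rewrite gt_eqF// addr_gt0// exprn_gt0// (lt_trans ltr01).
  rewrite mulr0 -[RHS]hdd -[RHS]addr0 -[X in _ = _ + X](mulr0 (s ^+ 2)) -[X in _ = _ + _ * X]hy.
  by ring.
have P0 : P = 0 by move/eqP: hP; rewrite mulf_eq0 (gt_eqF a0) orbF => /eqP.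
have Q0 : Q = 0.
  by move/eqP: hy; rewrite P0 mul0r add0r mulf_eq0 (gt_eqF b0) orbF => /eqP.
by move: PQ; rewrite P0 Q0 eqxx.
Qed.

End Candidate.

Lemma real_equation_eigen l : 0 < l -> real_equation l ->
  exists (f : vec4 R) v w, [/\ cont4 f,
    forall v w x, 0 <= x <= 1 -> K f v w x = l * f v w x & f v w (1 / 2) != 0].
Proof.
move=> l0 /(real_equation_secular l0).
set H := expR _; set h := expR _; set C := cos _; set S := sin _ => eq0.
have sec0 : exists e : R, (e = 1 \/ e = - 1) /\ secular t s H h C S e = 0.
  move/eqP: eq0; rewrite !mulf_eq0 gt_eqF /=; last first.
    by have t1 := tau_gt1 R; rewrite addr_gt0// exprn_gt0// (lt_trans ltr01).
  by case/orP => /eqP ?; [exists 1; split; [left|]|exists (-1); split; [right|]].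
have [e [epm sec]] := sec0.
have e2 : e ^+ 2 = 1 by case: epm => ->; ring.
have [P [Q [PQ r1 r2]]] := kernel2 sec.
have m1 m : scaled (m / l) 1 = m / (2 * l) by rewrite /scaled; field; rewrite gt_eqF.
have m0 m : scaled (m / l) 0 = - (m / (2 * l)) by rewrite /scaled; field; rewrite gt_eqF.
have [v [w nz]] := @eigen_candidate_neq0 l e P Q l0 e2 epm PQ.
exists (eigen_candidate l e P Q), v, w; split => //; first exact: cont4_eigen_candidate.
apply: eigen_candidate_eig => //.
  by rewrite !m0 !mulNr opprK cosN sinN -/H -/h -/C -/S -[RHS]r1; ring.
apply/eqP; rewrite -subr_eq0; apply/eqP.
by rewrite !m1 !mulNr -/H -/h -/C -/S -[RHS]r2; ring.
Qed.

End EigenCandidate.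

(** * Sections of null sets and of integrable functions *)

Section FubiniReal.
Context d1 d2 (T1 : measurableType d1) (T2 : measurableType d2) (R : realType).
Variables (m1 : {sigma_finite_measure set T1 -> \bar R})
  (m2 : {sigma_finite_measure set T2 -> \bar R}).

(** The measures of the sections of a null set have integral zero, so almost all of them are
    zero. *)
Lemma ae_ysection (P : T1 * T2 -> Prop) : {ae (m1 \x m2)%E, forall z, P z} ->
  {ae m2, forall y, {ae m1, forall x, P (x, y)}}.
Proof.
case=> N [mN N0 PN].
have mf := measurable_fun_ysection m1 mN.
have i0 : (\int[m2]_y `|m1 (ysection N y)| = 0)%E.
  under eq_integral do rewrite gee0_abs//.
  rewrite -N0 -[in RHS](setIT N) -integral_indic// fubini_tonelli2//=; last first.
  - by apply/measurable_EFinP; exact: measurable_indic.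
  - by apply: eq_integral => y _; rewrite -[LHS]/((m1 \o ysection N) y) -(indic_fubini_tonelli_GE m1 mN).
have := (ae_eq_integral_abs m2 measurableT mf).1 i0.
apply: filterS => y /= /(_ I) h; exists (ysection N y); split => //.
  exact: measurable_ysection.
by move=> x /= nP; rewrite /ysection/= inE; exact: PN.
Qed.

Lemma ae_xsection (P : T1 * T2 -> Prop) : {ae (m1 \x m2)%E, forall z, P z} ->
  {ae m1, forall x, {ae m2, forall y, P (x, y)}}.
Proof.
case=> N [mN N0 PN].
have mf := measurable_fun_xsection m2 mN.
have i0 : (\int[m1]_x `|m2 (xsection N x)| = 0)%E.
  under eq_integral do rewrite gee0_abs//.
  rewrite -N0 -[in RHS](setIT N) -integral_indic// fubini_tonelli1//=; last first.
  - by apply/measurable_EFinP; exact: measurable_indic.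
  - by apply: eq_integral => y _; rewrite -[LHS]/((m2 \o xsection N) y) -(indic_fubini_tonelli_FE m2 mN).
have := (ae_eq_integral_abs m1 measurableT mf).1 i0.
apply: filterS => y /= /(_ I) h; exists (xsection N y); split => //.
  exact: measurable_xsection.
by move=> x /= nP; rewrite /xsection/= inE; exact: PN.
Qed.

Variable h : T1 * T2 -> R.
Hypothesis ih : (m1 \x m2)%E.-integrable setT (EFin \o h).

Let measurable_h : measurable_fun setT (EFin \o h). Proof. exact: measurable_int ih. Qed.

Lemma integrable_Rintegral_section :
  m2.-integrable setT (fun y => (\int[m1]_x h (x, y))%:E).
Proof.
apply/integrableP; split.
  apply/measurable_EFinP; apply: measurableT_comp => //.
  exact: (measurable_fubini_G ih).
have := (integrable21ltyP m1 m2 measurable_h).1 ih.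
apply: le_lt_trans; apply: ge0_le_integral => //.
- apply: measurableT_comp => //; apply/measurable_EFinP; apply: measurableT_comp => //.
  exact: (measurable_fubini_G ih).
- apply: (@measurable_fun_fubini_tonelli_G _ _ _ _ _ m1 (abse \o (EFin \o h))) => //=.
  exact: measurableT_comp.
- move=> y _; rewrite /Rintegral.
  apply: le_trans (le_abse_integral m1 measurableT
    (measurableT_comp measurable_h (pair2_measurable y))).
  rewrite /comp/=; case: (integral _ _ _) => //= [|]; rewrite ?normr0 ?leey//.
Qed.

End FubiniReal.

(* The library's only sigma-finite instance on [_ \x _] is the one for
   subprobabilities, so products of sigma-finite measures need a name of their
   own. *)
Section SigmaFiniteProduct.
Local Open Scope ereal_scope.
Context d1 d2 (T1 : measurableType d1) (T2 : measurableType d2) (R : realType).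
Variables (m1 : {sigma_finite_measure set T1 -> \bar R})
  (m2 : {sigma_finite_measure set T2 -> \bar R}).

Definition sfprod := m1 \x m2.

HB.instance Definition _ := Measure.copy sfprod (m1 \x m2).

Let sfprod_sigma_finite : sigma_finite setT sfprod.
Proof.
have /sigma_finiteP[F [TF ndF Foo]] := sigma_finiteT m1.
have /sigma_finiteP[G [TG ndG Goo]] := sigma_finiteT m2.
exists (fun n => F n `*` G n) => [|k].
  rewrite -setXTT TF TG predeqE => -[x y]; split => [[/= [n _ Fx] [k _ Gy]]|].
    exists (maxn n k) => //; split.
      by move: x Fx; exact/subsetPset/ndF/leq_maxl.
    by move: y Gy; exact/subsetPset/ndG/leq_maxr.
  by move=> [n _ []/= ? ?]; split; exists n.
have [? ?] := Foo k; have [? ?] := Goo k; split; first exact: measurableX.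
by rewrite /sfprod product_measure1E// lte_mul_pinfty// ge0_fin_numE.
Qed.

HB.instance Definition _ :=
  Measure_isSigmaFinite.Build _ _ _ sfprod sfprod_sigma_finite.

End SigmaFiniteProduct.

(** * Changing the bracketing of a triple product *)

Section Reassociation.
Local Open Scope ereal_scope.
Context d1 d2 d3 (T1 : measurableType d1) (T2 : measurableType d2)
  (T3 : measurableType d3) (R : realType).
Variables (m1 : {sigma_finite_measure set T1 -> \bar R})
  (m2 : {sigma_finite_measure set T2 -> \bar R})
  (m3 : {sigma_finite_measure set T3 -> \bar R}).

(** T integrates out the first coordinate, whereas the product on the cube splits off the last
    one. *)
Definition lassoc (z : T1 * (T2 * T3)) : T1 * T2 * T3 := (z.1, z.2.1, z.2.2).

Lemma measurable_lassoc : measurable_fun setT lassoc.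
Proof.
apply: measurable_fun_pair; last exact: measurableT_comp measurable_snd measurable_snd.
apply: measurable_fun_pair; first exact: measurable_fst.
exact: measurableT_comp measurable_fst measurable_snd.
Qed.

Lemma tonelli_right (g : T1 * (T2 * T3) -> \bar R) :
  measurable_fun setT g -> (forall z, 0 <= g z) ->
  \int[m1 \x (m2 \x m3)]_z g z = \int[m3]_x3 \int[m2]_x2 \int[m1]_x1 g (x1, (x2, x3)).
Proof.
move=> mg g0; pose m23 : {sigma_finite_measure set (T2 * T3)%type -> \bar R} := sfprod m2 m3.
have -> := @fubini_tonelli2 _ _ _ _ _ m1 m23 g mg g0.
rewrite [LHS](@fubini_tonelli2 _ _ _ _ _ m2 m3 (fubini_G m1 g))//.
- exact: measurable_fun_fubini_tonelli_G.
- by move=> z; exact: integral_ge0.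
Qed.

Lemma tonelli_left (f : T1 * T2 * T3 -> \bar R) :
  measurable_fun setT f -> (forall z, 0 <= f z) ->
  \int[(m1 \x m2) \x m3]_z f z = \int[m3]_x3 \int[m2]_x2 \int[m1]_x1 f (x1, x2, x3).
Proof.
move=> mf f0; pose m12 : {sigma_finite_measure set (T1 * T2)%type -> \bar R} := sfprod m1 m2.
rewrite [LHS](@fubini_tonelli2 _ _ _ _ _ m12 m3 f mf f0); apply: eq_integral => x3 _.
rewrite /fubini_G [LHS](@fubini_tonelli2 _ _ _ _ _ m1 m2 (fun z => f (z, x3)))//.
exact: measurableT_comp mf (pair2_measurable x3).
Qed.

Lemma integral_lassoc (f : T1 * T2 * T3 -> \bar R) :
  measurable_fun setT f -> (forall z, 0 <= f z) ->
  \int[m1 \x (m2 \x m3)]_z (f \o lassoc) z = \int[(m1 \x m2) \x m3]_z f z.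
Proof.
move=> mf f0; rewrite tonelli_left// tonelli_right// => [|z]; last exact: f0.
exact: measurableT_comp mf measurable_lassoc.
Qed.

Lemma integrable_lassoc (f : T1 * T2 * T3 -> \bar R) :
  ((m1 \x m2) \x m3).-integrable setT f ->
  (m1 \x (m2 \x m3)).-integrable setT (f \o lassoc).
Proof.
move=> /integrableP[mf fi]; apply/integrableP; split.
  exact: measurableT_comp mf measurable_lassoc.
have := @integral_lassoc (abse \o f) (measurableT_comp (@abse_measurable R setT) mf) (fun z => abse_ge0 (f z)).
by move=> /= ->.
Qed.

Lemma ae_lassoc (P : T1 * T2 * T3 -> Prop) :
  {ae (m1 \x m2) \x m3, forall z, P z} ->
  {ae m2 \x m3, forall y, {ae m1, forall x, P (x, y.1, y.2)}}.
Proof.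
case=> N [mN N0 PN].
have reassoc : {ae m1 \x (m2 \x m3), forall z, P (lassoc z)} ->
    {ae m2 \x m3, forall y, {ae m1, forall x, P (x, y.1, y.2)}}.
  by move=> h; exact: (@ae_ysection _ _ _ _ _ m1 (sfprod m2 m3) _ h).
apply: reassoc.
have mN' : measurable (lassoc @^-1` N).
  by rewrite -[X in measurable X]setTI; exact: measurable_lassoc.
exists (lassoc @^-1` N); split => //; last by move=> z nP; exact: PN.
have mI : measurable_fun setT (fun z => (\1_N z : R)%:E).
  by apply/measurable_EFinP; exact: measurable_indic.
have h2 := integral_indic (m1 \x sfprod m2 m3) measurableT mN'.
have h1 := integral_indic ((m1 \x m2) \x m3) measurableT mN.
rewrite setIT in h2; rewrite setIT in h1.
rewrite -[LHS]h2; apply: etrans N0; rewrite -[RHS]h1.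
by apply: (integral_lassoc mI) => z; rewrite lee_fin indicE.
Qed.

End Reassociation.

Section Cylinder.
Context d1 d2 (T1 : measurableType d1) (T2 : measurableType d2) (R : realType).
Variables (m1 : {sigma_finite_measure set T1 -> \bar R})
  (m2 : {sigma_finite_measure set T2 -> \bar R}).

Lemma ae_cylinder (P : T1 -> Prop) : {ae m1, forall x, P x} ->
  {ae (m1 \x m2)%E, forall z, P z.1}.
Proof.
case=> N [mN N0 PN]; exists (N `*` setT); split.
- exact: measurableX.
- by rewrite product_measure1E//= N0 mul0e.
- by move=> z nP; split => //=; exact: PN.
Qed.

End Cylinder.

Section Measurable.
Context d2 (T2 : measurableType d2) (R : realType).

End Measurable.

(** * The transfer operator on integrable functions *)

Section RealIntegrable.
Context d (T : measurableType d) (R : realType).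
Variable m : {measure set T -> \bar R}.
Implicit Types f g : T -> R.

Definition rintegrable f := m.-integrable setT (EFin \o f).

Lemma rintegrableZ c f : rintegrable f -> rintegrable (fun x => c * f x).
Proof.
move=> fi; rewrite /rintegrable.
rewrite (_ : EFin \o _ = fun x => (c%:E * (EFin \o f) x)%E).
  exact: integrableZl.
by apply/funext => x; rewrite /comp EFinM.
Qed.

Lemma rintegrableD f g : rintegrable f -> rintegrable g -> rintegrable (fun x => f x + g x).
Proof.
move=> fi gi; rewrite /rintegrable.
rewrite (_ : EFin \o _ = ((EFin \o f) \+ (EFin \o g))%E); first exact: integrableD.
by apply/funext => x; rewrite /comp EFinD.
Qed.

Lemma rintegrable_restrict (D : set T) f : measurable D -> rintegrable f ->
  rintegrable (f \_ D).
Proof.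
move=> mD fi; rewrite /rintegrable -restrict_EFin; apply/(integrable_mkcond _ mD).
exact: integrableS fi.
Qed.

End RealIntegrable.

Section IntegrableTransfer.
Variable R : realType.
Local Notation mu := (@lebesgue_measure R).

Section Parametric.
Context d2 (T2 : measurableType d2) (m2 : {sigma_finite_measure set T2 -> \bar R}).
Variable p : T2 -> R.
Hypothesis mp : measurable_fun setT p.

Let rintegrable_section (S : set (measurableTypeR R * T2)) (h : measurableTypeR R * T2 -> R) :
  measurable S -> rintegrable (mu \x m2)%E h ->
  rintegrable m2 (fun y => \int[mu]_(r in [set r | S (r, y)]) h (r, y)).
Proof.
move=> mS hi.
have := integrable_Rintegral_section (rintegrable_restrict mS hi).
rewrite /rintegrable; apply: eq_integrable => //= y _ /=.
rewrite [in RHS]Rintegral_mkcond; congr EFin; apply: eq_Rintegral => r _.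
Qed.

Let measurable_below : measurable [set z : measurableTypeR R * T2 | 0 <= z.1 <= p z.2].
Proof.
rewrite (_ : [set _ | _] = (fst @^-1` `[0, +oo[) `&` ((fun z => p z.2 - z.1) @^-1` `[0, +oo[)).
  apply: measurableI; rewrite -[X in measurable X]setTI.
    by apply: measurable_fst => //; exact: measurable_itv.
  by apply: (measurable_funB (measurableT_comp mp measurable_snd) measurable_fst) => //;
    exact: measurable_itv.
apply/seteqP; split => z /=; rewrite !in_itv/= !andbT subr_ge0; first by case/andP.
by case=> -> ->.
Qed.

Let measurable_above : measurable [set z : measurableTypeR R * T2 | p z.2 <= z.1 <= 1].
Proof.
rewrite (_ : [set _ | _] = (fst @^-1` `]-oo, 1]) `&` ((fun z => z.1 - p z.2) @^-1` `[0, +oo[)).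
  apply: measurableI; rewrite -[X in measurable X]setTI.
    by apply: measurable_fst => //; exact: measurable_itv.
  by apply: (measurable_funB measurable_fst (measurableT_comp mp measurable_snd)) => //;
    exact: measurable_itv.
apply/seteqP; split => z /=; rewrite !in_itv/= andbT subr_ge0; first by case/andP.
by case=> -> ->.
Qed.

Lemma rintegrable_lint (h : measurableTypeR R * T2 -> R) : rintegrable (mu \x m2)%E h ->
  rintegrable m2 (fun y => lint (fun r => h (r, y)) (p y)).
Proof.
move=> /(rintegrable_section measurable_below).
by rewrite /rintegrable; apply: eq_integrable => //= y _; rewrite ?lintE ?rintE ?set_itvcc.
Qed.

Lemma rintegrable_rint (h : measurableTypeR R * T2 -> R) : rintegrable (mu \x m2)%E h ->
  rintegrable m2 (fun y => rint (fun r => h (r, y)) (p y)).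
Proof.
move=> /(rintegrable_section measurable_above).
by rewrite /rintegrable; apply: eq_integrable => //= y _; rewrite ?lintE ?rintE ?set_itvcc.
Qed.

Lemma rintegrable_transfer (f : bool -> bool -> measurableTypeR R * T2 -> R) v w :
  (forall u v, rintegrable (mu \x m2)%E (f u v)) ->
  rintegrable m2 (fun y => transfer (fun u v r => f u v (r, y)) v w (p y)).
Proof.
move=> fi; apply: rintegrableD; apply: rintegrableZ.
- exact: rintegrable_lint.
- exact: rintegrable_rint.
Qed.

End Parametric.

Implicit Types (f g : vec4 R) (v w : bool) (c d x : R).

Definition rintegrable4 f := forall v w, rintegrable mu (f v w).

Lemma rintegrable4_itv f v w a b : rintegrable4 f ->
  mu.-integrable `[a, b] (EFin \o f v w).
Proof. by move=> fi; apply: integrableS (fi v w). Qed.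

Lemma transfer_lin_integrable c f d g v w x : rintegrable4 f -> rintegrable4 g ->
  transfer (lin4 c f d g) v w x = c * transfer f v w x + d * transfer g v w x.
Proof.
move=> fi gi; rewrite /transfer /lin4 !lintE !rintE.
have Zi (F : vec4 R) e v' w' a b : rintegrable4 F ->
    mu.-integrable `[a, b] (EFin \o (fun t => e * F v' w' t)).
  by move=> Fi; apply: integrableS (rintegrableZ e (Fi v' w')).
rewrite !RintegralD//; try exact: Zi.
rewrite !RintegralZl//; try exact: rintegrable4_itv.
by ring.
Qed.

Lemma ae_neq x : {ae mu, forall t : R, t != x}.
Proof.
exists [set x]; split => //; first exact: lebesgue_measure_set1.
by move=> t /= /negP; rewrite negbK => /eqP.
Qed.

(** The integral over [0, x] sees only the letter a and that over [x, 1] only b, so f and g need to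
    agree only at the letter x < t; a function on the cube determines no more than that. *)
Lemma transfer_ae f g v w x : 0 <= x <= 1 ->
  (forall u, measurable_fun (`[0, 1]%classic : set (measurableTypeR R)) (f u v)) ->
  (forall u, measurable_fun (`[0, 1]%classic : set (measurableTypeR R)) (g u v)) ->
  {ae mu, forall t, 0 <= t <= 1 -> t != x -> f (x < t) v t = g (x < t) v t} ->
  transfer f v w x = transfer g v w x.
Proof.
move=> /andP[x0 x1] mf mg fg.
rewrite /transfer !lintE !rintE; congr (_ * _ + _ * _); congr fine;
  apply: ae_eq_integral => //;
  try (by apply/measurable_EFinP; apply: measurable_funS (mf _) => //;
    apply: subset_itv; rewrite bnd_simp);
  try (by apply/measurable_EFinP; apply: measurable_funS (mg _) => //;
    apply: subset_itv; rewrite bnd_simp);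
  move: (ae_neq x); apply: (@filterS2 _ _ (ae_filter_ringOfSetsType mu) _ _ _ _ fg) => t;
  move=> h tx; rewrite /= in_itv/= => /andP[ta tb]; move: h; rewrite tx.
- by rewrite ta (le_trans tb)// ltNge tb => /(_ isT isT) ->.
- by rewrite tb (le_trans x0)// lt_neqAle eq_sym tx ta => /(_ isT isT) ->.
Qed.

Lemma lint_rint_integrable (f : R -> R) x : rintegrable mu f -> 0 <= x <= 1 ->
  rint f x = lint f 1 - lint f x.
Proof.
move=> fi /andP[x0 x1]; have fi' a b : mu.-integrable `[a, b] (EFin \o f).
  exact: integrableS fi.
rewrite !lintE rintE Rintegral_itvB// Rintegral_itv_obnd_cbnd//.
by apply: integrableS (fi' 0 1) => //; apply: subset_itvr; rewrite bnd_simp.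
Qed.

Lemma cont4_transfer_integrable f : rintegrable4 f -> cont4 (transfer f).
Proof.
move=> fi.
have cl u v : cont01 (lint (f u v)).
  by apply: (@parameterized_integral_continuous R 0 1 (f u v)) => //; exact: rintegrable4_itv.
move=> v w; apply: cont01D; apply: cont01Z => //.
apply: (@cont01_congr _ (fun x => lint (f true v) 1 - lint (f true v) x)).
  by move=> x x01; rewrite lint_rint_integrable//; exact: fi.
by apply: cont01B => //; exact: cont01_cst.
Qed.

End IntegrableTransfer.

(** * Reduction from the cube to quadruples on the interval *)

Section CubeReduction.
Variable R : realType.
Local Notation mu := (@lebesgue_measure R).
Local Notation mu2 := (sfprod mu mu).
Local Notation mu3 := (@lebesgue3 R).
Local Notation T := (measurableTypeR R).
Implicit Types (F : cube_space R -> R) (v w : bool).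

(** After one application of T, the coordinate x3 survives only in the letter w; y is (x1, x2), and
    v is meant to be the letter between them. The letters of the inner quadruple are dummies since F
    is evaluated at points. *)
Definition first_step F v w (y : T * T) : R :=
  transfer (fun _ _ r => F (r, y.1, y.2)) v w y.1.

Definition second_step F : vec4 R := fun v w x =>
  transfer (fun u v t => first_step F u v (t, x)) v w x.

Definition cube_step F (x : cube_space R) : R :=
  first_step F (x.1.2 < x.1.1) (x.2 < x.1.2) x.1.

Definition pattern_fun (g : vec4 R) (x : cube_space R) : R :=
  g (x.1.2 < x.1.1) (x.2 < x.1.2) x.1.1.

Lemma rintegrable_first_step F v w : rintegrable mu3 F ->
  rintegrable mu2 (first_step F v w).
Proof.
move=> Fi.
apply: (@rintegrable_transfer R _ _ mu2 fst measurable_fst (fun _ _ => F \o @lassoc _ _ _ _ _ _)).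
by move=> _ _; exact: integrable_lassoc Fi.
Qed.

Lemma rintegrable_second_step F : rintegrable mu3 F -> rintegrable4 (second_step F).
Proof.
move=> Fi v w.
apply: (@rintegrable_transfer R _ _ mu id (@measurable_id _ _ _) (first_step F)).
by move=> u u'; exact: rintegrable_first_step.
Qed.

(** For almost every x the property holds almost everywhere on the line over which T integrates at
    x, so relations known almost everywhere may be used under T. *)
Lemma ae_slide (P : cube_space R -> Prop) : {ae mu3, forall z, P z} ->
  {ae mu3, forall x, {ae mu, forall t, P (t, x.1.1, x.1.2)}}.
Proof. by move=> /ae_lassoc h; exact: (@ae_cylinder _ _ _ _ _ mu2 mu _ h). Qed.

Lemma ae_section_integrable F : rintegrable mu3 F ->
  {ae mu3, forall x, rintegrable mu (fun t => F (t, x.1.1, x.1.2))}.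
Proof.
move=> /integrable_lassoc Fi.
apply: (@ae_cylinder _ _ _ _ _ mu2 mu
  (fun y => rintegrable mu (fun t => F (t, y.1, y.2)))).
exact: (@ae_integrable2 _ _ _ _ _ mu mu2 _ Fi).
Qed.

Lemma rintegrable_measurable d (T' : measurableType d) (m : {measure set T' -> \bar R}) f :
  rintegrable m f -> measurable_fun setT f.
Proof. by move=> /measurable_int /measurable_EFinP. Qed.

Lemma measurable_section F x1 x2 : measurable_fun setT F ->
  measurable_fun setT (fun t : T => F (t, x1, x2)).
Proof.
move=> mF; apply: (measurableT_comp mF) => /=.
by apply: measurable_fun_pair => //; apply: measurable_fun_pair => //; exact: measurable_id.
Qed.

Lemma cube_step_step F F' : rintegrable mu3 F -> rintegrable mu3 F' ->
  {ae mu3, forall x, unit_cube x -> F' x = cube_step F x} ->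
  {ae mu3, forall x, unit_cube x -> cube_step F' x = pattern_fun (second_step F) x}.
Proof.
move=> Fi Fi' /ae_slide; apply: (@filterS _ _ (ae_filter_ringOfSetsType mu3)).
move=> [[x1 x2] x3] /= h [[/= x1I x2I] x3I].
rewrite /cube_step/first_step/pattern_fun/second_step/=.
apply: transfer_ae => [|_|u|].
- by move: x1I; rewrite in_itv.
- by apply: measurable_funTS; apply: measurable_section; exact: rintegrable_measurable Fi'.
- apply: measurable_funTS.
  apply: (measurableT_comp (rintegrable_measurable (rintegrable_first_step u (x2 < x1) Fi))).
  exact: pair2_measurable.
- apply: (@filterS _ _ (ae_filter_ringOfSetsType mu)) h => t h tI _.
  by apply: h; do 2!split => //=; rewrite in_itv.
Qed.

Lemma cube_step_pattern F g : rintegrable mu3 F -> rintegrable4 g ->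
  {ae mu3, forall x, unit_cube x -> F x = pattern_fun g x} ->
  {ae mu3, forall x, unit_cube x -> cube_step F x = pattern_fun (transfer g) x}.
Proof.
move=> Fi gi /ae_slide; apply: (@filterS _ _ (ae_filter_ringOfSetsType mu3)).
move=> [[x1 x2] x3] /= h [[/= x1I x2I] x3I].
apply: transfer_ae => [|_|u|].
- by move: x1I; rewrite /= in_itv.
- by apply: measurable_funTS; apply: measurable_section; exact: rintegrable_measurable Fi.
- by apply: measurable_funTS; exact: rintegrable_measurable (gi _ _).
- apply: (@filterS _ _ (ae_filter_ringOfSetsType mu)) h => t h tI _.
  by apply: h; do 2!split => //=; rewrite in_itv.
Qed.

Lemma cube_step_lin c F d F' : rintegrable mu3 F -> rintegrable mu3 F' ->
  {ae mu3, forall x, cube_step (fun x => c * F x + d * F' x) x =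
     c * cube_step F x + d * cube_step F' x}.
Proof.
move=> /ae_section_integrable Fi /ae_section_integrable Fi'.
apply: (@filterS2 _ _ (ae_filter_ringOfSetsType mu3) _ _ _ _ Fi Fi') => x i i'.
exact: (@transfer_lin_integrable R c (fun _ _ t => F (t, x.1.1, x.1.2)) d
  (fun _ _ t => F' (t, x.1.1, x.1.2))).
Qed.

Lemma ae_exists (a b : R) (P : R -> Prop) : a < b -> {ae mu, forall t, P t} ->
  exists t, a < t < b /\ P t.
Proof.
move=> ab [N [mN N0 PN]]; apply: contrapT => no.
have sub : `]a, b[%classic `<=` N.
  move=> t /=; rewrite in_itv/= => tab; apply: PN => /= Pt; apply: no.
  by exists t.
have le0 : (mu `]a, b[%classic <= 0)%E.
  by rewrite -[leRHS]N0; apply: le_measure; rewrite ?inE//; exact: measurable_itv.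
by move: le0; rewrite lebesgue_measure_itv/= lte_fin ab -EFinD lee_fin subr_le0 leNgt ab.
Qed.

(** For 0 < x1 < 1 either letter is realized by an interval of x2 of positive length, and then
    likewise by x3; a null set cannot exhaust these intervals. *)
Lemma ae_pattern (P : bool -> bool -> R -> Prop) v w :
  {ae mu3, forall x, unit_cube x -> P (x.1.2 < x.1.1) (x.2 < x.1.2) x.1.1} ->
  {ae mu, forall t, 0 <= t <= 1 -> P v w t}.
Proof.
move=> h.
have {}h := @ae_xsection _ _ _ _ _ mu2 mu _ h.
have {}h := @ae_xsection _ _ _ _ _ mu mu _ h.
apply: (@filterS3 _ _ (ae_filter_ringOfSetsType mu) _ _ _ _ _ (ae_neq 0) (ae_neq 1) h).
move=> x1 x10 x11 h1 /andP[x1ge x1le].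
have x1gt : 0 < x1 by rewrite lt_neqAle eq_sym x10.
have x1lt : x1 < 1 by rewrite lt_neqAle x11.
have [x2 [x2v x2I h2]] : exists x2, [/\ (x2 < x1) = v, 0 < x2 < 1 &
    {ae mu, forall y, unit_cube (x1, x2, y) -> P (x2 < x1) (y < x2) x1}].
  case: (v).
    have [x2 [/andP[x20 x2x1] h2]] := ae_exists x1gt h1.
    by exists x2; split => //; rewrite x20 (lt_trans x2x1).
  have [x2 [/andP[x2x1 x21] h2]] := ae_exists x1lt h1.
  by exists x2; split => //; [rewrite ltNge ltW | rewrite x21 (lt_trans x1gt)].
move: x2I => /andP[x20 x21].
have [x3 [x3w x3I h3]] : exists x3, [/\ (x3 < x2) = w, 0 < x3 < 1 &
    unit_cube (x1, x2, x3) -> P (x2 < x1) (x3 < x2) x1].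
  case: (w).
    have [x3 [/andP[x30 x3x2] h3]] := ae_exists x20 h2.
    by exists x3; split => //; rewrite x30 (lt_trans x3x2).
  have [x3 [/andP[x3x2 x31] h3]] := ae_exists x21 h2.
  by exists x3; split => //; [rewrite ltNge ltW | rewrite x31 (lt_trans x20)].
move: x3I => /andP[x30 x31].
by rewrite -x2v -x3w; apply: h3; split; [split|]; rewrite /= in_itv/= ltW ?ltW.
Qed.

Lemma rintegrable_lin c F d F' : rintegrable mu3 F -> rintegrable mu3 F' ->
  rintegrable mu3 (fun x => c * F x + d * F' x).
Proof. by move=> Fi Fi'; apply: rintegrableD; exact: rintegrableZ. Qed.

(** With z = a + i b and pairs read as complex functions, G = z F, H = z G and I = z H. Almost
    everywhere H = T^2 F is a pattern function of some g and I = T H, so K g = z g almost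
    everywhere; K g is continuous and satisfies the equation everywhere. If K g vanishes, so does I,
    and dividing three times by z gives F = 0. *)
Lemma eigen_regularize F1 F2 a b : rintegrable mu3 F1 -> rintegrable mu3 F2 ->
  {ae mu3, forall x, unit_cube x -> a * F1 x - b * F2 x = cube_step F1 x} ->
  {ae mu3, forall x, unit_cube x -> b * F1 x + a * F2 x = cube_step F2 x} ->
  exists h1 h2 : vec4 R, [/\ cont4 h1, cont4 h2,
    forall v w x, 0 <= x <= 1 -> transfer h1 v w x = a * h1 v w x - b * h2 v w x,
    forall v w x, 0 <= x <= 1 -> transfer h2 v w x = b * h1 v w x + a * h2 v w x &
    (forall v w x, 0 <= x <= 1 -> h1 v w x = 0 /\ h2 v w x = 0) -> a ^+ 2 + b ^+ 2 != 0 ->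
    {ae mu3, forall x, unit_cube x -> F1 x = 0 /\ F2 x = 0}].
Proof.
move=> i1 i2 e1 e2.
have fil := ae_filter_ringOfSetsType mu3.
have comb c d A B : rintegrable mu3 A -> rintegrable mu3 B ->
    exists2 C, rintegrable mu3 C & forall x, C x = c * A x + d * B x.
  by move=> iA iB; exists (fun x => c * A x + d * B x) => //; exact: rintegrable_lin.
have [G1 iG1 G1E] := comb a (- b) _ _ i1 i2.
have [G2 iG2 G2E] := comb b a _ _ i1 i2.
have [H1 iH1 H1E] := comb a (- b) _ _ iG1 iG2.
have [H2 iH2 H2E] := comb b a _ _ iG1 iG2.
have eG1 : {ae mu3, forall x, unit_cube x -> G1 x = cube_step F1 x}.
  by apply: (@filterS _ _ fil) e1 => x h /h <-; rewrite G1E mulNr.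
have eG2 : {ae mu3, forall x, unit_cube x -> G2 x = cube_step F2 x}.
  by apply: (@filterS _ _ fil) e2 => x h /h <-; rewrite G2E.
have [g1 ig1 KG1] : exists2 g1, rintegrable4 g1 &
    {ae mu3, forall x, unit_cube x -> cube_step G1 x = pattern_fun g1 x}.
  by exists (second_step F1); [exact: rintegrable_second_step | exact: cube_step_step].
have [g2 ig2 KG2] : exists2 g2, rintegrable4 g2 &
    {ae mu3, forall x, unit_cube x -> cube_step G2 x = pattern_fun g2 x}.
  by exists (second_step F2); [exact: rintegrable_second_step | exact: cube_step_step].
have lin c d A B A' B' C C' : rintegrable mu3 A -> rintegrable mu3 B ->
    (forall x, C x = c * A x + d * B x) -> (forall x, C' x = c * A' x + d * B' x) ->
    {ae mu3, forall x, unit_cube x -> A' x = cube_step A x} ->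
    {ae mu3, forall x, unit_cube x -> B' x = cube_step B x} ->
    {ae mu3, forall x, unit_cube x -> C' x = cube_step C x}.
  move=> iA iB /funext-> CE eA eB; have l := cube_step_lin c d iA iB.
  apply: (@filterS3 _ _ fil _ _ _ _ _ eA eB l) => x hA hB hl xc.
  by rewrite CE (hA xc) (hB xc) hl.
have eH1 := lin _ _ _ _ _ _ _ _ i1 i2 G1E H1E eG1 eG2.
have eH2 := lin _ _ _ _ _ _ _ _ i1 i2 G2E H2E eG1 eG2.
have [I1 _ I1E] := comb a (- b) _ _ iH1 iH2.
have [I2 _ I2E] := comb b a _ _ iH1 iH2.
have eI1 := lin _ _ _ _ _ _ _ _ iG1 iG2 H1E I1E eH1 eH2.
have eI2 := lin _ _ _ _ _ _ _ _ iG1 iG2 H2E I2E eH1 eH2.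
have Hg1 : {ae mu3, forall x, unit_cube x -> H1 x = pattern_fun g1 x}.
  by apply: (@filterS2 _ _ fil _ _ _ _ eH1 KG1) => x h h' xc; rewrite (h xc) (h' xc).
have Hg2 : {ae mu3, forall x, unit_cube x -> H2 x = pattern_fun g2 x}.
  by apply: (@filterS2 _ _ fil _ _ _ _ eH2 KG2) => x h h' xc; rewrite (h xc) (h' xc).
have KH1 := cube_step_pattern iH1 ig1 Hg1.
have KH2 := cube_step_pattern iH2 ig2 Hg2.
have Hg := @filterS2 _ _ fil _ _ _ (fun x h h' => conj h h') Hg1 Hg2.
have kg1 : {ae mu3, forall x, unit_cube x ->
    pattern_fun (transfer g1) x = a * pattern_fun g1 x - b * pattern_fun g2 x}.
  apply: (@filterS3 _ _ fil _ _ _ _ _ eI1 KH1 Hg) => x hI hK [h1 h2] xc.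
  by rewrite -(hK xc) -(hI xc) I1E (h1 xc) (h2 xc) mulNr.
have kg2 : {ae mu3, forall x, unit_cube x ->
    pattern_fun (transfer g2) x = b * pattern_fun g1 x + a * pattern_fun g2 x}.
  apply: (@filterS3 _ _ fil _ _ _ _ _ eI2 KH2 Hg) => x hI hK [h1 h2] xc.
  by rewrite -(hK xc) -(hI xc) I2E (h1 xc) (h2 xc).
have {}kg1 v w := @ae_pattern
  (fun v w t => transfer g1 v w t = a * g1 v w t - b * g2 v w t) v w kg1.
have {}kg2 v w := @ae_pattern
  (fun v w t => transfer g2 v w t = b * g1 v w t + a * g2 v w t) v w kg2.
have c1 : cont4 (transfer g1) by exact: cont4_transfer_integrable.
have c2 : cont4 (transfer g2) by exact: cont4_transfer_integrable.
have mc (h : vec4 R) u v : cont4 h ->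
    measurable_fun (`[0, 1]%classic : set (measurableTypeR R)) (h u v).
  by move=> ch; apply: subspace_continuous_measurable_fun => //; exact: ch.
have ml c d u v : measurable_fun (`[0, 1]%classic : set (measurableTypeR R)) (lin4 c g1 d g2 u v).
  apply: measurable_funTS.
  apply: (@rintegrable_measurable _ _ mu).
  by apply: rintegrableD; exact: rintegrableZ.
have filu := ae_filter_ringOfSetsType mu.
have KK1 v w x : 0 <= x <= 1 -> transfer (transfer g1) v w x =
    a * transfer g1 v w x - b * transfer g2 v w x.
  move=> x01; rewrite -mulNr -transfer_lin_integrable//; apply: transfer_ae => //.
  - by move=> u; exact: mc.
  - have k (u : bool) := kg1 u v; have := @filterS2 _ _ filu _ _ _ (fun x h h' => conj h h') (k false) (k true).
    apply: (@filterS _ _ filu) => t [kf kt] t01 _; rewrite /lin4 mulNr.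
    by case: (x < t); [exact: kt|exact: kf].
have KK2 v w x : 0 <= x <= 1 -> transfer (transfer g2) v w x =
    b * transfer g1 v w x + a * transfer g2 v w x.
  move=> x01; rewrite -transfer_lin_integrable//; apply: transfer_ae => //.
  - by move=> u; exact: mc.
  - have k (u : bool) := kg2 u v; have := @filterS2 _ _ filu _ _ _ (fun x h h' => conj h h') (k false) (k true).
    apply: (@filterS _ _ filu) => t [kf kt] t01 _; rewrite /lin4.
    by case: (x < t); [exact: kt|exact: kf].
exists (transfer g1), (transfer g2); split => // h0 ab0.
have solve (y z : R) : a * y - b * z = 0 -> b * y + a * z = 0 -> y = 0 /\ z = 0.
  move=> p q; split; apply: (mulfI ab0); rewrite mulr0.
  - by transitivity (a * (a * y - b * z) + b * (b * y + a * z)); [ring | rewrite p q !mulr0 addr0].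
  - by transitivity (a * (b * y + a * z) - b * (a * y - b * z)); [ring | rewrite p q !mulr0 subr0].
have KH := @filterS2 _ _ fil _ _ _ (fun x h h' => conj h h') KH1 KH2.
apply: (@filterS3 _ _ fil _ _ _ _ _ eI1 eI2 KH) => -[[x1 x2] x3] hI1 hI2 [k1 k2] xc.
have [z1 z2] : pattern_fun (transfer g1) (x1, x2, x3) = 0 /\ pattern_fun (transfer g2) (x1, x2, x3) = 0.
  by apply: h0; case: xc => -[] /=; rewrite in_itv.
have := hI1 xc; have := hI2 xc; rewrite (k1 xc) (k2 xc) z1 z2 I1E I2E mulNr => q2 q1.
have [] := solve _ _ q1 q2; rewrite H1E H2E mulNr => q3 q4.
have [] := solve _ _ q3 q4; rewrite G1E G2E mulNr => q5 q6.
exact: solve q5 q6.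
Qed.

End CubeReduction.

(** * The operator T away from ties *)

Section OperatorOnCube.
Local Open Scope complex_scope.
Variable R : realType.
Local Notation mu := (@lebesgue_measure R).
Local Notation mu2 := (sfprod mu mu).
Local Notation mu3 := (@lebesgue3 R).
Local Notation T := (measurableTypeR R).

Lemma chi_allowed (t x1 x2 x3 : R) : t != x1 -> x1 != x2 -> x2 != x3 ->
  chi t x1 x2 x3 = (allowed (x1 < t) (x2 < x1) (x3 < x2))%:R.
Proof.
by rewrite /chi /allowed; case: (ltgtP t x1) => //; case: (ltgtP x1 x2) => //;
  case: (ltgtP x2 x3).
Qed.

Lemma chi01 (t x1 x2 x3 : R) : 0 <= chi t x1 x2 x3 <= 1.
Proof. by rewrite /chi; case: ifP; rewrite !lexx ler01. Qed.

Lemma measurable_chi (x1 x2 x3 : R) :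
  measurable_fun setT (fun t : T => chi t x1 x2 x3).
Proof.
apply: measurable_fun_ifT => //; apply: measurable_or; apply: measurable_and => //;
  exact: measurable_fun_ltr.
Qed.

Lemma integral_chi (g : R -> R) (x1 x2 x3 : R) : rintegrable mu g ->
  0 <= x1 <= 1 -> x1 != x2 -> x2 != x3 ->
  \int[mu]_(t in `[0, 1]) (chi t x1 x2 x3 * g t) =
  transfer (fun _ _ => g) (x2 < x1) (x3 < x2) x1.
Proof.
move=> gi x01 x12 x23.
have mg : measurable_fun setT (g : T -> R) by exact: rintegrable_measurable gi.
have pi : rintegrable mu (fun t => chi t x1 x2 x3 * g t).
  apply: le_integrable gi => //.
    by apply/measurable_EFinP; apply: measurable_funM => //; exact: measurable_chi.
  move=> t _ /=; rewrite lee_fin normrM ler_piMl//.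
  by have /andP[c0 c1] := chi01 t x1 x2 x3; rewrite ger0_norm.
pose p4 : vec4 R := fun _ _ t => chi t x1 x2 x3 * g t.
pose q4 : vec4 R := fun u _ t => (allowed u (x2 < x1) (x3 < x2))%:R * g t.
transitivity (transfer p4 false false x1).
  by rewrite /transfer /= !mul1r lint_rint_integrable// lintE addrCA subrr addr0.
rewrite (@transfer_ae R p4 q4 false false x1 x01); first last.
- apply: (@filterS _ _ (ae_filter_ringOfSetsType mu)) (ae_neq x1) => t tx _ _.
  by rewrite /p4 /q4 chi_allowed.
- by move=> u; apply: measurable_funTS; apply: measurable_funM.
- by move=> u; apply: measurable_funTS; exact: rintegrable_measurable pi.
have gi' a b : mu.-integrable `[a, b] (EFin \o g) by exact: integrableS gi.
rewrite {1}/transfer /= !mul1r /q4 !lintE !rintE !RintegralZl//.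
Qed.

Lemma ae_graph d (T1 : measurableType d) (m1 : {sigma_finite_measure set T1 -> \bar R})
  (p : T1 -> R) : measurable_fun setT p ->
  {ae (m1 \x mu)%E, forall z, p z.1 != z.2}.
Proof.
move=> mp; exists [set z | p z.1 = z.2]; split.
- rewrite (_ : [set _ | _] = (fun z : T1 * T => p z.1 - z.2) @^-1` [set 0]).
    rewrite -[X in measurable X]setTI.
    by apply: (measurable_funB (measurableT_comp mp measurable_fst) measurable_snd).
  by apply/seteqP; split => z /=; [move=> ->; rewrite subrr | move/eqP; rewrite subr_eq0 => /eqP].
- rewrite /product_measure1; apply: integral0_eq => x _ /=.
  rewrite (_ : xsection _ _ = [set p x]) ?lebesgue_measure_set1//.
  by apply/seteqP; split => y; rewrite /xsection/= inE.
- by move=> z /= /negP; rewrite negbK => /eqP.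
Qed.

Lemma ae_no_ties : {ae mu3, forall x, x.1.1 != x.1.2 /\ x.1.2 != x.2}.
Proof.
have h1 := @ae_cylinder _ _ _ _ _ mu2 mu _ (@ae_graph _ _ mu id (@measurable_id _ _ _)).
have h2 := @ae_graph _ _ mu2 snd measurable_snd.
by apply: (@filterS2 _ _ (ae_filter_ringOfSetsType mu3) _ _ _ _ h1 h2).
Qed.

Lemma measurable_cube : measurable (@unit_cube R).
Proof. by apply: measurableX; [apply: measurableX|]; exact: measurable_itv. Qed.

Lemma cube_step_chi (F : cube_space R -> R) (f : cube_space R -> R) :
  rintegrable mu3 F -> (forall x, unit_cube x -> F x = f x) ->
  {ae mu3, forall x, unit_cube x ->
    \int[mu]_(t in `[0, 1]) (chi t x.1.1 x.1.2 x.2 * f (t, x.1.1, x.1.2)) = cube_step F x}.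
Proof.
move=> Fi Ff.
apply: (@filterS2 _ _ (ae_filter_ringOfSetsType mu3) _ _ _ _ (ae_section_integrable Fi) ae_no_ties).
move=> [[x1 x2] x3] /= si [x12 x23] [[/= x1I x2I] x3I].
have x01 : 0 <= x1 <= 1 by move: x1I; rewrite /= in_itv.
rewrite /cube_step /first_step /= -(integral_chi si x01 x12 x23).
apply: eq_Rintegral => t; rewrite inE => tI; congr (_ * _).
by rewrite Ff//; split.
Qed.

Lemma ReZ (c : R) (z : R[i]) : complex.Re (c%:C * z) = c * complex.Re z.
Proof. by case: z => p q /=; rewrite mul0r subr0. Qed.

Lemma ImZ (c : R) (z : R[i]) : complex.Im (c%:C * z) = c * complex.Im z.
Proof. by case: z => p q /=; rewrite mul0r addr0. Qed.

Lemma T_op_cube_step (f : cube_space R -> R[i]) F1 F2 :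
  rintegrable mu3 F1 -> rintegrable mu3 F2 ->
  (forall x, unit_cube x -> F1 x = complex.Re (f x)) ->
  (forall x, unit_cube x -> F2 x = complex.Im (f x)) ->
  ae_eq_cube (T_op f) (fun x => cube_step F1 x +i* cube_step F2 x).
Proof.
move=> i1 i2 e1 e2; have c1 := cube_step_chi i1 e1; have c2 := cube_step_chi i2 e2.
apply: (@filterS2 _ _ (ae_filter_ringOfSetsType mu3) _ _ _ _ c1 c2).
move=> [[x1 x2] x3] /= h1 h2 xc; rewrite -(h1 xc) -(h2 xc) /integral01.
by congr (_ +i* _); apply: eq_Rintegral => t _; rewrite ?ReZ ?ImZ.
Qed.

End OperatorOnCube.

(** * Eigenfunctions of T in L^2 and continuous eigenfunctions of K *)

Section Eigenfunctions.
Local Open Scope complex_scope.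
Variable R : realType.
Local Notation mu := (@lebesgue_measure R).
Local Notation mu3 := (@lebesgue3 R).
Local Notation T := (measurableTypeR R).
Local Notation K := (@transfer R).

Lemma lebesgue3_cube : mu3 (@unit_cube R) = 1%E.
Proof.
pose I01 : set T := `[0, 1]%classic.
have m01 : measurable I01 by exact: measurable_itv.
have mu01 : mu I01 = 1%E by rewrite lebesgue_measure_itv/= lte_fin ltr01 sube0.
have h2 := @product_measure1E _ _ T T R mu mu _ _ m01 m01.
have h3 := @product_measure1E _ _ (T * T)%type T R (mu \x mu)%E mu _ _ (measurableX m01 m01) m01.
apply: (etrans h3); rewrite [X in (X * _)%E]h2.
by move: mu01; rewrite /= => ->; rewrite !mule1.
Qed.

Lemma bounded_integrable_cube (f : cube_space R -> R) C :
  measurable_fun (@unit_cube R) f -> (forall x, unit_cube x -> `|f x| <= C) ->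
  mu3.-integrable (@unit_cube R) (EFin \o f).
Proof.
move=> mf fC; apply: measurable_bounded_integrable => //.
- exact: measurable_cube.
- by rewrite lebesgue3_cube ltry.
- exists C; split; first exact: num_real.
  by move=> M CM x xc; apply: le_trans (fC x xc) (ltW CM).
Qed.

Lemma restrict_rintegrable (f : cube_space R -> R) :
  mu3.-integrable (@unit_cube R) (EFin \o f) -> rintegrable mu3 (f \_ (@unit_cube R)).
Proof.
move=> fi; rewrite /rintegrable -restrict_EFin.
have mc : measurable (@unit_cube R) by exact: measurable_cube.
by apply/(integrable_mkcond _ mc).
Qed.

Lemma normc_sqr (z : R[i]) : Normc.normc z ^+ 2 = complex.Re z ^+ 2 + complex.Im z ^+ 2.
Proof. by case: z => p q /=; rewrite sqr_sqrtr// addr_ge0// sqr_ge0. Qed.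

(** The cube has finite measure and |p| <= 1 + (p^2 + q^2), so square integrability implies
    integrability. *)
Lemma L2_integrable (f : cube_space R -> R[i]) : L2_cube f ->
  rintegrable mu3 ((fun x => complex.Re (f x)) \_ (@unit_cube R)) /\
  rintegrable mu3 ((fun x => complex.Im (f x)) \_ (@unit_cube R)).
Proof.
move=> [mr mi fin].
pose N x : R := Normc.normc (f x) ^+ 2.
pose one : cube_space R -> R := cst 1.
have mN : measurable_fun (@unit_cube R) N.
  rewrite /N.
  under eq_fun do rewrite normc_sqr.
  by apply: measurable_funD; apply: measurable_funX.
have iN : mu3.-integrable (@unit_cube R) (fun x => (1 + N x)%:E).
  rewrite (_ : (fun x => _) = ((EFin \o one) \+ (EFin \o N))%E); last first.
    by apply/funext => x; rewrite /= EFinD.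
  apply: integrableD => //; first exact: measurable_cube.
    apply: (@bounded_integrable_cube one 1) => [|x _]; first exact: measurable_cst.
    by rewrite /one /= normr1.
  apply/integrableP; split; first exact/measurable_EFinP.
  apply: le_lt_trans fin; rewrite le_eqVlt; apply/orP; left; apply/eqP.
  by apply: eq_integral => x _; rewrite /= ger0_norm// sqr_ge0.
have small (p q : R) : `|p| <= `|1 + (p ^+ 2 + q ^+ 2)|.
  rewrite [leRHS]ger0_norm ?addr_ge0 ?sqr_ge0//.
  have q0 := sqr_ge0 q; have h1 := sqr_ge0 (p - 1); have h2 := sqr_ge0 (p + 1).
  have h3 := sqr_ge0 p; rewrite ler_norml; apply/andP; split; nra.
split; apply: restrict_rintegrable; apply: le_integrable iN => //; try exact: measurable_cube;
  try exact/measurable_EFinP.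
- by move=> x _; rewrite lee_fin /N normc_sqr.
- by move=> x _; rewrite lee_fin /N normc_sqr [X in _ + X]addrC.
Qed.

Lemma eigenfunction_regularize (m : R[i]) : T_eigenvalue m -> m != 0 ->
  exists h1 h2 : vec4 R, exists v w x, [/\ cont4 h1, cont4 h2,
    forall v w x, 0 <= x <= 1 -> K h1 v w x +i* K h2 v w x = m * (h1 v w x +i* h2 v w x),
    0 <= x <= 1 & h1 v w x +i* h2 v w x != 0].
Proof.
case: m => a b [f [fL f0 fe]] m0; have [i1 i2] := L2_integrable fL.
set F1 := _ \_ _ in i1; set F2 := _ \_ _ in i2.
have e1 x : unit_cube x -> F1 x = complex.Re (f x) by move=> xc; rewrite /F1 patchE mem_set.
have e2 x : unit_cube x -> F2 x = complex.Im (f x) by move=> xc; rewrite /F2 patchE mem_set.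
have cs := T_op_cube_step i1 i2 e1 e2.
have fil := ae_filter_ringOfSetsType mu3.
have g1 : {ae mu3, forall x, unit_cube x -> a * F1 x - b * F2 x = cube_step F1 x}.
  apply: (@filterS2 _ _ fil _ _ _ _ fe cs) => x h h' xc.
  by move: (h xc); rewrite (h' xc) e1// e2//; case: (f x) => p q [-> _].
have g2 : {ae mu3, forall x, unit_cube x -> b * F1 x + a * F2 x = cube_step F2 x}.
  apply: (@filterS2 _ _ fil _ _ _ _ fe cs) => x h h' xc.
  by move: (h xc); rewrite (h' xc) e1// e2//; case: (f x) => p q [_ ->]; rewrite addrC.
have [h1 [h2 [c1 c2 k1 k2 z]]] := eigen_regularize i1 i2 g1 g2.
have ab0 : a ^+ 2 + b ^+ 2 != 0.
  rewrite paddr_eq0 ?sqr_ge0// !sqrf_eq0; apply: contra m0 => /andP[/eqP-> /eqP->].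
  exact/eqP.
have [[v [w [x [x01 hx]]]]|no] := pselect (exists v w x, 0 <= x <= 1 /\ h1 v w x +i* h2 v w x != 0).
  exists h1, h2, v, w, x; split => // v' w' x' x01'; rewrite k1// k2//.
  by apply/eqP; rewrite eq_complex /= eqxx addrC eqxx.
exfalso; apply: f0; rewrite /ae_eq_cube.
have /z : forall v w x, 0 <= x <= 1 -> h1 v w x = 0 /\ h2 v w x = 0.
  move=> v w x x01; have : ~ (h1 v w x +i* h2 v w x != 0) by move=> h; apply: no; exists v, w, x.
  by move/negP; rewrite negbK eq_complex /= => /andP[/eqP-> /eqP->].
move=> /(_ ab0); apply: (@filterS _ _ fil) => x h xc.
move: (h xc); rewrite e1// e2//; case: (f x) => p q /= [-> ->].
by [].
Qed.

Lemma measurable_pattern (g : vec4 R) : rintegrable4 g -> measurable_fun setT (pattern_fun g).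
Proof.
move=> gi.
have mg v w : measurable_fun setT (fun x : cube_space R => g v w x.1.1).
  apply: (measurableT_comp (rintegrable_measurable (gi v w))).
  exact: (measurableT_comp measurable_fst measurable_fst).
have m12 : measurable_fun setT (fun x : cube_space R => x.1.2 < x.1.1).
  apply: measurable_fun_ltr.
    exact: (measurableT_comp measurable_snd measurable_fst).
  exact: (measurableT_comp measurable_fst measurable_fst).
have m23 : measurable_fun setT (fun x : cube_space R => x.2 < x.1.2).
  apply: measurable_fun_ltr => //.
  exact: (measurableT_comp measurable_snd measurable_fst).
rewrite (_ : pattern_fun g = fun x => if x.1.2 < x.1.1 then
    if x.2 < x.1.2 then g true true x.1.1 else g true false x.1.1 else
    if x.2 < x.1.2 then g false true x.1.1 else g false false x.1.1).
  by apply: measurable_fun_ifT => //; apply: measurable_fun_ifT.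
by apply/funext => x; rewrite /pattern_fun; case: (_ < _); case: (_ < _).
Qed.

Lemma cont4_restrict (g : vec4 R) : cont4 g -> rintegrable4 (fun v w => g v w \_ `[0, 1]).
Proof.
move=> cg v w; rewrite /rintegrable -restrict_EFin.
have m01 : measurable (`[0, 1]%classic : set T) by exact: measurable_itv.
by apply/(integrable_mkcond _ m01); exact: cont01_integrable.
Qed.

Lemma T_eigenvalue_cont4 (lam : R) (phi : vec4 R) : cont4 phi ->
  (forall v w x, 0 <= x <= 1 -> K phi v w x = lam * phi v w x) ->
  (forall x, 0 < x < 1 -> phi false false x != 0) -> T_eigenvalue lam%:C.
Proof.
move=> cphi eig phi0.
(* [rintegrable4] concerns the whole line, and nothing is known of phi outside [0, 1]. *)
pose psi : vec4 R := fun v w => phi v w \_ `[0, 1].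
have psiE v w x : 0 <= x <= 1 -> psi v w x = phi v w x.
  by move=> x01; rewrite /psi patchE mem_set//= in_itv.
have psii : rintegrable4 psi by exact: cont4_restrict.
have mpsi := measurable_pattern psii.
have [C C0 phiC] := cont4_bounded cphi.
have in01 (x : cube_space R) : unit_cube x -> 0 <= x.1.1 <= 1.
  by case: x => [[x1 x2] x3] [[]] /=; rewrite in_itv.
have bpsi x : unit_cube x -> `|pattern_fun psi x| <= C.
  by move=> /in01 x01; rewrite /pattern_fun psiE// phiC.
have mpsic : measurable_fun (@unit_cube R) (pattern_fun psi) by exact: measurable_funTS.
have fil := ae_filter_ringOfSetsType mu3.
exists (fun x => (pattern_fun psi x)%:C); split.
- split => //=.
  have : mu3.-integrable (@unit_cube R) (EFin \o (fun x => pattern_fun psi x ^+ 2)).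
    apply: (@bounded_integrable_cube _ (C ^+ 2)); first exact: measurable_funX.
    by move=> x xc; rewrite normrX ler_pXn2r ?nnegrE//; exact: bpsi.
  move=> /integrableP[_]; apply: le_lt_trans; rewrite le_eqVlt; apply/orP; left; apply/eqP.
  apply: eq_integral => x _ /=; rewrite ger0_norm ?sqr_ge0// expr0n addr0 sqr_sqrtr//.
  exact: sqr_ge0.
- move=> z; have {}z : {ae mu3, forall x, unit_cube x -> pattern_fun psi x = 0}.
    by apply: (@filterS _ _ fil) z => x h /h [].
  have h := @ae_pattern R (fun v w t => psi v w t = 0) false false z.
  have [t [/andP[t0 t1] ht]] := ae_exists (@ltr01 R) h.
  have t01 : 0 <= t <= 1 by rewrite !ltW.
  by move: (ht t01); rewrite psiE//; apply/eqP/phi0; rewrite t0.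
- pose F1 := pattern_fun psi \_ (@unit_cube R).
  have F1E x : unit_cube x -> F1 x = pattern_fun psi x.
    by move=> xc; rewrite /F1 patchE mem_set.
  have i1 : rintegrable mu3 F1 by apply: restrict_rintegrable; exact: (bounded_integrable_cube mpsic bpsi).
  pose F2 : cube_space R -> R := cst 0.
  have i2 : rintegrable mu3 F2 by exact: integrable0.
  have cs := @T_op_cube_step R (fun x => (pattern_fun psi x)%:C) F1 F2 i1 i2 F1E (fun _ _ => erefl).
  have st : {ae mu3, forall x, unit_cube x -> cube_step F1 x = pattern_fun (K psi) x}.
    apply: cube_step_pattern => //; exact: (@filterS _ _ fil _ _ (fun x _ => F1E x) (@filterT _ _ fil)).
  apply: (@filterS2 _ _ fil _ _ _ _ cs st) => x hc hs xc.
  rewrite (hc xc) (hs xc); have x01 := in01 _ xc.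
  have -> : cube_step F2 x = 0.
    by rewrite /cube_step /first_step /transfer lint_cst// rint_cst// !mul0r !mulr0 addr0.
  rewrite /pattern_fun psiE// (transfer_congr psiE)// eig//.
  by apply/eqP; rewrite eq_complex /= !mul0r !mulr0 subr0 addr0 !eqxx.
Qed.

End Eigenfunctions.

(** * Conclusion: the eigenvalue of the positive eigenfunction is the required root *)

Local Open Scope complex_scope.

(** Positivity ensures that phi + flip phi does not cancel: its aa component at 0 is phi_aa(0) +
    phi_bb(1) > 0. *)
Lemma perron_root (R : realType) (lam : R) (phi : vec4 R) : 0 < lam -> cont4 phi ->
  (forall v w x, 0 <= x <= 1 -> transfer phi v w x = lam * phi v w x) ->
  0 < phi false false 0 -> 0 <= phi true true 1 -> lambda_equation lam.
Proof.
move=> lam0 cphi eig p0 p1; apply/lambda_equationE.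
have cf : cont4 (flip4 phi) by exact: cont4_flip.
apply: (@symmetric_eigen_equation R lam (lin4 1 phi 1 (flip4 phi))) => //.
- exact: cont4_lin.
- move=> v w x x01; rewrite transfer_lin// /lin4 transfer_flip// eig// /flip4 eig//.
    by ring.
  by move: x01 => /andP[x0 x1]; apply/andP; split; lra.
- by move=> v w x x01; rewrite /lin4 /flip4 !negbK subKr addrC.
- by rewrite /lin4 /flip4 /= !mul1r subr0 gt_eqF// ltr_wpDr.
Qed.

Theorem proposition5p2 (R : realType) :
  exists lambda0 : R,
    [/\ largest_positive_root lambda0,
        largest_T_eigenvalue lambda0%:C &
        exists c r : R,
          [/\ 0 < c, 0 < r, r < lambda0 &
              (fun n : nat => (alpha n)%:R / n`!%:R
                              - c * lambda0 ^ (n%:Z - 3) : R)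
              =O_\oo (fun n : nat => r ^+ n : R)]].
Proof.
have [lam [phi [c1 [c2 [lam0 cphi c10 phib eig]]]]] := @perron R.
have phi_ge v w x : 0 <= x <= 1 -> c1 * profile v w x <= phi v w x by move=> /(phib v w)/andP[].
have phi_le v w x : 0 <= x <= 1 -> phi v w x <= c2 * profile v w x by move=> /(phib v w)/andP[].
have phi0 x : 0 <= x <= 1 -> 0 < phi false false x /\ 0 < phi true true x.
  by move=> x01; split; apply: lt_le_trans (phi_ge _ _ _ x01); rewrite /profile mulr1.
exists lam; split.
- split => //.
    have [h0 _] := phi0 0 ltac:(by rewrite lexx ler01).
    have [_ h1] := phi0 1 ltac:(by rewrite lexx ler01).
    exact: perron_root cphi eig h0 (ltW h1).
  move=> l l0 /lambda_equationE /(real_equation_eigen l0)[f [v [w [cf feig fnz]]]].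
  apply: (perron_real_le lam0 cphi c10 phi_ge phi_le eig cf feig _ fnz).
  by apply/andP; split; lra.
- have nlam : Normc.normc lam%:C = lam by rewrite /= expr0n addr0 sqrtr_sqr gtr0_norm.
  split.
    apply: (T_eigenvalue_cont4 cphi eig) => x /andP[x0 x1].
    by have [h _] := phi0 x ltac:(by rewrite !ltW); rewrite gt_eqF.
  move=> m em mlam; rewrite nlam.
  (* The regularization divides by the eigenvalue; for 0 the strict inequality is just lam > 0. *)
  have [->|m0] := eqVneq m 0; first by rewrite /= expr0n addr0 sqrtr0.
  have [h1 [h2 [v [w [x [ch1 ch2 heig x01 hnz]]]]]] := eigenfunction_regularize em m0.
  exact: (perron_dominant lam0 cphi c10 phi_ge phi_le eig ch1 ch2 heig x01 hnz).
- exact: (alpha_bigO lam0 cphi c10 phi_ge phi_le eig).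
Qed.
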